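(* For an integer $\alpha\ge 1$ let $$\psi(\alpha)=\left\lfloor \frac{5^{\alpha+1}}{4}\right\rfloor+1-\gcd(\alpha,2),\qquad \beta(\alpha)=\lfloor\alpha/2\rfloor+1 .$$ Then for all integers $\alpha\ge 1$, $$\frac{(1+5x)^{\psi(\alpha)}}{5^{\beta(\alpha)}}\cdot L_{\alpha}\in\mathbb{Z}[x].$$
   Context: Notation: $q=e^{2\pi i\tau}$ with $\tau$ in the upper half plane, and $(a;q)_{\infty}:=\prod_{j=0}^{\infty}(1-aq^j)$. The integers $d_5(n)$, $n\ge 0$, are defined by $\sum_{n\ge 0}d_5(n)q^n=\frac{(q^2;q^2)_{\infty}^{5}}{(q;q)_{\infty}^{16}}$. The function $x$ is $$x=q\,\frac{(q^2;q^2)_{\infty}(q^{10};q^{10})_{\infty}^3}{(q;q)_{\infty}^3(q^5;q^5)_{\infty}}.$$ Put $\lambda_{\alpha}:=\frac{1+3\cdot 5^{\alpha}}{4}$ for $\alpha\ge 1$. For integers $\alpha\ge 1$ define $$L_{2\alpha-1}=\frac{(q^5;q^5)_{\infty}^{16}}{(q^{10};q^{10})_{\infty}^5}\sum_{n=0}^{\infty}d_5(5^{2\alpha-1}n+\lambda_{2\alpha-1})q^{n+2},\qquad L_{2\alpha}=\frac{(q;q)_{\infty}^{16}}{(q^{2};q^{2})_{\infty}^5}\sum_{n=0}^{\infty}d_5(5^{2\alpha}n+\lambda_{2\alpha})q^{n+1}.$$ $\mathbb{Z}[x]$ denotes the ring of polynomials in the function $x$ with integer coefficients. *)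

(* Defs.v *)
From mathcomp Require Import all_boot all_order all_algebra.
From mathcomp Require Import all_classical all_reals all_analysis.
From mathcomp Require Import complex.
Set Implicit Arguments.
Unset Strict Implicit.
Unset Printing Implicit Defensive.
Import Order.TTheory GRing.Theory Num.Theory.
Import numFieldNormedType.Exports.
Local Open Scope classical_set_scope.
Local Open Scope ring_scope.
Local Open Scope complex_scope.

(* Limits below are taken over an abstract [K : numFieldType], because the norm
   topology is not inferred on the concrete type [R[i]]; they are used with
   [K := R[i]], whose norm is the complex modulus. All the products and series
   involved converge for [`|q| < 1]. *)

(* (a; q)_oo *)
Definition qpoch (K : numFieldType) (a q : K) : K :=
  lim ((fun N => \prod_(0 <= j < N) (1 - a * q ^+ j)) @ \oo).

(* (q^k; q^k)_oo *)
Definition euler (K : numFieldType) (k : nat) (q : K) : K :=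
  qpoch (q ^+ k) (q ^+ k).

Definition has_sum (K : numFieldType) (u : nat -> K) (l : K) : Prop :=
  series u @ \oo --> l.

Definition sum_series (K : numFieldType) (u : nat -> K) : K :=
  lim (series u @ \oo).

Definition cexp (R : realType) (z : R[i]) : R[i] :=
  (expR (complex.Re z))%:C * (cos (complex.Im z) +i* sin (complex.Im z)).

Definition upper_half_plane (R : realType) (tau : R[i]) : Prop :=
  0 < complex.Im tau.

Definition nome (R : realType) (tau : R[i]) : R[i] :=
  cexp ((0 +i* (2 * pi)) * tau).

(* The generating function determines [d] uniquely. *)
Definition is_d5 (R : realType) (d : nat -> int) : Prop :=
  forall tau : R[i], upper_half_plane tau ->
    let q := nome tau in
    has_sum (fun n => (d n)%:~R * q ^+ n) (euler 2 q ^+ 5 / euler 1 q ^+ 16).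

Definition x_fun (R : realType) (tau : R[i]) : R[i] :=
  let q := nome tau in
  q * (euler 2 q * euler 10 q ^+ 3 / (euler 1 q ^+ 3 * euler 5 q)).

(* The division is exact, as 5 ^ alpha = 1 modulo 4. *)
Definition lambda_shift (alpha : nat) : nat := ((1 + 3 * 5 ^ alpha) %/ 4)%N.

Definition L_fun (R : realType) (d : nat -> int) (alpha : nat) (tau : R[i]) :
    R[i] :=
  let q := nome tau in
  if odd alpha then
    euler 5 q ^+ 16 / euler 10 q ^+ 5 *
    sum_series (fun n => (d (5 ^ alpha * n + lambda_shift alpha)%N)%:~R * q ^+ (n + 2))
  else
    euler 1 q ^+ 16 / euler 2 q ^+ 5 *
    sum_series (fun n => (d (5 ^ alpha * n + lambda_shift alpha)%N)%:~R * q ^+ (n + 1)).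

(* [5 ^ (alpha + 1) %/ 4 >= 1], so the truncated subtraction is exact. *)
Definition psi_exp (alpha : nat) : nat :=
  (5 ^ (alpha + 1) %/ 4 + 1 - gcdn alpha 2)%N.

Definition beta_exp (alpha : nat) : nat := (alpha %/ 2 + 1)%N.

(* [f], a function on the upper half plane, belongs to Z[g]. *)
Definition in_int_poly_ring (R : realType) (g f : R[i] -> R[i]) : Prop :=
  exists P : {poly int}, forall tau : R[i], upper_half_plane tau ->
    f tau = (map_poly intr P).[g tau].

(* Main.v *)
(* Writing E_k = (q^k; q^k)_oo, put y = x(q^5) and p = phi(-q) / phi(-q^25), where
   phi(-q) = E_1^2 / E_2 is the sum of (-1)^n q^(n^2). The Jacobi triple product and
   two theta identities obtained by cutting a square lattice into sublattices of index
   5 give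
     1 + 4 x = E_2^2 E_5^4 / (E_1^4 E_10^2),   1 + 5 x = E_2^5 E_5 / (E_1^5 E_10),
   and multiplying out E_1(zeta q) over the fifth roots of unity zeta gives a quintic
   equation for p over Z[1 + 4 y], whence a monic quintic for x over Z[y] in which
   moreover 1 + 5 x divides (1 + 5 y)^5. Let U keep the coefficients of the q^(5 n).
   Then L_(2a) = U L_(2a-1), L_(2a+1) = W L_(2a) and L_1 = W 1, with
   W f = ((1 + 4 x) / (1 + 5 x))^6 U(p x^6 f). The quintic turns U(x^m) and U(p x^m)
   into linear recurrences in m with coefficients in Z[x]. The divisibility of
   (1 + 5 y)^5 by 1 + 5 x then shows that (1 + 5 x)^psi L_alpha lies in Z[x], while
   tracking the powers of 5 in the recurrences shows that U and W exchange two 5-adic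
   lattices of power series in x, which gives the factor 5^beta. All of this takes
   place in formal power series over Z; the identity is finally evaluated at the nome,
   and a convergent power series that vanishes on (0, 1) identifies d_5. *)
From HB Require Import structures.
Require Import Defs.
From mathcomp Require Import all_boot all_order all_algebra all_field.
From mathcomp Require Import all_classical all_reals all_analysis.
From mathcomp Require Import complex ring lra zify ssrZ.
Import Order.TTheory GRing.Theory Num.Theory.
Local Open Scope ring_scope.

Set Implicit Arguments.
Unset Strict Implicit.
Unset Printing Implicit Defensive.

(** * Formal power series *)

(** Denominators and powers of 5 are handled independently. The series 1 / (1 + 5 x) has the
    coefficients (-5)^r in x, so it preserves every 5-adic estimate used and can be ignored while
    powers of 5 are counted. The two halves meet at the end: since x = q + ..., divisibility by 5^k
    can be read off from the q-coefficients or from the x-coefficients alike. The obstacle is that U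
    gives no factor 5 on a general power of x: modulo 5 the quintic reads x^5 = y, hence U(x^5) is x
    modulo 5. The bound for the coefficient of x^r in U(x^m), about 5^((5 r - m - 6) / 6), is void
    for small r. The gain at every second step therefore rests on a cancellation in one combination
    of powers, congruent to x^2 (1 + 4 x)^6 modulo 5; a finite computation settles the small r that
    the bound leaves open. The number 4 enters because x is reached through 1 + 4 x = phi(-q^5)^2 /
    phi(-q)^2: the 5-dissection of phi(-q) has only three terms, so that U is explicit on the first
    four powers of p, which start the recurrences. *)

Record fps (R : comNzRingType) := Fps { coefs :> nat -> R }.

Section FormalPowerSeries.
Variable R : comNzRingType.
Implicit Types f g h : fps R.

Lemma fpsP f g : (forall n, f n = g n) <-> f = g.
Proof.
split=> [fg|-> //]; case: f g fg => [f] [g] /= fg.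
by congr Fps; apply: funext.
Qed.

HB.instance Definition _ := gen_eqMixin (fps R).
HB.instance Definition _ := gen_choiceMixin (fps R).

Definition fps_zero : fps R := Fps (fun=> 0).
Definition fps_add f g : fps R := Fps (fun n => f n + g n).
Definition fps_opp f : fps R := Fps (fun n => - f n).
Definition fps_one : fps R := Fps (fun n => (n == 0)%:R).
Definition fps_mul f g : fps R :=
  Fps (fun n => \sum_(i < n.+1) f i * g (n - i)%N).

Lemma fps_addA : associative fps_add.
Proof. by move=> f g h; apply/fpsP => n /=; rewrite addrA. Qed.
Lemma fps_addC : commutative fps_add.
Proof. by move=> f g; apply/fpsP => n /=; rewrite addrC. Qed.
Lemma fps_add0 : left_id fps_zero fps_add.
Proof. by move=> f; apply/fpsP => n /=; rewrite add0r. Qed.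
Lemma fps_addN : left_inverse fps_zero fps_opp fps_add.
Proof. by move=> f; apply/fpsP => n /=; rewrite addNr. Qed.

HB.instance Definition _ :=
  GRing.isZmodule.Build (fps R) fps_addA fps_addC fps_add0 fps_addN.

Definition trunc (N : nat) f : {poly R} := \poly_(i < N) f i.

Lemma coef_trunc N f i : (i < N)%N -> (trunc N f)`_i = f i.
Proof. by rewrite coef_poly => ->. Qed.

(** A coefficient of a product involves finitely many coefficients of the factors, so the ring
    axioms are inherited from polynomials by truncation. *)
Lemma fps_mulE N f g n : (n < N)%N ->
  fps_mul f g n = (trunc N f * trunc N g)`_n.
Proof.
move=> nN; rewrite coefM; apply: eq_bigr => i _.
rewrite !coef_trunc ?(leq_ltn_trans _ nN) ?leq_subr //.
by rewrite -ltnS.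
Qed.

Lemma coef_mul_eq (p p' r r' : {poly R}) n :
  (forall i, (i <= n)%N -> p`_i = p'`_i) ->
  (forall i, (i <= n)%N -> r`_i = r'`_i) -> (p * r)`_n = (p' * r')`_n.
Proof.
move=> pp rr; rewrite !coefM; apply: eq_bigr => i _.
by rewrite pp ?rr ?leq_subr // -ltnS.
Qed.

Lemma fps_mulC : commutative fps_mul.
Proof.
by move=> f g; apply/fpsP => n; rewrite !(fps_mulE _ _ (ltnSn n)) mulrC.
Qed.

Lemma fps_mulA : associative fps_mul.
Proof.
move=> f g h; apply/fpsP => n; rewrite !(fps_mulE _ _ (ltnSn n)).
transitivity ((trunc n.+1 f * (trunc n.+1 g * trunc n.+1 h))`_n).
  apply: coef_mul_eq => // i ile; rewrite coef_trunc // (@fps_mulE n.+1) //.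
rewrite mulrA; apply: coef_mul_eq => // i ile.
by rewrite coef_trunc // (@fps_mulE n.+1).
Qed.

Lemma fps_mul1 : left_id fps_one fps_mul.
Proof.
move=> f; apply/fpsP => n /=; rewrite big_ord_recl /= mul1r subn0 big1 ?addr0 //.
by move=> i _; rewrite mul0r.
Qed.

Lemma fps_mulDl : left_distributive fps_mul fps_add.
Proof.
move=> f g h; apply/fpsP => n /=; rewrite -big_split /=.
by apply: eq_bigr => i _; rewrite mulrDl.
Qed.

Lemma fps_1_neq0 : fps_one != fps_zero.
Proof.
by apply/eqP => /fpsP /(_ 0%N) /= /eqP; rewrite (oner_eq0 R).
Qed.

HB.instance Definition _ := GRing.Zmodule_isComNzRing.Build (fps R)
  fps_mulA fps_mulC fps_mul1 fps_mulDl fps_1_neq0.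

Lemma fpsDE f g n : (f + g) n = f n + g n. Proof. by []. Qed.
Lemma fpsNE f n : (- f) n = - f n. Proof. by []. Qed.
Lemma fpsBE f g n : (f - g) n = f n - g n. Proof. by []. Qed.
Lemma fps1E n : (1 : fps R) n = (n == 0)%:R. Proof. by []. Qed.
Lemma fpsME f g n : (f * g) n = \sum_(i < n.+1) f i * g (n - i)%N.
Proof. by []. Qed.

Lemma fps_sumE I (r : seq I) (P : pred I) (F : I -> fps R) n :
  (\sum_(i <- r | P i) F i) n = \sum_(i <- r | P i) F i n.
Proof.
by elim/big_rec2: _ => // i x y _ <-.
Qed.

Lemma fpsMnE f k n : (f *+ k) n = f n *+ k.
Proof. by elim: k => // k IH; rewrite !mulrS fpsDE IH. Qed.

Lemma fps_natE k n : (k%:R : fps R) n = (if n == 0%N then k%:R else 0).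
Proof. by rewrite fpsMnE fps1E; case: eqP => //; rewrite mul0rn. Qed.

Lemma fps_intE (k : int) n : (k%:~R : fps R) n = (if n == 0%N then k%:~R else 0).
Proof.
case: k => k; first by rewrite -!pmulrn fps_natE.
by rewrite !NegzE !mulrNz fpsNE -!pmulrn fps_natE; case: eqP; rewrite ?oppr0.
Qed.

Lemma fps_natME k f n : (k%:R * f) n = k%:R * f n.
Proof. by rewrite mulr_natl fpsMnE mulr_natl. Qed.

Lemma fps_intME (k : int) f n : (k%:~R * f) n = k%:~R * f n.
Proof.
case: k => k; first by rewrite -!pmulrn fps_natME.
by rewrite !NegzE !mulrNz !mulNr fpsNE -!pmulrn fps_natME.
Qed.

Definition qpow k : fps R := Fps (fun n => (n == k)%:R).

Lemma qpowE k n : qpow k n = (n == k)%:R. Proof. by []. Qed.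

Lemma qpowME k f n : (qpow k * f) n = if (k <= n)%N then f (n - k)%N else 0.
Proof.
rewrite fpsME; case: leqP => kn.
  rewrite (bigD1 (Ordinal (kn : (k < n.+1)%N))) //= eqxx mul1r big1 ?addr0 //.
  by move=> i /negbTE ik; rewrite (_ : (nat_of_ord i == k) = false) ?mul0r.
rewrite big1 // => i _; rewrite /= (_ : (nat_of_ord i == k) = false) ?mul0r //.
by apply: ltn_eqF; apply: leq_trans kn; rewrite ltnS -ltnS.
Qed.

Lemma qpowD i j : qpow (i + j)%N = qpow i * qpow j.
Proof.
apply/fpsP => n; rewrite qpowME !qpowE; case: leqP => h.
  by rewrite -(eqn_add2r i (n - i)) subnK // [(j + i)%N]addnC.
by rewrite ltn_eqF // (leq_trans h) ?leq_addr.
Qed.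

Lemma qpow0 : qpow 0 = 1. Proof. by []. Qed.

Lemma qpowX i k : qpow i ^+ k = qpow (i * k)%N.
Proof.
by elim: k => [|k IH]; [rewrite muln0 | rewrite exprS IH mulnS qpowD].
Qed.

Lemma qpow_inj k f g : qpow k * f = qpow k * g -> f = g.
Proof.
move=> /fpsP h; apply/fpsP => n; have := h (n + k)%N.
by rewrite !qpowME leq_addl addnK.
Qed.

(** Congruence modulo [q ^ K], in place of a topology on series: infinite sums and products are
    compared with finite ones for every [K], and [eqmP] concludes. *)
Definition eqm (K : nat) f g := forall n, (n < K)%N -> f n = g n.

Lemma eqm_refl K f : eqm K f f. Proof. by []. Qed.
Lemma eqm_sym K f g : eqm K f g -> eqm K g f.
Proof. by move=> h n nK; rewrite h. Qed.
Lemma eqm_trans K f g h : eqm K f g -> eqm K g h -> eqm K f h.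
Proof. by move=> fg gh n nK; rewrite fg ?gh. Qed.
Lemma eqm_le K K' f g : (K' <= K)%N -> eqm K f g -> eqm K' f g.
Proof. by move=> KK h n nK; apply: h; apply: leq_trans KK. Qed.
Lemma eqmP f g : (forall K, eqm K f g) -> f = g.
Proof. by move=> h; apply/fpsP => n; apply: (h n.+1). Qed.
Lemma eqmD K f f' g g' : eqm K f f' -> eqm K g g' -> eqm K (f + g) (f' + g').
Proof. by move=> h h' n nK; rewrite !fpsDE h ?h'. Qed.
Lemma eqmN K f f' : eqm K f f' -> eqm K (- f) (- f').
Proof. by move=> h n nK; rewrite !fpsNE h. Qed.
Lemma eqmM K f f' g g' : eqm K f f' -> eqm K g g' -> eqm K (f * g) (f' * g').
Proof.
move=> h h' n nK; rewrite !fpsME; apply: eq_bigr => i _.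
rewrite h ?h' // ?(leq_ltn_trans (leq_subr _ _)) //.
by apply: leq_ltn_trans nK; rewrite -ltnS.
Qed.
Lemma eqmX K f f' k : eqm K f f' -> eqm K (f ^+ k) (f' ^+ k).
Proof. by move=> h; elim: k => // k IH; rewrite !exprS; apply: eqmM. Qed.
Lemma eqm_sum K I (r : seq I) (P : pred I) (F G : I -> fps R) :
  (forall i, P i -> eqm K (F i) (G i)) ->
  eqm K (\sum_(i <- r | P i) F i) (\sum_(i <- r | P i) G i).
Proof. by move=> h; elim/big_rec2: _ => // i x y Pi xy; apply: eqmD => //; apply: h. Qed.
Lemma eqm_prod K I (r : seq I) (P : pred I) (F G : I -> fps R) :
  (forall i, P i -> eqm K (F i) (G i)) ->
  eqm K (\prod_(i <- r | P i) F i) (\prod_(i <- r | P i) G i).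
Proof. by move=> h; elim/big_rec2: _ => // i x y Pi xy; apply: eqmM => //; apply: h. Qed.

Lemma eqm_qpow K k f : (K <= k)%N -> eqm K (qpow k * f) 0.
Proof. by move=> Kk n nK; rewrite qpowME leqNgt (leq_trans nK Kk). Qed.

Lemma fps_shift f : f 0%N = 0 -> exists g, f = qpow 1 * g.
Proof.
move=> f0; exists (Fps (fun n => f n.+1)); apply/fpsP => n.
by rewrite qpowME; case: n => [|n] //=; rewrite subn1.
Qed.

Lemma eqm_exp0 f k : f 0%N = 0 -> eqm k (f ^+ k) 0.
Proof.
move=> /fps_shift [g ->]; rewrite exprMn qpowX mul1n; exact: eqm_qpow.
Qed.

(* An inverse only when [f 0 = 1]. *)
Definition finv f : fps R := Fps (fun n => (\sum_(i < n.+1) (1 - f) ^+ i) n).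

Lemma finv_eqm f K : f 0%N = 1 -> eqm K (finv f) (\sum_(i < K) (1 - f) ^+ i).
Proof.
move=> f0 n nK.
have [d ->] : exists d, K = (n.+1 + d)%N by exists (K - n.+1)%N; rewrite subnKC.
rewrite big_split_ord fpsDE -[LHS]addr0; congr (_ + _).
rewrite fps_sumE big1 // => i _.
apply: (@eqm_exp0 (1 - f) (n.+1 + i)) => //; last by rewrite ltnS leq_addr.
by rewrite fpsBE f0 subrr.
Qed.

Lemma finvK f : f 0%N = 1 -> f * finv f = 1.
Proof.
move=> f0; apply: eqmP => K; apply: (eqm_trans (eqmM (@eqm_refl K f) (@finv_eqm f K f0))).
have -> : f * (\sum_(i < K) (1 - f) ^+ i) = 1 - (1 - f) ^+ K.
  by rewrite -[RHS]opprB subrX1 -mulNr opprB subKr.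
rewrite -{3}[1](subr0 1); apply: eqmD => //; apply: eqmN; apply: eqm_exp0.
by rewrite fpsBE f0 subrr.
Qed.

(** The substitute for division: an identity between eta quotients is multiplied by a series of
    constant term 1 that clears its denominators, and that series is cancelled here. *)
Lemma fps_cancel f g h : f 0%N = 1 -> f * g = f * h -> g = h.
Proof.
move=> f0 e; rewrite -[g]mul1r -[h]mul1r -(finvK f0) ![f * finv f]mulrC.
by rewrite -!mulrA e.
Qed.

Lemma coef0M f g : (f * g) 0%N = f 0%N * g 0%N.
Proof. by rewrite fpsME big_ord_recl big_ord0 addr0. Qed.

Lemma coef0X f k : (f ^+ k) 0%N = f 0%N ^+ k.
Proof. by elim: k => [|k IH]; rewrite // !exprS coef0M IH. Qed.

Lemma coef0_finv f : finv f 0%N = 1.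
Proof. by rewrite /= big_ord_recl big_ord0 addr0. Qed.

Definition fsub (k : nat) f : fps R :=
  Fps (fun n => if (k %| n)%N then f (n %/ k)%N else 0).

Lemma fsub_additive k : zmod_morphism (fsub k).
Proof.
by move=> f g; apply/fpsP => n /=; case: ifP; rewrite ?subr0.
Qed.

Lemma sum_dvdn (k m : nat) (F : nat -> R) : (0 < k)%N ->
  \sum_(i < (m * k).+1) (if (k %| i)%N then F (i %/ k)%N else 0) =
  \sum_(i < m.+1) F i.
Proof.
move=> k0; elim: m => [|m IH].
  by rewrite mul0n !big_ord1 /= dvdn0 div0n.
rewrite [RHS]big_ord_recr /= -IH mulSn addnC -addSn big_split_ord /=; congr (_ + _).
case: k k0 {IH} => // k _; rewrite big_ord_recr /= big1 => [|i _].
  rewrite add0r (_ : ((m * k.+1).+1 + k = m.+1 * k.+1)%N); last by lia.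
  by rewrite dvdn_mull // mulnK.
rewrite (_ : ((m * k.+1).+1 + i = m * k.+1 + i.+1)%N); last by lia.
by rewrite dvdn_addr ?dvdn_mull // gtnNdvd // ltnS.
Qed.

Lemma fsub_multiplicative k : (0 < k)%N -> monoid_morphism (fsub k).
Proof.
move=> k0; split.
  apply/fpsP => n; rewrite /=; case: ifP => kn.
    by rewrite /= -{2}(divnK kn) muln_eq0 [k == _]gtn_eqF // orbF.
  by case: n kn => //; rewrite dvdn0.
move=> f g; apply/fpsP => n; rewrite fpsME /=; case: ifP => kn.
  rewrite -(divnK kn) mulnK //; move: (n %/ k)%N => m.
  rewrite -(@sum_dvdn k m (fun i => f i * g (m - i)%N)) //; apply: eq_bigr => i _.
  case: ifP => ki; rewrite ?mul0r //.
  have im : (i <= m * k)%N by rewrite -ltnS.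
  by rewrite dvdn_subr ?dvdn_mull // ki divnBr // mulnK.
rewrite big1 // => i _; case: ifP => ki; rewrite ?mul0r //.
have im : (i <= n)%N by rewrite -ltnS.
by rewrite dvdn_subl // kn mulr0.
Qed.

Definition fdec (k : nat) f : fps R := Fps (fun n => f (k * n)%N).

Lemma fdec_additive k : zmod_morphism (fdec k).
Proof. by move=> f g; apply/fpsP. Qed.

End FormalPowerSeries.

Arguments qpow R k%_N.
Arguments eqm {R} K%_N f g.
Arguments fsub {R} k%_N f.
Arguments fdec {R} k%_N f.

(** * Substitution of q^k for q, and decimation *)

Section Substitution.
Variable R : comNzRingType.
Implicit Types f g h : fps R.

HB.instance Definition _ k :=
  GRing.isZmodMorphism.Build (fps R) (fps R) (fsub k) (@fsub_additive R k).
HB.instance Definition _ k := GRing.isMonoidMorphism.Build (fps R) (fps R)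
  (fsub k.+1) (@fsub_multiplicative R k.+1 isT).
HB.instance Definition _ k :=
  GRing.isZmodMorphism.Build (fps R) (fps R) (fdec k) (@fdec_additive R k).

Lemma fsubE k f n : fsub k f n = if (k %| n)%N then f (n %/ k)%N else 0.
Proof. by []. Qed.

Lemma fdecE k f n : fdec k f n = f (k * n)%N. Proof. by []. Qed.

Lemma fsub_comp j k f : (0 < j)%N -> (0 < k)%N ->
  fsub j (fsub k f) = fsub (j * k) f.
Proof.
move=> j0 k0; apply/fpsP => n; rewrite !fsubE.
have [jn|jn] := boolP (j %| n)%N.
  rewrite -(divnK jn) mulnK // ![(_ * j)%N]mulnC; move: (n %/ j)%N => m.
  by rewrite dvdn_pmul2l // divnMl.
by case: ifP => // jkn; case/negP: jn; apply: dvdn_trans jkn; apply: dvdn_mulr.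
Qed.

Lemma fsub_qpow k i : (0 < k)%N -> fsub k (qpow R i) = qpow R (k * i)%N.
Proof.
move=> k0; apply/fpsP => n; rewrite fsubE !qpowE; case: ifP => kn.
  by rewrite -{2}(divnK kn) mulnC eqn_pmul2l.
by rewrite (_ : (n == _) = false) //; apply: contraFF kn => /eqP ->; apply: dvdn_mulr.
Qed.

Lemma fsub_coef0 k f : fsub k f 0%N = f 0%N.
Proof. by rewrite fsubE dvdn0 div0n. Qed.

Lemma fdecK k f : (0 < k)%N -> fdec k (fsub k f) = f.
Proof. by move=> k0; apply/fpsP => n; rewrite fdecE fsubE dvdn_mulr // mulKn. Qed.

(** The projection formula: it turns an equation with coefficients in q^k into a recurrence for
    decimated series with coefficients in q. *)
Lemma fdec_fsubM k f g : (0 < k)%N -> fdec k (fsub k f * g) = f * fdec k g.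
Proof.
move=> k0; apply/fpsP => n; rewrite fdecE !fpsME mulnC.
rewrite -(@sum_dvdn R k n (fun i => f i * fdec k g (n - i)%N)) //.
apply: eq_bigr => i _; rewrite fsubE; case: ifP => ki; rewrite ?mul0r //.
by rewrite fdecE mulnBr [(k * (i %/ k))%N]mulnC divnK // [(k * n)%N]mulnC.
Qed.

Lemma fdec_qpowM k i f : (0 < k)%N ->
  fdec k (qpow R i * fsub k f) = if (k %| i)%N then qpow R (i %/ k) * f else 0.
Proof.
move=> k0; case: ifP => ki; last first.
  apply/fpsP => n; rewrite fdecE qpowME; case: leqP => // le; rewrite fsubE.
  by rewrite dvdn_subr ?dvdn_mulr // ki.
case: k k0 ki => // k k0 ki.
by rewrite -{1}(divnK ki) mulnC -fsub_qpow // -rmorphM fdecK.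
Qed.

Lemma eqm_fdec k K f g : (0 < k)%N ->
  eqm (k * K)%N f g -> eqm K (fdec k f) (fdec k g).
Proof. by move=> k0 h n nK; rewrite !fdecE; apply: h; rewrite ltn_pmul2l. Qed.

Lemma eqm_fsub k K f g : eqm K f g -> eqm K (fsub k f) (fsub k g).
Proof.
move=> h n nK; rewrite !fsubE; case: ifP => // kn; apply: h.
by apply: leq_ltn_trans nK; apply: leq_div.
Qed.

End Substitution.

(** * Infinite products *)

Section FormalProducts.
Variable R : comNzRingType.
Implicit Types (f g : fps R) (u v : nat -> fps R).

(* Only the first [n + 1] factors of such a product affect the coefficient of
   [q ^ n]; [fprod] is meaningless otherwise. *)
Definition tame u := forall i, eqm i.+1 (u i) 1.

Definition fprod u : fps R := Fps (fun n => (\prod_(i < n.+1) u i) n).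

Lemma eqm_prod1 K I (r : seq I) (P : pred I) (F : I -> fps R) :
  (forall i, P i -> eqm K (F i) 1) -> eqm K (\prod_(i <- r | P i) F i) 1.
Proof.
move=> h; have := @eqm_prod R K I r P F (fun=> 1) h.
by rewrite big1_eq.
Qed.

Lemma fprod_eqm u K m : tame u -> (K <= m)%N ->
  eqm K (fprod u) (\prod_(i < m) u i).
Proof.
move=> tu Km n nK.
have [d ->] : exists d, m = (n.+1 + d)%N by exists (m - n.+1)%N; rewrite subnKC // (leq_trans nK).
rewrite big_split_ord; transitivity ((\prod_(i < n.+1) u i * 1) n); first by rewrite mulr1.
apply: (@eqmM _ n.+1) => //; apply: eqm_sym; apply: eqm_prod1 => i _.
by apply: eqm_le (tu _); rewrite ltnS /= leqW ?leq_addr.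
Qed.

Lemma fprod_coef0 u : tame u -> fprod u 0%N = 1.
Proof. by move=> tu; rewrite /= big_ord1 (tu 0%N). Qed.

Lemma fprod_fsub k u : tame u ->
  tame (fun i => fsub k.+1 (u i)) /\ fsub k.+1 (fprod u) = fprod (fun i => fsub k.+1 (u i)).
Proof.
move=> tu; have t : tame (fun i => fsub k.+1 (u i)).
  by move=> i; rewrite -(rmorph1 (fsub k.+1)); apply: eqm_fsub; apply: tu.
split=> //; apply: eqmP => K.
apply: eqm_trans (eqm_sym (fprod_eqm t (leqnn K))).
by rewrite -rmorph_prod; apply: eqm_fsub; apply: fprod_eqm.
Qed.

Lemma tame_qpow (c : fps R) (e : nat -> nat) : (forall i, (i < e i)%N) ->
  tame (fun i => 1 + c * qpow R (e i)).
Proof.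
move=> h i; rewrite -[X in eqm _ _ X]addr0; apply: eqmD => //.
by rewrite mulrC; apply: eqm_qpow.
Qed.

(* (q^k; q^k)_oo *)
Definition feuler k : fps R := fprod (fun i => 1 - qpow R (k * i.+1)%N).

Lemma tame_feuler k : (0 < k)%N -> tame (fun i => 1 - qpow R (k * i.+1)%N).
Proof.
move=> k0 i; rewrite -mulN1r; apply: (@tame_qpow (-1) (fun i => k * i.+1)%N).
by move=> j; apply: leq_pmull.
Qed.

Lemma feuler_eqm k K m : (0 < k)%N -> (K <= m)%N ->
  eqm K (feuler k) (\prod_(i < m) (1 - qpow R (k * i.+1)%N)).
Proof. by move=> k0; apply: fprod_eqm; apply: tame_feuler. Qed.

Lemma feuler0 k : (0 < k)%N -> feuler k 0%N = 1.
Proof. by move=> k0; apply: fprod_coef0; apply: tame_feuler. Qed.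

Lemma fsub_feuler j k : (0 < k)%N -> fsub j.+1 (feuler k) = feuler (j.+1 * k).
Proof.
move=> k0; rewrite (fprod_fsub j (tame_feuler k0)).2; congr fprod; apply: funext => i.
by rewrite rmorphB rmorph1 /= fsub_qpow // mulnA.
Qed.

End FormalProducts.

Arguments feuler R k%_N.

(** * Change of coefficient ring, used to adjoin fifth roots of unity *)

Section CoefficientMap.
Variables (R S : comNzRingType) (phi : {rmorphism R -> S}).

Definition fmap (f : fps R) : fps S := Fps (fun n => phi (f n)).

Lemma fmap_additive : zmod_morphism fmap.
Proof. by move=> f g; apply/fpsP => n /=; rewrite rmorphB. Qed.

Lemma fmap_multiplicative : monoid_morphism fmap.
Proof.
split; first by apply/fpsP => n /=; rewrite rmorph_nat.
move=> f g; apply/fpsP => n; rewrite fpsME /= rmorph_sum.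
by apply: eq_bigr => i _; rewrite rmorphM.
Qed.

HB.instance Definition _ :=
  GRing.isZmodMorphism.Build (fps R) (fps S) fmap fmap_additive.
HB.instance Definition _ :=
  GRing.isMonoidMorphism.Build (fps R) (fps S) fmap fmap_multiplicative.

Lemma fmapE f n : fmap f n = phi (f n). Proof. by []. Qed.

Lemma fmap_qpow i : fmap (qpow R i) = qpow S i.
Proof. by apply/fpsP => n; rewrite fmapE !qpowE rmorph_nat. Qed.

Lemma fmap_fsub k f : fmap (fsub k f) = fsub k (fmap f).
Proof. by apply/fpsP => n; rewrite fmapE !fsubE; case: ifP; rewrite ?rmorph0. Qed.

Lemma fmap_feuler k : fmap (feuler R k) = feuler S k.
Proof.
apply/fpsP => n; rewrite /= -[phi _]/(fmap _ n) rmorph_prod; congr (coefs _ n).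
by apply: eq_bigr => i _; rewrite rmorphB rmorph1 /= fmap_qpow.
Qed.

End CoefficientMap.

(** * Sums over arbitrary index sets *)

Section GeneratingSums.
Variable R : comNzRingType.
Implicit Types f g : fps R.

(* [f] is the sum over [i] of [s i * q ^ e i], each exponent being taken
   finitely often. *)
Definition gensum (I : eqType) (e : I -> nat) (s : I -> fps R) f :=
  forall N, exists r : seq I, [/\ uniq r, forall i, (e i < N)%N -> i \in r &
    eqm N f (\sum_(i <- r) s i * qpow R (e i))].

Lemma eqm_filter N (I : eqType) (e : I -> nat) (s : I -> fps R) (r : seq I) :
  eqm N (\sum_(i <- r) s i * qpow R (e i))
    (\sum_(i <- r | (e i < N)%N) s i * qpow R (e i)).
Proof.
rewrite (bigID (fun i => (e i < N)%N)) /= -[X in eqm _ _ X]addr0.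
apply: eqmD => //; elim/big_ind: _ => // [x y hx hy|i].
  by rewrite -[0]addr0; apply: eqmD.
by rewrite -leqNgt mulrC => h; apply: eqm_qpow.
Qed.

Lemma gensum_eqm N (I : eqType) (e : I -> nat) (s : I -> fps R) (r : seq I) f :
  gensum e s f -> uniq r -> (forall i, (e i < N)%N -> i \in r) ->
  eqm N f (\sum_(i <- r) s i * qpow R (e i)).
Proof.
move=> /(_ N)[t [ut ht ft]] ur hr; apply: eqm_trans ft _.
apply: eqm_trans (@eqm_filter N I e s t) _.
apply: eqm_trans _ (eqm_sym (@eqm_filter N I e s r)).
rewrite -big_filter -[X in eqm _ _ X]big_filter (perm_big [seq i <- r | (e i < N)%N]) //.
apply: uniq_perm; rewrite ?filter_uniq // => i; rewrite !mem_filter.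
by case: ltnP => //= h; rewrite ht ?hr.
Qed.

Lemma gensum_unique (I : eqType) (e : I -> nat) (s : I -> fps R) f g :
  gensum e s f -> gensum e s g -> f = g.
Proof.
move=> hf hg; apply: eqmP => N; have [r [ur hr gr]] := hg N.
exact: eqm_trans (gensum_eqm hf ur hr) (eqm_sym gr).
Qed.

Lemma eq_gensum (I : eqType) (e e' : I -> nat) (s s' : I -> fps R) f :
  e =1 e' -> s =1 s' -> gensum e s f -> gensum e' s' f.
Proof.
move=> ee ss h N; have [r [ur hr fr]] := h N; exists r; split=> //.
  by move=> i; rewrite -ee; apply: hr.
by under eq_bigr do rewrite -ee -ss.
Qed.

Lemma gensum_bij (I J : eqType) (h : J -> I) (h' : I -> J)
    (e : I -> nat) (s : I -> fps R) f :
  cancel h h' -> cancel h' h ->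
  gensum e s f -> gensum (e \o h) (s \o h) f.
Proof.
move=> hK h'K hf N; have [r [ur hr fr]] := hf N; exists (map h' r); split.
- by rewrite map_inj_uniq //; apply: can_inj h'K.
- by move=> j /= ej; rewrite -[j]hK map_f // hr.
- by rewrite big_map; under eq_bigr do rewrite /= h'K.
Qed.

Lemma gensumM (I J : eqType) (e : I -> nat) (s : I -> fps R)
    (e' : J -> nat) (s' : J -> fps R) f g :
  gensum e s f -> gensum e' s' g ->
  gensum (fun ij : I * J => (e ij.1 + e' ij.2)%N) (fun ij => s ij.1 * s' ij.2)
    (f * g).
Proof.
move=> hf hg N; have [r [ur hr fr]] := hf N; have [t [ut ht gt]] := hg N.
exists [seq (i, j) | i <- r, j <- t]; split.
- by apply: allpairs_uniq => // -[? ?] [? ?].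
- move=> [i j] /= eij; apply/allpairsP; exists (i, j); split=> //=.
    by apply: hr; apply: leq_ltn_trans eij; apply: leq_addr.
  by apply: ht; apply: leq_ltn_trans eij; apply: leq_addl.
- apply: eqm_trans (eqmM fr gt) _; rewrite big_allpairs_dep /= big_distrl /=.
  rewrite (eq_bigr (fun i => \sum_(j <- t) s i * s' j * qpow R (e i + e' j)%N)) // => i _.
  by rewrite big_distrr /=; apply: eq_bigr => j _; rewrite qpowD; ring.
Qed.

(** The right-hand side of a dissection is a finite sum of series. Its index set becomes the
    disjoint union [K * I], which [gensum_surj] maps bijectively onto the index set of the left-hand
    side. *)
Lemma gensum_bigcup (K : finType) (I : eqType) (e : K -> I -> nat)
    (s : K -> I -> fps R) (F : K -> fps R) :
  (forall k, gensum (e k) (s k) (F k)) ->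
  gensum (fun ki : K * I => e ki.1 ki.2) (fun ki => s ki.1 ki.2)
    (\sum_k F k).
Proof.
move=> h N; have /choice[r hr] : forall k, exists r : seq I,
    [/\ uniq r, forall i, (e k i < N)%N -> i \in r &
      eqm N (F k) (\sum_(i <- r) s k i * qpow R (e k i))] by move=> k; apply: h.
exists [seq (k, i) | k <- enum K, i <- r k]; split.
- apply: allpairs_uniq_dep; first exact: enum_uniq.
    by move=> k _; case: (hr k).
  by move=> [? ?] [? ?] _ _ /= [-> ->].
- move=> [k i] /= eki; apply/allpairsPdep; exists k, i; split=> //.
    by rewrite mem_enum.
  by case: (hr k) => _ hk _; apply: hk.
- rewrite big_allpairs_dep /= big_enum /=; apply: eqm_sum => k _.
  by case: (hr k).
Qed.

Definition irange (n : nat) : seq int := [seq k%:Z - n%:Z | k <- iota 0 (n + n).+1].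

Lemma irange_uniq n : uniq (irange n).
Proof. by rewrite map_inj_uniq ?iota_uniq // => i j; lia. Qed.

Lemma mem_irange n (i : int) : (i \in irange n) = (`|i| <= n)%N.
Proof.
apply/mapP/idP => [[k]|h]; first by rewrite mem_iota => /andP[_ kn] ->; lia.
by exists (absz (i + n%:Z)); rewrite ?mem_iota; lia.
Qed.

(* The bilateral series with terms [s i * q ^ e i]; the summation range is
   exact as soon as [|i| <= e i + 2]. *)
Definition theta (e : int -> nat) (s : int -> fps R) : fps R :=
  Fps (fun n => (\sum_(i <- irange (n + 2)) s i * qpow R (e i)) n).

Lemma theta_gensum (e : int -> nat) (s : int -> fps R) :
  (forall i, `|i| <= e i + 2)%N -> gensum e s (theta e s).
Proof.
move=> h N; exists (irange (N + 2)); split=> [||n nN]; first exact: irange_uniq.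
  by move=> i iN; rewrite mem_irange; have := h i; lia.
rewrite /theta /=; move: (ltnSn n).
suff : eqm n.+1 (\sum_(i <- irange (n + 2)) s i * qpow R (e i))
   (\sum_(i <- irange (N + 2)) s i * qpow R (e i)) by exact.
apply: eqm_trans (@eqm_filter _ _ _ _ _) _.
apply: eqm_trans _ (eqm_sym (@eqm_filter _ _ _ _ _)).
rewrite -big_filter -[X in eqm _ _ X]big_filter.
rewrite (perm_big [seq i <- irange (N + 2) | (e i < n.+1)%N]) //.
apply: uniq_perm; rewrite ?filter_uniq ?irange_uniq // => i.
rewrite !mem_filter !mem_irange; case: ltnP => //= ei.
by have := h i; lia.
Qed.

End GeneratingSums.

(** * Gaussian binomial coefficients *)

Section TripleProduct.
Variable R : comNzRingType.

(** The Gaussian binomial coefficient, given by the q-Pascal rule so that no division occurs. *)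
Fixpoint gbin (Q : R) (n k : nat) : R :=
  match n, k with
  | _, 0 => 1
  | 0, _.+1 => 0
  | n'.+1, k'.+1 => gbin Q n' k' + Q ^+ k * gbin Q n' k
  end.

Lemma gbin0 Q n : gbin Q n 0 = 1. Proof. by case: n. Qed.

Lemma gbinS Q n k : gbin Q n.+1 k.+1 = gbin Q n k + Q ^+ k.+1 * gbin Q n k.+1.
Proof. by []. Qed.

Lemma gbin_small Q n k : (n < k)%N -> gbin Q n k = 0.
Proof.
elim: n k => [|n IH] [|k] // nk; rewrite gbinS !IH ?mulr0 ?addr0 //.
exact: ltnW.
Qed.

Lemma gbinn Q n : gbin Q n n = 1.
Proof. by elim: n => // n IH; rewrite gbinS IH gbin_small ?mulr0 ?addr0. Qed.

Definition qfact (Q : R) n := \prod_(i < n) (1 - Q ^+ i.+1).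

Lemma gbin_fact Q n k : (k <= n)%N ->
  gbin Q n k * qfact Q k * qfact Q (n - k) = qfact Q n.
Proof.
elim: n k => [|n IH] [|k] kn; rewrite ?gbin0 ?subn0 /= ?mul1r //.
- by rewrite /qfact !big_ord0 mulr1.
- by rewrite {1}/qfact big_ord0 mul1r.
rewrite -/(gbin Q n.+1 k.+1) gbinS subSS; have [kn'|] := ltnP k n; last first.
  move=> nk; have -> : k = n by apply/eqP; rewrite eqn_leq nk andbT -ltnS.
  by rewrite subnn gbinn gbin_small // mulr0 addr0 mul1r {2}/qfact big_ord0 mulr1.
have e1 := IH k (ltnW kn'); have e2 := IH k.+1 kn'.
have sk : (n - k = (n - k.+1).+1)%N by lia.
have qS m : qfact Q m.+1 = qfact Q m * (1 - Q ^+ m.+1) by rewrite /qfact big_ord_recr.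
rewrite [RHS]qS mulrDl mulrDl.
have -> : gbin Q n k * qfact Q k.+1 * qfact Q (n - k) = qfact Q n * (1 - Q ^+ k.+1).
  by rewrite qS -e1; ring.
have -> : Q ^+ k.+1 * gbin Q n k.+1 * qfact Q k.+1 * qfact Q (n - k) =
    qfact Q n * Q ^+ k.+1 * (1 - Q ^+ (n - k)).
  have -> : qfact Q (n - k) = qfact Q (n - k.+1) * (1 - Q ^+ (n - k)).
    by rewrite [in LHS]sk qS -sk.
  by rewrite -e2; ring.
have -> : Q ^+ n.+1 = Q ^+ k.+1 * Q ^+ (n - k) by rewrite -exprD; congr (_ ^+ _); lia.
by ring.
Qed.

(** The q-binomial theorem, by splitting off the factor [i = 0] and replacing [z] by [z * Q]. It is
    kept homogeneous in [y] because the triple product takes [y = Q ^ N], which avoids negative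
    powers of q. *)
Lemma gauss_binomial (Q y z : R) n :
  \prod_(i < n) (y + z * Q ^+ i) =
  \sum_(k < n.+1) Q ^+ 'C(k, 2) * gbin Q n k * z ^+ k * y ^+ (n - k).
Proof.
elim: n z => [|n IH] z.
  by rewrite big_ord0 big_ord1 /= !expr0 !mulr1.
rewrite big_ord_recl expr0 mulr1.
under eq_bigr => i _ do rewrite /= /bump add1n exprS mulrA.
rewrite IH mulrDl !big_distrr /=.
rewrite [RHS]big_ord_recl /= ?gbin0 ?bin0n ?expr0 ?mulr1 ?mul1r subn0.
rewrite big_ord_recl /= ?gbin0 ?bin0n ?expr0 ?mulr1 ?mul1r subn0 -exprS -addrA; congr (_ + _).
under [RHS]eq_bigr => i _ do rewrite /bump /= add1n subSS -/(gbin Q n.+1 i.+1).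
transitivity (\sum_(i < n.+1) (Q ^+ 'C(i.+1, 2) * (gbin Q n i.+1 * Q ^+ i.+1) * z ^+ i.+1 * y ^+ (n
  - i)) +
   \sum_(i < n.+1) (Q ^+ 'C(i.+1, 2) * gbin Q n i * z ^+ i.+1 * y ^+ (n - i))).
  congr (_ + _).
    rewrite big_ord_recr /= gbin_small // !(mulr0, mul0r) addr0.
    apply: eq_bigr => i _; rewrite /bump /= add1n exprMn.
    rewrite (_ : (n - i = (n - i.+1).+1)%N) ?exprS; first by ring.
    by have := ltn_ord i; lia.
  apply: eq_bigr => i _; rewrite exprMn binS bin1 exprD exprS; ring.
rewrite -big_split /=; apply: eq_bigr => i _; ring.
Qed.

End TripleProduct.

(** * The Jacobi triple product *)

Section JacobiTripleProduct.
Variables (R : comNzRingType) (A B : nat) (eps : fps R) (e : int -> nat).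
Hypotheses (B0 : (0 < B)%N) (BA : (B < A)%N) (eps2 : eps * eps = 1).
Hypothesis e_ge : forall j : int, (`|j| <= e j + 2)%N.
Hypothesis eE : forall j : int,
  (2 * e j)%:Z = A%:Z * j * (j - 1) + 2 * B%:Z * j.

Let Q := qpow R A.
Let s (j : int) := eps ^+ absz j.
Let factorl i := 1 + eps * qpow R (A * i + (A - B))%N.
Let factorr i := 1 + eps * qpow R (A * i + B)%N.
(** The exponent that makes all exponents of the symmetric finite product nonnegative. *)
Let c0 N := (B * N + A * ('C(N, 2) + N * N))%N.

Lemma eps_exp i j : odd i = odd j -> eps ^+ i = eps ^+ j.
Proof.
have h k : eps ^+ k = eps ^+ odd k.
  rewrite -{1}(odd_double_half k) exprD -mul2n exprM expr2 eps2 expr1n mulr1 //.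
by move=> ij; rewrite h ij -h.
Qed.

Lemma Qpow i : Q ^+ i = qpow R (A * i)%N. Proof. exact: qpowX. Qed.

(** The q-binomial theorem for the [2 N] factors [Q ^ N + eps * q ^ B * Q ^ i]. The last [N] of them
    give [factorr] after [Q ^ N] is taken out; the first [N] give [factorl] in reverse order after
    the other summand is taken out. *)
Lemma jtp_finite N :
  (\prod_(i < N) factorl i) * (\prod_(i < N) factorr i) =
  \sum_(k < (N + N).+1) gbin Q (N + N) k * s (k%:Z - N%:Z) * qpow R (e (k%:Z - N%:Z)).
Proof.
apply: (@qpow_inj R (c0 N)).
have epsN : eps ^+ N * eps ^+ N = 1 by rewrite -exprMn eps2 expr1n.
suff H : eps ^+ N * (qpow R (c0 N) * ((\prod_(i < N) factorl i) * (\prod_(i < N) factorr i))) =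
  eps ^+ N * (qpow R (c0 N) * (\sum_(k < (N + N).+1) gbin Q (N + N) k * s (k%:Z - N%:Z) * qpow R (e
    (k%:Z - N%:Z)))).
  have inv z : z = eps ^+ N * (eps ^+ N * z) by rewrite mulrA epsN mul1r.
  by rewrite [LHS]inv [RHS]inv H.
transitivity (\prod_(i < N + N) (Q ^+ N + eps * qpow R B * Q ^+ i)).
  rewrite big_split_ord /=.
  have -> : \prod_(i < N) (Q ^+ N + eps * qpow R B * Q ^+ (N + i)) =
      qpow R (A * (N * N)) * \prod_(i < N) factorr i.
    have -> : qpow R (A * (N * N)) = \prod_(i < N) Q ^+ N.
      by rewrite prodr_const card_ord -exprM Qpow.
    rewrite -big_split /=; apply: eq_bigr => i _.
    by rewrite /factorr exprD qpowD -Qpow; ring.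
  have -> : \prod_(i < N) (Q ^+ N + eps * qpow R B * Q ^+ i) =
      eps ^+ N * qpow R (B * N) * Q ^+ 'C(N, 2) * \prod_(i < N) factorl i.
    have -> : \prod_(i < N) factorl i = \prod_(i < N) factorl (N - i.+1)%N.
      by rewrite (reindex_inj rev_ord_inj).
    have -> : eps ^+ N * qpow R (B * N) * Q ^+ 'C(N, 2) = \prod_(i < N) (eps * qpow R B * Q ^+ i).
      rewrite big_split /= prodr_const card_ord exprMn (qpowX R B N); congr (_ * _).
      by rewrite -bin2_sum expr_sum big_mkord.
    rewrite -big_split /=; apply: eq_bigr => i _; rewrite /factorl mulrDr mulr1 addrC.
    congr (_ + _); rewrite !Qpow.
    transitivity (eps * eps * qpow R (B + A * i + (A * (N - i.+1) + (A - B)))); last by rewrite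
      !qpowD; ring.
    rewrite eps2 mul1r; congr (qpow R _); have iN := ltn_ord i.
    rewrite -{1}(subnKC iN); move: (N - i.+1)%N => d; nia.
  rewrite /c0 qpowD mulnDr qpowD -Qpow; ring.
rewrite gauss_binomial !big_distrr /=; apply: eq_bigr => k _.
have kN : (k <= N + N)%N by rewrite -ltnS.
rewrite exprMn (qpowX R B k) -!exprM !Qpow.
transitivity (eps ^+ k * gbin Q (N + N) k * qpow R (A * 'C(k, 2) + B * k + A * (N * (N + N - k)))).
  by rewrite !qpowD; ring.
have -> : eps ^+ k = eps ^+ N * s (k%:Z - N%:Z).
  by rewrite -exprD; apply: eps_exp; lia.
have -> : (A * 'C(k, 2) + B * k + A * (N * (N + N - k)) = c0 N + e (k%:Z - N%:Z))%N.
  have := eE (k%:Z - N%:Z).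
  have b2 m : (2 * 'C(m, 2))%:Z = m%:Z * (m%:Z - 1).
    have -> : (2 * 'C(m, 2) = m * m.-1)%N by rewrite -mul_bin_diag bin1.
    by case: m => // m; rewrite /= PoszM; congr (_ * _); lia.
  have := b2 k; have := b2 N; rewrite /c0.
  move: (nat_of_ord k) kN => m kN.
  have [d dE] : exists d, (N + N = m + d)%N by exists (N + N - m)%N; rewrite subnKC.
  have -> : (N + N - m = d)%N by lia.
  move: (e _) ('C(m, 2)) ('C(N, 2)) => x u v hv hu hx.
  have : A%:Z * (2 * u)%:Z = A%:Z * (m%:Z * (m%:Z - 1)) by rewrite hu.
  have : A%:Z * (2 * v)%:Z = A%:Z * (N%:Z * (N%:Z - 1)) by rewrite hv.
  have : A%:Z * N%:Z * (N + N)%:Z = A%:Z * N%:Z * (m + d)%:Z by rewrite dE.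
  nia.
rewrite qpowD; ring.
Qed.

(** The limit of [jtp_finite]. With [N = 2 K + 2], a term of exponent below [K] has both [k] and
    [2 N - k] at least [K]; modulo [q ^ K] the quotient of q-factorials in [gbin_fact] is then the
    inverse of [feuler R A]. *)
Lemma jacobi_triple :
  feuler R A * fprod factorl * fprod factorr = theta e s.
Proof.
have A0 : (0 < A)%N by apply: leq_ltn_trans BA.
apply: eqmP => K; pose N := (K + K + 2)%N.
have KN : (K <= N)%N by rewrite /N; lia.
have tl : tame factorl by apply: (@tame_qpow R eps (fun i => A * i + (A - B))%N) => i; nia.
have tr : tame factorr by apply: (@tame_qpow R eps (fun i => A * i + B)%N) => i; nia.
have -> : eqm K (feuler R A * fprod factorl * fprod factorr) (theta e s) =
   eqm K (feuler R A * (fprod factorl * fprod factorr)) (theta e s) by rewrite mulrA.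
apply: (@eqm_trans _ K _ (feuler R A * ((\prod_(i < N) factorl i) * (\prod_(i < N) factorr i)))).
  by apply: eqmM => //; apply: eqmM; apply: fprod_eqm.
rewrite jtp_finite.
have ths : gensum e s (theta e s) := theta_gensum s e_ge.
apply: eqm_trans _ (eqm_sym (@gensum_eqm _ K _ _ _ (irange N) _ ths (irange_uniq N) _)); last first.
  by move=> i ei; rewrite mem_irange; have := e_ge i; rewrite /N; lia.
rewrite /irange big_map -[iota 0 _]/(index_iota 0 (N + N).+1) big_mkord big_distrr /=.
apply: eqm_sum => k _.
have kN : (k <= N + N)%N by rewrite -ltnS.
have [le|lt] := leqP K (e (k%:Z - N%:Z)).
  apply: (@eqm_trans _ _ _ 0).
    by rewrite !mulrA mulrC; apply: eqm_qpow.
  by apply: eqm_sym; rewrite mulrC; apply: eqm_qpow.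
have kb : (K <= k)%N /\ (K <= N + N - k)%N.
  by have := e_ge (k%:Z - N%:Z); move: lt; rewrite /N; lia.
have -> (g x y : fps R) : feuler R A * (g * x * y) = (g * feuler R A) * (x * y) by ring.
rewrite -[X in eqm _ _ X]mul1r; apply: eqmM => //.
have qfactE m : (K <= m)%N -> eqm K (qfact Q m) (feuler R A).
  move=> Km; apply: eqm_sym; apply: eqm_trans (feuler_eqm _ A0 Km) _.
  by rewrite /qfact; under [X in eqm _ _ X]eq_bigr do rewrite Qpow.
have := gbin_fact Q kN; set g := gbin _ _ _ => hg.
have h1 : eqm K (g * feuler R A * feuler R A) (feuler R A).
  apply: eqm_trans (qfactE (N + N)%N _); last by rewrite /N; lia.
  rewrite -hg; apply: eqmM; [apply: eqmM => // |]; apply: eqm_sym; apply: qfactE; tauto.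
have f0 : feuler R A 0%N = 1 by apply: feuler0.
have := eqmM h1 (@eqm_refl _ K (finv (feuler R A))).
by rewrite -[X in eqm _ X _]mulrA (finvK f0) mulr1.
Qed.

End JacobiTripleProduct.

(** * Products split by residue classes *)

Section ProductSplitting.
Variable R : comNzRingType.
Implicit Types u v : nat -> fps R.

Lemma fprodM u v : tame u -> tame v ->
  fprod u * fprod v = fprod (fun i => u i * v i).
Proof.
move=> tu tv; have t : tame (fun i => u i * v i).
  by move=> i; rewrite -[1]mulr1; apply: eqmM; [apply: tu | apply: tv].
apply: eqmP => K; apply: eqm_trans (eqmM (fprod_eqm tu (leqnn K)) (fprod_eqm tv (leqnn K))) _.
by rewrite -big_split; apply: eqm_sym; apply: fprod_eqm.
Qed.

Lemma fprod_split m u : (0 < m)%N -> tame u ->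
  fprod u = \prod_(c < m) fprod (fun i => u (m * i + c)%N).
Proof.
move=> m0 tu; apply: eqmP => K.
apply: eqm_trans (@fprod_eqm _ u K (K * m) tu (leq_pmulr _ m0)) _.
have -> : \prod_(i < K * m) u i = \prod_(c < m) \prod_(i < K) u (m * i + c)%N.
  rewrite exchange_big /=; elim: K => [|K IH]; first by rewrite !big_ord0.
  rewrite [RHS]big_ord_recr /= -IH mulSn addnC big_split_ord /=; congr (_ * _).
  by rewrite mulnC.
apply: eqm_prod => c _; apply: eqm_sym; apply: fprod_eqm => // i.
by apply: eqm_le (tu _); rewrite ltnS; apply: leq_trans (leq_addr _ _); apply: leq_pmull.
Qed.

Lemma tameB (e : nat -> nat) : (forall i, (i < e i)%N) ->
  tame (fun i => 1 - qpow R (e i)).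
Proof. by move=> h i; rewrite -mulN1r; apply: tame_qpow. Qed.

Lemma tameD (e : nat -> nat) : (forall i, (i < e i)%N) ->
  tame (fun i => 1 + qpow R (e i)).
Proof. by move=> h i; rewrite -[qpow _ _]mul1r; apply: tame_qpow. Qed.

(* (q^c; q^m)_oo and (-q^c; q^m)_oo *)
Definition minus_prod m c : fps R := fprod (fun i => 1 - qpow R (m * i + c)%N).
Definition plus_prod m c : fps R := fprod (fun i => 1 + qpow R (m * i + c)%N).

Arguments minus_prod (m c)%_N.
Arguments plus_prod (m c)%_N.

Lemma minus_plus_prod m c : (0 < m)%N -> (0 < c)%N ->
  minus_prod m c * plus_prod m c = minus_prod (2 * m) (2 * c).
Proof.
move=> m0 c0; rewrite fprodM; [|by apply: tameB => i; nia|by apply: tameD => i; nia].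
congr fprod; apply: funext => i.
rewrite (_ : (2 * m * i + 2 * c = (m * i + c) + (m * i + c))%N); last by lia.
by rewrite (qpowD _ (m * i + c) (m * i + c)); ring.
Qed.

Lemma minus_prod_split d m c : (0 < d)%N -> (0 < m)%N -> (0 < c)%N ->
  minus_prod m c = \prod_(j < d) minus_prod (d * m) (m * j + c).
Proof.
move=> d0 m0 c0; rewrite /minus_prod (@fprod_split d) //.
  apply: eq_bigr => j _; congr fprod; apply: funext => i; congr (1 - qpow R _).
  by lia.
by apply: tameB => i; nia.
Qed.

Lemma feulerE k : (0 < k)%N -> feuler R k = minus_prod k k.
Proof. by move=> k0; congr fprod; apply: funext => i; rewrite mulnS addnC. Qed.

End ProductSplitting.

Arguments minus_prod R (m c)%_N.
Arguments plus_prod R (m c)%_N.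

(** * Ramanujan theta functions *)

Section JacobiTheta.
Variable R : comNzRingType.

Definition tri (j : int) : nat := (absz (j * (j + 1))%R %/ 2)%N.

Lemma triE j : (2 * tri j)%:Z = j * (j + 1).
Proof.
rewrite /tri mulnC divnK; first by nia.
by rewrite dvdn2 abszM oddM; lia.
Qed.

(** The exponent A j (j - 1) / 2 + B j, which is nonnegative for 0 < B < A. Thus [jtheta A B eps] is
    Ramanujan's f(eps q^B, eps q^(A - B)) for a sign [eps]. *)
Definition jexp (A B : nat) (j : int) : nat :=
  absz (A%:Z * (tri (j - 1))%:Z + B%:Z * j).

Lemma jexpE A B j : (0 < B)%N -> (B < A)%N ->
  (2 * jexp A B j)%:Z = A%:Z * j * (j - 1) + 2 * B%:Z * j.
Proof.
move=> B0 BA; have := triE (j - 1); rewrite /jexp subrK.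
move: (tri _) => t ht.
have h : A%:Z * (2 * t)%:Z = A%:Z * ((j - 1) * j) by rewrite ht.
have [d dE] : exists d, A = (B + d.+1)%N by exists (A - B).-1%N; lia.
have j2 : 0 <= j * (j - 1) by nia.
have j3 : 0 <= j * (j + 1) by nia.
suff : 0 <= A%:Z * j * (j - 1) + 2 * B%:Z * j by nia.
have -> : A%:Z * j * (j - 1) + 2 * B%:Z * j = B%:Z * (j * (j + 1)) + d.+1%:Z * (j * (j - 1)).
  by rewrite dE PoszD; ring.
by apply: addr_ge0; apply: mulr_ge0.
Qed.

Lemma jexp_ge A B j : (0 < B)%N -> (B < A)%N -> (absz j <= jexp A B j + 2)%N.
Proof.
move=> B0 BA; have := jexpE j B0 BA.
have [d dE] : exists d, A = (B + d.+1)%N by exists (A - B).-1%N; lia.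
have -> : A%:Z * j * (j - 1) + 2 * B%:Z * j = B%:Z * (j * (j + 1)) + d.+1%:Z * (j * (j - 1)).
  by rewrite dE PoszD; ring.
have j2 : 0 <= j * (j - 1) by nia.
have j3 : 0 <= j * (j + 1) by nia.
have h1 : j * (j + 1) <= B%:Z * (j * (j + 1)) by rewrite ler_peMl //; lia.
have h2 : j * (j - 1) <= d.+1%:Z * (j * (j - 1)) by rewrite ler_peMl.
by nia.
Qed.

Definition jtheta (A B : nat) (eps : fps R) : fps R :=
  theta (jexp A B) (fun j => eps ^+ absz j).

Lemma jtheta_gensum A B eps : (0 < B)%N -> (B < A)%N ->
  gensum (jexp A B) (fun j => eps ^+ absz j) (jtheta A B eps).
Proof. by move=> B0 BA; apply: theta_gensum => j; apply: jexp_ge. Qed.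

Lemma jtheta_minus A B : (0 < B)%N -> (B < A)%N ->
  jtheta A B (-1) = feuler R A * minus_prod R A (A - B) * minus_prod R A B.
Proof.
move=> B0 BA; rewrite /jtheta -(@jacobi_triple R A B (-1)) ?mulrNN ?mulr1 //; first last.
- by move=> j; apply: jexpE.
- by move=> j; apply: jexp_ge.
by congr (_ * _ * _); congr fprod; apply: funext => i; rewrite mulN1r.
Qed.

Lemma jtheta_plus A B : (0 < B)%N -> (B < A)%N ->
  jtheta A B 1 = feuler R A * plus_prod R A (A - B) * plus_prod R A B.
Proof.
move=> B0 BA; rewrite /jtheta -(@jacobi_triple R A B 1) ?mulr1 //; first last.
- by move=> j; apply: jexpE.
- by move=> j; apply: jexp_ge.
by congr (_ * _ * _); congr fprod; apply: funext => i; rewrite mul1r.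
Qed.

(** In Ramanujan's notation these six are phi(-q), psi(q), f(-q, -q^9), f(-q^3, -q^7), f(q, q^4) and
    f(q^2, q^3). *)
Definition phi : fps R := jtheta 2 1 (-1).
Definition psi : fps R := jtheta 4 1 1.
Definition f19 : fps R := jtheta 10 9 (-1).
Definition f37 : fps R := jtheta 10 7 (-1).
Definition f14 : fps R := jtheta 5 1 1.
Definition f23 : fps R := jtheta 5 2 1.

Lemma phi_feuler : phi * feuler R 2 = feuler R 1 ^+ 2.
Proof.
rewrite /phi jtheta_minus // (@feulerE R 1) // (@minus_prod_split R 2 1 1) //.
by rewrite !big_ord_recr big_ord0 /= (@feulerE R 2) //; ring.
Qed.

Lemma psi_feuler : psi * feuler R 1 = feuler R 2 ^+ 2.
Proof.
rewrite /psi jtheta_plus // (@feulerE R 1) // (@minus_prod_split R 4 1 1) //.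
rewrite (@feulerE R 2) // (@minus_prod_split R 2 2 2) // (@feulerE R 4) //.
rewrite !big_ord_recr !big_ord0 /=.
have e1 : minus_prod R 4 1 * plus_prod R 4 1 = minus_prod R 8 2 by exact: minus_plus_prod.
have e3 : minus_prod R 4 3 * plus_prod R 4 3 = minus_prod R 8 6 by exact: minus_plus_prod.
have e2 : minus_prod R 4 2 = minus_prod R 8 2 * minus_prod R 8 6.
  by rewrite (@minus_prod_split R 2 4 2) // !big_ord_recr big_ord0 /= mul1r.
transitivity (minus_prod R 4 4 ^+ 2 * minus_prod R 4 2 * ((minus_prod R 4 1 * plus_prod R 4 1) *
  (minus_prod R 4 3 * plus_prod R 4 3))).
  by ring.
by rewrite e1 e3 -e2; ring.
Qed.

Lemma f19_f37 : f19 * f37 * feuler R 2 * feuler R 5 = feuler R 1 * feuler R 10 ^+ 3.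
Proof.
rewrite /f19 /f37 !jtheta_minus // (@feulerE R 1) // (@minus_prod_split R 10 1 1) //.
rewrite (@feulerE R 2) // (@minus_prod_split R 5 2 2) //.
rewrite (@feulerE R 5) // (@minus_prod_split R 2 5 5) // (@feulerE R 10) //.
by rewrite !big_ord_recr !big_ord0 /=; ring.
Qed.

Lemma f14_f23 : f14 * f23 * feuler R 1 * feuler R 10 = feuler R 2 * feuler R 5 ^+ 3.
Proof.
rewrite /f14 /f23 !jtheta_plus // (@feulerE R 1) // (@minus_prod_split R 5 1 1) //.
rewrite (@feulerE R 2) // (@minus_prod_split R 5 2 2) //.
rewrite (@feulerE R 5) // (@feulerE R 10) // !big_ord_recr !big_ord0 /=.
have e c := @minus_plus_prod R 5 c isT.
rewrite -[minus_prod R (5 * 2) (2 * 0 + 2)](e 1%N) // -[minus_prod R _ (2 * 1 + 2)](e 2%N) //.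
rewrite -[minus_prod R _ (2 * 2 + 2)](e 3%N) // -[minus_prod R _ (2 * 3 + 2)](e 4%N) //.
by ring.
Qed.

End JacobiTheta.

Section GensumOperations.
Variable R : comNzRingType.
Implicit Types f g : fps R.

Lemma gensum_shift (I : eqType) (e : I -> nat) (s : I -> fps R) f m c :
  gensum e s f ->
  gensum (fun i => m + e i)%N (fun i => c * s i) (c * qpow R m * f).
Proof.
move=> hf N; have [r [ur hr fr]] := hf N; exists r; split=> //.
  by move=> i ei; apply: hr; apply: leq_ltn_trans ei; apply: leq_addl.
apply: eqm_trans (eqmM (@eqm_refl _ _ (c * qpow R m)) fr) _.
rewrite big_distrr /= (eq_bigr (fun i => c * s i * qpow R (m + e i)%N)) // => i _.
by rewrite qpowD; ring.
Qed.

Lemma gensum_fsub k (I : eqType) (e : I -> nat) (s : I -> fps R) f :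
  (forall i, fsub k.+1 (s i) = s i) ->
  gensum e s f -> gensum (fun i => k.+1 * e i)%N s (fsub k.+1 f).
Proof.
move=> hs hf N; have [r [ur hr fr]] := hf N; exists r; split=> //.
  by move=> i ei; apply: hr; apply: leq_ltn_trans ei; apply: leq_pmull.
apply: eqm_trans (eqm_fsub _ fr) _; rewrite rmorph_sum /=.
under [X in eqm _ X _]eq_bigr => i _ do rewrite rmorphM /= hs fsub_qpow //.
by [].
Qed.

Lemma gensum_surj (I J : eqType) (h : J -> I) (e : I -> nat) (s : I -> fps R)
    (e' : J -> nat) (s' : J -> fps R) f g :
  injective h -> (forall i, exists j, h j = i) ->
  e \o h =1 e' -> s \o h =1 s' ->
  gensum e s f -> gensum e' s' g -> f = g.
Proof.
move=> inj /choice[h' h'K] ee ss hf hg.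
have hK : cancel h h' by move=> j; apply: inj; rewrite h'K.
apply: gensum_unique hg; apply: eq_gensum ee ss _.
exact: gensum_bij hK h'K hf.
Qed.

End GensumOperations.

(** * Theta identities of level 5 *)

Section ThetaDissections.
Variable R : comNzRingType.

Let eps_sub k i : fsub k.+1 ((-1) ^+ i : fps R) = (-1) ^+ i.
Proof. by rewrite rmorphXn rmorphN1. Qed.

Let one_sub k (i : nat) : fsub k.+1 ((1 : fps R) ^+ i) = 1 ^+ i.
Proof. by rewrite rmorphXn rmorph1. Qed.

Let pick5 (T : Type) (a b c d e : T) (k : 'I_5) :=
  nth a [:: a; b; c; d; e] k.

Lemma signE i j : odd i = odd j -> (-1) ^+ i = (-1) ^+ j :> fps R.
Proof. by move=> h; rewrite -signr_odd h signr_odd. Qed.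

(** Squares are 0, 1 or 4 modulo 5. The integers are split into 5 k, the two classes of sign times
    (5 k + 1) and the two of sign times (5 k + 2); opposite classes contribute equally, whence the
    factors 2. *)
Lemma phi_dissection :
  phi R = fsub 25 (phi R) - 2 * qpow R 1 * fsub 5 (f37 R)
          + 2 * qpow R 4 * fsub 5 (f19 R).
Proof.
pose F := pick5 (fsub 25 (phi R)) (-1 * qpow R 1 * fsub 5 (f37 R))
  (-1 * qpow R 1 * fsub 5 (f37 R)) (1 * qpow R 4 * fsub 5 (f19 R))
  (1 * qpow R 4 * fsub 5 (f19 R)).
pose E k (j : int) : nat := pick5 (25 * jexp 2 1 j)%N (1 + 5 * jexp 10 7 j)%N
  (1 + 5 * jexp 10 7 j)%N (4 + 5 * jexp 10 9 j)%N (4 + 5 * jexp 10 9 j)%N k.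
pose s k (j : int) : fps R := pick5 ((-1) ^+ absz j) (-1 * (-1) ^+ absz j)
  (-1 * (-1) ^+ absz j) (1 * (-1) ^+ absz j) (1 * (-1) ^+ absz j) k.
have gp := @jtheta_gensum R 2 1 (-1) isT isT.
have g37 := @jtheta_gensum R 10 7 (-1) isT isT.
have g19 := @jtheta_gensum R 10 9 (-1) isT isT.
have hF k : gensum (E k) (s k) (F k).
  have h0 : gensum (fun j => 25 * jexp 2 1 j)%N (fun j => (-1) ^+ absz j) (fsub 25 (phi R)).
    exact: gensum_fsub gp.
  have h1 : gensum (fun j => 1 + 5 * jexp 10 7 j)%N (fun j => -1 * (-1) ^+ absz j)
      (-1 * qpow R 1 * fsub 5 (f37 R)).
    by apply: gensum_shift; apply: gensum_fsub g37.
  have h2 : gensum (fun j => 4 + 5 * jexp 10 9 j)%N (fun j => 1 * (-1) ^+ absz j)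
      (1 * qpow R 4 * fsub 5 (f19 R)).
    by apply: gensum_shift; apply: gensum_fsub g19.
  by case: k => [[|[|[|[|[|k]]]]] hk].
have hsum := gensum_bigcup hF.
pose h (kj : 'I_5 * int) : int :=
  pick5 (5 * kj.2) (5 * kj.2 + 1) (- (5 * kj.2) - 1) (5 * kj.2 + 2) (- (5 * kj.2) - 2) kj.1.
transitivity (\sum_k F k); last first.
  by rewrite !big_ord_recr big_ord0 /= /F /pick5 /=; ring.
apply: (gensum_surj (h := h) _ _ _ _ gp hsum).
- move=> [[[|[|[|[|[|k]]]]] hk] j] [[[|[|[|[|[|k']]]]] hk'] j']; rewrite /h /pick5 //= => e;
    try (by exfalso; lia); congr (_, _); try (by apply: val_inj); lia.
- move=> i; have [t] : exists t : int, i = 5 * t \/ i = 5 * t + 1 \/ i = 5 * t + 2 \/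
    i = 5 * t + 3 \/ i = 5 * t + 4 by exists (i %/ 5)%Z; lia.
  move=> [->|[->|[->|[->|->]]]].
  + by exists (@Ordinal 5 0 isT, t).
  + by exists (@Ordinal 5 1 isT, t).
  + by exists (@Ordinal 5 3 isT, t).
  + by exists (@Ordinal 5 4 isT, - t - 1); rewrite /h /pick5 /=; ring.
  + by exists (@Ordinal 5 2 isT, - t - 1); rewrite /h /pick5 /=; ring.
- move=> [k j]; have := @jexpE 2 1 (h (k, j)) isT isT; have := @jexpE 2 1 j isT isT.
  have := @jexpE 10 7 j isT isT; have := @jexpE 10 9 j isT isT.
  by case: k => [[|[|[|[|[|k]]]]] hk]; rewrite /h /E /pick5 /=; lia.
- move=> [k j]; case: k => [[|[|[|[|[|k]]]]] hk]; rewrite /h /s /pick5 //= -?exprS ?mul1r;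
  apply: signE; lia.
Qed.

(* The index set Z[i] is cut into the multiples of 2 - i, which give the first
   term on the right, and four cosets permuted by the units. *)
Lemma phi_lattice :
  phi R ^+ 2 = fsub 5 (phi R) ^+ 2 - 4 * qpow R 1 * (f19 R * f37 R).
Proof.
pose G := -1 * qpow R 1 * (f19 R * f37 R).
pose F := pick5 (fsub 5 (phi R) * fsub 5 (phi R)) G G G G.
have gp := @jtheta_gensum R 2 1 (-1) isT isT.
have g37 := @jtheta_gensum R 10 7 (-1) isT isT.
have g19 := @jtheta_gensum R 10 9 (-1) isT isT.
pose e0 (j : int * int) := (5 * jexp 2 1 j.1 + 5 * jexp 2 1 j.2)%N.
pose e1 (j : int * int) := (1 + (jexp 10 9 j.1 + jexp 10 7 j.2))%N.
pose s0 (j : int * int) : fps R := (-1) ^+ absz j.1 * (-1) ^+ absz j.2.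
pose s1 (j : int * int) : fps R := -1 * ((-1) ^+ absz j.1 * (-1) ^+ absz j.2).
pose E k (j : int * int) : nat := pick5 (e0 j) (e1 j) (e1 j) (e1 j) (e1 j) k.
pose s k (j : int * int) : fps R := pick5 (s0 j) (s1 j) (s1 j) (s1 j) (s1 j) k.
have hF k : gensum (E k) (s k) (F k).
  have h0 : gensum e0 s0 (fsub 5 (phi R) * fsub 5 (phi R)).
    have g5 := @gensum_fsub R 4 _ _ _ _ (fun i => eps_sub 4 (absz i)) gp.
    exact: (gensumM g5 g5).
  have h1 : gensum e1 s1 G by exact: (gensum_shift 1 (-1) (gensumM g19 g37)).
  by case: k => [[|[|[|[|[|k]]]]] hk].
have hsum := gensum_bigcup hF.
(* Class 0 is w = (2 - i)(m + n i); classes 1 to 4 are u (w + 1) for u = 1, i, -i, -1. The norm of w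
   + 1 is 1 + (5 m^2 + 4 m) + (5 n^2 + 2 n), which separates into the exponents of [f19] and
   [f37]. *)
pose h (kj : 'I_5 * (int * int)) : int * int :=
  let: (k, (m, n)) := kj in
  pick5 (2 * m + n, 2 * n - m) (2 * m + n + 1, 2 * n - m)
    (m - 2 * n, 2 * m + n + 1) (2 * n - m, - (2 * m + n + 1))
    (- (2 * m + n + 1), m - 2 * n) k.
transitivity (\sum_k F k); last first.
  by rewrite !big_ord_recr big_ord0 /= /F /pick5 /= /G; ring.
rewrite expr2; apply: (gensum_surj (h := h) _ _ _ _ (gensumM gp gp) hsum).
- move=> [[[|[|[|[|[|k]]]]] hk] [m n]] [[[|[|[|[|[|k']]]]] hk'] [m' n']];
    rewrite /h /pick5 //= => -[ea eb]; try (by exfalso; lia);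
    congr (_, (_, _)); try (by apply: val_inj); lia.
- move=> [a b]; have [t] : exists t : int, a = 5 * t - 2 * b \/ a = 5 * t + 1 - 2 * b \/
    a = 5 * t + 2 - 2 * b \/ a = 5 * t + 3 - 2 * b \/ a = 5 * t + 4 - 2 * b.
    by exists ((a + 2 * b) %/ 5)%Z; lia.
  move=> [->|[->|[->|[->|->]]]].
  + by exists (@Ordinal 5 0 isT, (2 * t - b, t)); rewrite /h /pick5 /=; congr (_, _); ring.
  + by exists (@Ordinal 5 1 isT, (2 * t - b, t)); rewrite /h /pick5 /=; congr (_, _); ring.
  + by exists (@Ordinal 5 2 isT, (t, b - 1 - 2 * t)); rewrite /h /pick5 /=; congr (_, _); ring.
  + by exists (@Ordinal 5 3 isT, (- t - 1, - b + 1 + 2 * t)); rewrite /h /pick5 /=; congr (_, _); ring.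
  + by exists (@Ordinal 5 4 isT, (b - 2 * t - 2, - t - 1)); rewrite /h /pick5 /=; congr (_, _); ring.
- move=> [k [m n]]; have := @jexpE 2 1 (h (k, (m, n))).1 isT isT.
  have := @jexpE 2 1 (h (k, (m, n))).2 isT isT.
  have := @jexpE 2 1 m isT isT; have := @jexpE 2 1 n isT isT.
  have := @jexpE 10 9 m isT isT; have := @jexpE 10 7 n isT isT.
  by case: k => [[|[|[|[|[|k]]]]] hk]; rewrite /h /E /pick5 /e0 /e1 /=; lia.
- move=> [k [m n]]; case: k => [[|[|[|[|[|k]]]]] hk];
    rewrite /h /s /pick5 /s0 /s1 //= -!exprD -?exprS; apply: signE; lia.
Qed.

(* The sum over all integers covers every triangular number twice. *)
Definition psi2 : fps R := theta tri (fun=> 1).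

Lemma psi2_gensum : gensum tri (fun=> 1) psi2.
Proof. by apply: theta_gensum => j; have := triE j; nia. Qed.

Lemma psi2E : psi2 = 2 * psi R.
Proof.
have gp := @jtheta_gensum R 4 1 1 isT isT.
have hsum : gensum (fun ki : bool * int => jexp 4 1 ki.2) (fun ki => 1 ^+ absz ki.2) (\sum_(k :
  bool) psi R).
  exact: (gensum_bigcup (fun=> gp)).
pose h (kj : bool * int) : int := if kj.1 then 2 * kj.2 - 1 else - (2 * kj.2).
transitivity (\sum_(k : bool) psi R); last by rewrite big_bool /=; ring.
apply: (gensum_surj (h := h) _ _ _ _ psi2_gensum hsum).
- move=> [[] j] [[] j']; rewrite /h /= => e; try (by exfalso; lia); congr (_, _); lia.
- move=> i; have [t [->|->]] : exists t : int, i = 2 * t - 1 \/ i = - (2 * t).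
    have [e|e] : (i %% 2)%Z = 0 \/ (i %% 2)%Z = 1 by lia.
      by exists (- (i %/ 2)%Z); lia.
    by exists ((i %/ 2)%Z + 1); lia.
    by exists (true, t).
  by exists (false, t).
- move=> [k j]; have := triE (h (k, j)); have := @jexpE 4 1 j isT isT.
  by case: k; rewrite /h /=; lia.
- by move=> [k j] /=; rewrite expr1n.
Qed.

(** As 8 [tri j] + 1 = (2 j + 1)^2, the square runs over the Gaussian integers with odd coordinates.
    The multiples of 2 - i, class 1 of [h], give the term in q; multiplication by the units permutes
    the other four classes. *)
Lemma psi2_lattice :
  psi2 ^+ 2 = qpow R 1 * fsub 5 psi2 ^+ 2 + 4 * (f14 R * f23 R).
Proof.
pose G := f14 R * f23 R.
pose F := pick5 G (1 * qpow R 1 * (fsub 5 psi2 * fsub 5 psi2)) G G G.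
have gp := psi2_gensum.
have g14 := @jtheta_gensum R 5 1 1 isT isT.
have g23 := @jtheta_gensum R 5 2 1 isT isT.
pose e1 (j : int * int) := (1 + (5 * tri j.1 + 5 * tri j.2))%N.
pose e0 (j : int * int) := (jexp 5 1 j.1 + jexp 5 2 j.2)%N.
pose s1 (j : int * int) : fps R := 1 * (1 * 1).
pose s0 (j : int * int) : fps R := 1 ^+ absz j.1 * 1 ^+ absz j.2.
pose E k (j : int * int) : nat := pick5 (e0 j) (e1 j) (e0 j) (e0 j) (e0 j) k.
pose s k (j : int * int) : fps R := pick5 (s0 j) (s1 j) (s0 j) (s0 j) (s0 j) k.
have hF k : gensum (E k) (s k) (F k).
  have h0 : gensum e0 s0 G by exact: (gensumM g14 g23).
  have h1 : gensum e1 s1 (1 * qpow R 1 * (fsub 5 psi2 * fsub 5 psi2)).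
    have g5 := @gensum_fsub R 4 _ _ _ _ (fun i => one_sub 4 0) gp.
    exact: (gensum_shift 1 1 (gensumM g5 g5)).
  by case: k => [[|[|[|[|[|k]]]]] hk].
have hsum := gensum_bigcup hF.
pose h (kj : 'I_5 * (int * int)) : int * int :=
  let: (k, (m, n)) := kj in
  pick5 (- m - 2 * n, n - 2 * m) (2 * m + n + 1, 2 * n - m)
    (m + 2 * n - 1, 2 * m - n - 1) (n - 2 * m, m + 2 * n - 1)
    (2 * m - n - 1, - m - 2 * n) k.
transitivity (\sum_k F k); last first.
  by rewrite !big_ord_recr big_ord0 /= /F /pick5 /= /G; ring.
rewrite expr2; apply: (gensum_surj (h := h) _ _ _ _ (gensumM gp gp) hsum).
- move=> [[[|[|[|[|[|k]]]]] hk] [m n]] [[[|[|[|[|[|k']]]]] hk'] [m' n']];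
    rewrite /h /pick5 //= => -[ea eb]; try (by exfalso; lia);
    congr (_, (_, _)); try (by apply: val_inj); lia.
- move=> [a b]; have [t] : exists t : int, a = 5 * t - 2 * b \/ a = 5 * t + 1 - 2 * b \/
    a = 5 * t + 2 - 2 * b \/ a = 5 * t + 3 - 2 * b \/ a = 5 * t + 4 - 2 * b.
    by exists ((a + 2 * b) %/ 5)%Z; lia.
  move=> [->|[->|[->|[->|->]]]].
  + by exists (@Ordinal 5 0 isT, (- t, b - 2 * t)); rewrite /h /pick5 /=; congr (_, _); ring.
  + by exists (@Ordinal 5 1 isT, (2 * t - b, t)); rewrite /h /pick5 /=; congr (_, _); ring.
  + by exists (@Ordinal 5 2 isT, (t + 1, 2 * t + 1 - b)); rewrite /h /pick5 /=; congr (_, _); ring.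
  + by exists (@Ordinal 5 3 isT, (b - 2 * t - 1, t + 1)); rewrite /h /pick5 /=; congr (_, _); ring.
  + by exists (@Ordinal 5 4 isT, (- b + 2 * t + 2, - t - 1)); rewrite /h /pick5 /=; congr (_, _); ring.
- move=> [k [m n]]; have := triE (h (k, (m, n))).1.
  have := triE (h (k, (m, n))).2; have := triE m; have := triE n.
  have := @jexpE 5 1 m isT isT; have := @jexpE 5 2 n isT isT.
  by case: k => [[|[|[|[|[|k]]]]] hk]; rewrite /h /E /pick5 /e0 /e1 /=; lia.
- by move=> [k [m n]]; case: k => [[|[|[|[|[|k]]]]] hk];
    rewrite /s /pick5 /s0 /s1 //= ?expr1n ?mulr1.
Qed.

End ThetaDissections.

(** * Norms over the fifth roots of unity *)

Section RootsOfUnity.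
Variable R : comNzRingType.

(** Conjugate factors are paired, which leaves only the Gaussian periods [g] and [h]; their sum and
    their product are both -1. *)
Lemma prod5_geometric (w z : R) : w ^+ 5 = 1 ->
  1 + w + w ^+ 2 + w ^+ 3 + w ^+ 4 = 0 ->
  \prod_(j < 5) (1 - w ^+ j * z) = 1 - z ^+ 5.
Proof.
move=> w5 ws; rewrite !big_ord_recr big_ord0 /=.
pose g := w + w ^+ 4; pose h := w ^+ 2 + w ^+ 3.
have gh : g + h = -1 by rewrite -[LHS](addrK 1) -[RHS]add0r -{1}ws /g /h; ring.
have ghM : g * h = -1.
  transitivity (w ^+ 3 + w ^+ 4 + w ^+ 5 * w + w ^+ 5 * w ^+ 2); first by rewrite /g /h; ring.
  by rewrite w5 -gh /g /h; ring.
transitivity ((1 - z) * (1 - g * z + w ^+ 5 * z ^+ 2) * (1 - h * z + w ^+ 5 * z ^+ 2)).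
  by rewrite /g /h; ring.
rewrite w5.
transitivity ((1 - z) * (1 - (g + h) * z + (2 + g * h) * z ^+ 2 - (g + h) * z ^+ 3 + z ^+ 4)).
  by ring.
by rewrite gh ghM; ring.
Qed.

(** The norm of a series 1 + a + b whose parts have exponents 0, 1 and 4 modulo 5; [w ^+ (4 * j)] is
    the inverse of [w ^+ j]. *)
Lemma prod5_trinomial (w a b : R) : w ^+ 5 = 1 ->
  1 + w + w ^+ 2 + w ^+ 3 + w ^+ 4 = 0 ->
  \prod_(j < 5) (1 + w ^+ j * a + w ^+ (4 * j) * b) =
  1 + a ^+ 5 + b ^+ 5 - 5 * (a * b) + 5 * (a * b) ^+ 2.
Proof.
move=> w5 ws; rewrite !big_ord_recr big_ord0 /=.
pose g := w + w ^+ 4; pose h := w ^+ 2 + w ^+ 3.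
have gh : g + h = -1 by rewrite -[LHS](addrK 1) -[RHS]add0r -{1}ws /g /h; ring.
have ghM : g * h = -1.
  transitivity (w ^+ 3 + w ^+ 4 + w ^+ 5 * w + w ^+ 5 * w ^+ 2); first by rewrite /g /h; ring.
  by rewrite w5 -gh /g /h; ring.
have -> : w ^+ (4 * 4) = w ^+ 5 ^+ 3 * w by rewrite -exprM -exprSr.
have -> : w ^+ (4 * 3) = w ^+ 5 ^+ 2 * w ^+ 2 by rewrite -exprM -exprD.
have -> : w ^+ (4 * 2) = w ^+ 5 * w ^+ 3 by rewrite -exprD.
rewrite w5 !expr1n !mul1r.
transitivity ((1 + a + b) * (1 + g * (a + b) + w ^+ 5 * (a ^+ 2 + b ^+ 2) + (w ^+ 2 + w ^+ 5 * w ^+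
  3) * (a * b))
   * (1 + h * (a + b) + w ^+ 5 * (a ^+ 2 + b ^+ 2) + (w ^+ 4 + w ^+ 5 * w) * (a * b))).
  by rewrite /g /h; ring.
rewrite w5 !mul1r -/h [w ^+ 4 + w]addrC -/g.
transitivity ((1 + a + b) * ((1 + a ^+ 2 + b ^+ 2) ^+ 2 + (g + h) * ((1 + a ^+ 2 + b ^+ 2) * (a + b
  + a * b))
   + g * h * ((a + b) ^+ 2 + (a * b) ^+ 2) + ((g + h) ^+ 2 - 2 * (g * h)) * (a + b) * (a * b))).
  by ring.
by rewrite gh ghM; ring.
Qed.

Variable z : R.

Definition twist (f : fps R) : fps R := Fps (fun n => z ^+ n * f n).

Lemma twist_additive : zmod_morphism twist.
Proof. by move=> f g; apply/fpsP => n; rewrite /= mulrBr. Qed.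

Lemma twist_multiplicative : monoid_morphism twist.
Proof.
split; first by apply/fpsP => -[|n]; rewrite /= ?expr0 ?mul1r ?mulr0.
move=> f g; apply/fpsP => n; rewrite fpsME /= big_distrr /=.
apply: eq_bigr => i _; have i_n : (i <= n)%N by rewrite -ltnS.
by rewrite -{1}(subnKC i_n) exprD; ring.
Qed.

HB.instance Definition _ :=
  GRing.isZmodMorphism.Build (fps R) (fps R) twist twist_additive.
HB.instance Definition _ :=
  GRing.isMonoidMorphism.Build (fps R) (fps R) twist twist_multiplicative.

Definition cst (c : R) : fps R := Fps (fun n => if n == 0%N then c else 0).

Lemma cstM c (f : fps R) n : (cst c * f) n = c * f n.
Proof.
rewrite fpsME big_ord_recl /= subn0 big1 ?addr0 // => i _.
by rewrite mul0r.
Qed.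

Lemma cst_additive : zmod_morphism cst.
Proof. by move=> c d; apply/fpsP => -[|n] /=; rewrite ?subr0. Qed.

Lemma cst_multiplicative : monoid_morphism cst.
Proof.
split; first by apply/fpsP => -[|n].
by move=> c d; apply/fpsP => n; rewrite cstM; case: n => //= n; rewrite mulr0.
Qed.

HB.instance Definition _ := GRing.isZmodMorphism.Build R (fps R) cst cst_additive.
HB.instance Definition _ := GRing.isMonoidMorphism.Build R (fps R) cst cst_multiplicative.

Lemma twist_qpow k : twist (qpow R k) = cst (z ^+ k) * qpow R k.
Proof.
apply/fpsP => n; rewrite cstM qpowE /= ; case: eqP => [->|] //.
by rewrite !mulr0.
Qed.

Lemma twist_fsub k f : (0 < k)%N -> z ^+ k = 1 -> twist (fsub k f) = fsub k f.
Proof.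
move=> k0 zk; apply/fpsP => n; rewrite /= ; case: ifP; rewrite ?mulr0 // => kn.
by rewrite -{1}(divnK kn) mulnC exprM zk expr1n mul1r.
Qed.

Lemma eqm_twist K f g : eqm K f g -> eqm K (twist f) (twist g).
Proof. by move=> h n nK; rewrite /= h. Qed.

End RootsOfUnity.

Section Norm.
Variables (R : comNzRingType) (z : R).
Hypotheses (z5 : z ^+ 5 = 1)
  (zs : forall m, ~~ (5 %| m)%N ->
    1 + z ^+ m + (z ^+ m) ^+ 2 + (z ^+ m) ^+ 3 + (z ^+ m) ^+ 4 = 0).

Lemma twist_fprod (w : R) u : tame u ->
  tame (fun i => twist w (u i)) /\ twist w (fprod u) = fprod (fun i => twist w (u i)).
Proof.
move=> tu; have t : tame (fun i => twist w (u i)).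
  by move=> i; rewrite -(rmorph1 (twist w)); apply: eqm_twist; apply: tu.
split=> //; apply: eqmP => K.
apply: eqm_trans (eqm_sym (fprod_eqm t (leqnn K))).
by rewrite -rmorph_prod; apply: eqm_twist; apply: fprod_eqm.
Qed.

Lemma fprod_prod (I : finType) (u : I -> nat -> fps R) : (forall j, tame (u j)) ->
  tame (fun i => \prod_j u j i) /\ \prod_j fprod (u j) = fprod (fun i => \prod_j u j i).
Proof.
move=> tu; have t : tame (fun i => \prod_j u j i).
  by move=> i; apply: eqm_prod1 => j _; apply: tu.
split=> //; apply: eqmP => K; apply: eqm_trans (eqm_sym (fprod_eqm t (leqnn K))).
rewrite exchange_big /=; apply: eqm_prod => j _; exact: fprod_eqm.
Qed.

(** The conjugates of 1 - q^(k n) multiply to 1 - q^(5 k n) if 5 does not divide n, and to (1 - q^(k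
    n))^5 if it does. The second kind gives E_(5k)^5, the first E_(5k) / E_(25k). *)
Lemma norm_feuler k : (0 < k)%N -> ~~ (5 %| k)%N ->
  (\prod_(j < 5) twist (z ^+ j) (feuler R k)) * feuler R (25 * k) =
  feuler R (5 * k) ^+ 6.
Proof.
move=> k0 k5; have tk := @tame_feuler R k k0.
have tj (j : 'I_5) := (twist_fprod (z ^+ j) tk).1.
have -> : \prod_(j < 5) twist (z ^+ j) (feuler R k) =
    \prod_(j < 5) fprod (fun i => twist (z ^+ j) (1 - qpow R (k * i.+1)%N)).
  by apply: eq_bigr => j _; exact: (twist_fprod (z ^+ j) tk).2.
have [t ->] := fprod_prod tj.
pose v i : fps R := if (5 %| i.+1)%N then (1 - qpow R (k * i.+1)) ^+ 5
  else 1 - qpow R (5 * (k * i.+1)).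
have -> : fprod (fun i => \prod_(j < 5) twist (z ^+ j) (1 - qpow R (k * i.+1)%N)) = fprod v.
  congr fprod; apply: funext => i; rewrite /v.
  under eq_bigr => j _ do rewrite rmorphB rmorph1 /= twist_qpow -exprM mulnC exprM rmorphXn.
  case: ifP => i5.
    have -> : z ^+ (k * i.+1) = 1.
      by rewrite -(divnK i5) mulnA mulnC exprM z5 expr1n.
    under eq_bigr => j _ do rewrite rmorph1 expr1n mul1r.
    by rewrite prodr_const card_ord.
  rewrite prod5_geometric; first by rewrite qpowX [(5 * _)%N]mulnC.
    by rewrite -rmorphXn -exprM mulnC exprM z5 expr1n rmorph1.
  have := @zs (k * i.+1)%N; rewrite Euclid_dvdM // i5 orbF => /(_ k5).
  by move/(congr1 (@cst R)); rewrite !rmorphD !rmorphXn rmorph1 rmorph0.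
have tv : tame v.
  move=> i; rewrite /v; case: ifP => _.
    rewrite -[1 in X in eqm _ _ X](expr1n _ 5); apply: eqmX.
    by apply: tame_feuler.
  have := @tameB R (fun i => 5 * (k * i.+1))%N; apply => j; nia.
rewrite (@fprod_split R 5 v) // !big_ord_recr big_ord0 /= mul1r.
have -> : fprod (fun i => v (5 * i + 4)%N) = feuler R (5 * k) ^+ 5.
  have t5 : tame (fun i => 1 - qpow R (5 * k * i.+1)%N) by apply: tame_feuler; lia.
  have [_ e5] := @fprod_prod 'I_5 (fun=> fun i => 1 - qpow R (5 * k * i.+1)%N) (fun=> t5).
  transitivity (\prod_(j < 5) feuler R (5 * k)); last by rewrite prodr_const card_ord.
  rewrite [RHS]e5; congr fprod; apply: funext => i; rewrite /v prodr_const card_ord.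
  rewrite (_ : (5 * i + 4).+1 = (5 * i.+1)%N) ?dvdn_mulr //; last by lia.
  by congr ((1 - qpow R _) ^+ _); lia.
have vE c : (c < 4)%N -> fprod (fun i => v (5 * i + c)%N) = minus_prod R (5 * (5 * k)) (5 * k * c.+1).
  move=> c4; congr fprod; apply: funext => i; rewrite /v.
  rewrite (_ : (5 %| (5 * i + c).+1)%N = false); last by apply/negbTE; lia.
  by congr (1 - qpow R _); lia.
rewrite !vE // [RHS]exprS.
have {2}-> : feuler R (5 * k) = minus_prod R (5 * (5 * k)) (5 * k * 1) *
    minus_prod R (5 * (5 * k)) (5 * k * 2) * minus_prod R (5 * (5 * k)) (5 * k * 3) *
    minus_prod R (5 * (5 * k)) (5 * k * 4) * feuler R (25 * k).
  rewrite !feulerE ?(@minus_prod_split R 5 (5 * k)) //; try lia.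
  rewrite !big_ord_recr big_ord0 /= mul1r.
  have sE c : (5 * k * c + 5 * k = 5 * k * c.+1)%N by rewrite mulnS addnC.
  by rewrite !sE (_ : (25 * k = 5 * (5 * k))%N) ?mulnA // [(5 * k * 5)%N]mulnC !mulnA.
by ring.
Qed.

End Norm.

(** * The quintic equation *)

Section QuinticNorm.

Lemma fmap_inj : injective (fmap (intr : {rmorphism int -> algC})).
Proof. by move=> f g /fpsP h; apply/fpsP => n; have /= := h n; move/intr_inj. Qed.

Definition phi5 : fps int := fsub 5 (phi int).
Definition phi25 : fps int := fsub 25 (phi int).

Lemma phi0 : phi int 0%N = 1.
Proof.
have := congr1 (fun f : fps int => f 0%N) (phi_feuler int).
by rewrite coef0M coef0X !feuler0 // expr1n mulr1.
Qed.

(* The 5-dissection of [phi / phi25]: [p25 = 1 + pa + pb], with exponents congruent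
   to 0, 1 and 4 modulo 5. *)
Definition p25 : fps int := phi int * finv phi25.
Definition p1 : fps int := - 2 * f37 int * finv phi5.
Definition p4 : fps int := 2 * f19 int * finv phi5.
Definition pa : fps int := qpow int 1 * fsub 5 p1.
Definition pb : fps int := qpow int 4 * fsub 5 p4.

Lemma phi5_0 : phi5 0%N = 1. Proof. by rewrite fsub_coef0 phi0. Qed.
Lemma phi25_0 : phi25 0%N = 1. Proof. by rewrite fsub_coef0 phi0. Qed.

Lemma fsub_phi5 : fsub 5 phi5 = phi25. Proof. by rewrite fsub_comp. Qed.

Lemma fsub_finv k (f : fps int) : f 0%N = 1 -> fsub k.+1 (finv f) = finv (fsub k.+1 f).
Proof.
move=> f0; have g0 : fsub k.+1 f 0%N = 1 by rewrite fsub_coef0.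
by apply: (fps_cancel g0); rewrite (finvK g0) -rmorphM finvK ?rmorph1.
Qed.

Lemma p25M : p25 * phi25 = phi int.
Proof. by rewrite -mulrA [_ * phi25]mulrC finvK ?mulr1 // phi25_0. Qed.

Lemma pa_phi25 : pa * phi25 = - 2 * qpow int 1 * fsub 5 (f37 int).
Proof.
rewrite /pa /p1 !rmorphM /= (@fsub_finv 4) ?phi5_0 // fsub_phi5.
rewrite rmorphN rmorph_nat -!mulrA [finv _ * _]mulrC finvK ?phi25_0 //; ring.
Qed.

Lemma pb_phi25 : pb * phi25 = 2 * qpow int 4 * fsub 5 (f19 int).
Proof.
rewrite /pb /p4 !rmorphM /= (@fsub_finv 4) ?phi5_0 // fsub_phi5.
rewrite rmorph_nat -!mulrA [finv _ * _]mulrC finvK ?phi25_0 //; ring.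
Qed.

Lemma p25E : p25 = 1 + pa + pb.
Proof.
apply: (fps_cancel phi25_0); rewrite [LHS]mulrC p25M {1}phi_dissection -/phi25.
by rewrite [RHS]mulrC !mulrDl pa_phi25 pb_phi25; ring.
Qed.

(** [phi_lattice] read in q^5: its last term becomes the product of the two outer terms of the
    dissection, whose leading powers q and q^4 multiply to q^5. *)
Lemma pab : (1 + pa * pb) * phi25 ^+ 2 = phi5 ^+ 2.
Proof.
have := congr1 (fsub 5) (phi_lattice int).
rewrite rmorphXn /= -/phi5 rmorphB rmorphXn /= -/phi5 fsub_phi5 => ->.
transitivity (phi25 ^+ 2 + (pa * phi25) * (pb * phi25)); first by ring.
rewrite pa_phi25 pb_phi25 !rmorphM /= rmorph_nat fsub_qpow //.
by rewrite (qpowD _ 1 4); ring.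
Qed.

Lemma twist_p25 (z : algC) j : z ^+ 5 = 1 ->
  twist (z ^+ j) (fmap intr p25) =
  1 + cst z ^+ j * fmap intr pa + cst z ^+ (4 * j) * fmap intr pb.
Proof.
move=> z5; have zj : (z ^+ j) ^+ 5 = 1 by rewrite -exprM mulnC exprM z5 expr1n.
rewrite p25E !rmorphD !rmorph1 /= /pa /pb !rmorphM /= !fmap_qpow !fmap_fsub.
rewrite !twist_qpow !twist_fsub // -!rmorphXn /= expr1 -exprM [(4 * j)%N]mulnC.
by rewrite !mulrA.
Qed.

(* The conjugates of [1 + pa + pb] under [q -> zeta q] multiply to the right-hand
   side; the left-hand side comes from the product formula for [E_1]. *)
Lemma p25_norm :
  (1 + pa * pb) ^+ 3 = 1 + pa ^+ 5 + pb ^+ 5 - 5 * (pa * pb) + 5 * (pa * pb) ^+ 2.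
Proof.
have [z zP] := C_prim_root_exists (isT : (0 < 5)%N).
have z5 : z ^+ 5 = 1 by apply: prim_expr_order.
have zs m : ~~ (5 %| m)%N ->
    1 + z ^+ m + (z ^+ m) ^+ 2 + (z ^+ m) ^+ 3 + (z ^+ m) ^+ 4 = 0.
  move=> m5; have zm : z ^+ m != 1 by rewrite -(prim_order_dvd zP).
  have w5 : (z ^+ m) ^+ 5 = 1 by rewrite -exprM mulnC exprM z5 expr1n.
  have /eqP : (z ^+ m - 1) * (1 + z ^+ m + (z ^+ m) ^+ 2 + (z ^+ m) ^+ 3 + (z ^+ m) ^+ 4) = 0.
    by transitivity ((z ^+ m) ^+ 5 - 1); [ring | rewrite w5 subrr].
  by rewrite mulf_eq0 subr_eq0 (negbTE zm) => /eqP.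
apply: fmap_inj; set io := fmap _.
pose T (f : fps algC) := \prod_(j < 5) twist (z ^+ j) f.
have TM f g : T (f * g) = T f * T g.
  by rewrite /T -big_split; apply: eq_bigr => j _; rewrite rmorphM.
have ioM f g : io (f * g) = io f * io g by rewrite /io rmorphM.
have ioX f n : io (f ^+ n) = io f ^+ n by rewrite /io rmorphXn.
have ioE k : io (feuler int k) = feuler algC k by apply: fmap_feuler.
have n1 : T (feuler algC 1) * feuler algC 25 = feuler algC 5 ^+ 6.
  exact: (norm_feuler z5 zs (isT : (0 < 1)%N) (isT : ~~ (5 %| 1)%N)).
have n2 : T (feuler algC 2) * feuler algC 50 = feuler algC 10 ^+ 6.
  exact: (norm_feuler z5 zs (isT : (0 < 2)%N) (isT : ~~ (5 %| 2)%N)).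
have F1 : T (io (phi int)) * T (feuler algC 2) = T (feuler algC 1) ^+ 2.
  have := congr1 (fun f => T (io f)) (phi_feuler int).
  by rewrite /= ioM ioX !ioE TM expr2 TM.
have F5 : io phi5 * feuler algC 10 = feuler algC 5 ^+ 2.
  have := congr1 (fun f => io (fsub 5 f)) (phi_feuler int).
  by rewrite /= rmorphM rmorphXn /= !fsub_feuler // ioM ioX !ioE.
have F25 : io phi25 * feuler algC 50 = feuler algC 25 ^+ 2.
  have := congr1 (fun f => io (fsub 25 f)) (phi_feuler int).
  by rewrite /= rmorphM rmorphXn /= !fsub_feuler // ioM ioX !ioE.
have Tp : T (io p25) * io phi25 ^+ 5 = T (io (phi int)).
  transitivity (T (io p25) * T (io phi25)); last by rewrite -TM -ioM p25M.
  congr (T (io p25) * _).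
  rewrite /T -{1}[5%N]card_ord -prodr_const; apply: eq_bigr => j _.
  rewrite /phi25 /io fmap_fsub twist_fsub //.
  by rewrite -exprM mulnC exprM (_ : 25 = 5 * 5)%N // exprM z5 !expr1n.
have pabE : io (1 + pa * pb) * io phi25 ^+ 2 = io phi5 ^+ 2.
  by rewrite -!ioX -ioM pab.
have a0 : io phi25 0%N = 1 by rewrite /io fmapE phi25_0.
have e0 k : (0 < k)%N -> feuler algC k 0%N = 1 by apply: feuler0.
(* As phi(-q) = E_1^2 / E_2, its norm is (E_5^6 / E_25)^2 E_50 / E_10^6 = [phi5 ^ 6 / phi25]; the
   norm of [phi25], a series in q^25, is its fifth power. *)
have Tt : T (io p25) * io phi25 ^+ 6 = io phi5 ^+ 6.
  have u0 : (feuler algC 10 ^+ 6 * feuler algC 25 ^+ 2) 0%N = 1.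
    by rewrite coef0M !coef0X !e0 // !expr1n mulr1.
  apply: (fps_cancel u0).
  transitivity (T (io p25) * io phi25 ^+ 5 * io phi25 * feuler algC 25 ^+ 2 * feuler algC 10 ^+ 6);
    first by ring.
  rewrite Tp -[in LHS]n2.
  transitivity (T (io (phi int)) * T (feuler algC 2) * (io phi25 * feuler algC 50) * feuler algC 25
    ^+ 2); first by ring.
  rewrite F1 F25.
  transitivity ((T (feuler algC 1) * feuler algC 25) ^+ 2 * feuler algC 25 ^+ 2); first by ring.
  rewrite n1; transitivity ((feuler algC 5 ^+ 2) ^+ 6 * feuler algC 25 ^+ 2); first by ring.
  by rewrite -F5; ring.
have -> : io (1 + pa ^+ 5 + pb ^+ 5 - 5 * (pa * pb) + 5 * (pa * pb) ^+ 2) = T (io p25).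
  rewrite /T; under [RHS]eq_bigr => j _ do rewrite twist_p25 //.
  rewrite prod5_trinomial; last first.
  - have := congr1 (@cst _) (@zs 1%N isT).
    by rewrite !rmorphD !rmorphXn rmorph1 rmorph0 expr1.
  - by rewrite -rmorphXn z5 rmorph1.
  have ioD f g : io (f + g) = io f + io g by rewrite /io rmorphD.
  have ioN f : io (- f) = - io f by rewrite /io rmorphN.
  have io1 : io 1 = 1 by rewrite /io rmorph1.
  have io5 : io 5 = 5 by rewrite /io rmorph_nat.
  rewrite -/io; move: (pa) (pb) => u v.
  by rewrite 4!ioD ioN (ioX u) (ioX v) (ioM 5 (u * v)) (ioM 5 ((u * v) ^+ 2)) (ioX (u * v)) (ioM u)
    io1 io5.
have a6 : (io phi25 ^+ 6) 0%N = 1 by rewrite coef0X a0 expr1n.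
apply: (fps_cancel a6); rewrite [RHS]mulrC Tt ioX.
transitivity ((io (1 + pa * pb) * io phi25 ^+ 2) ^+ 3); first by ring.
by rewrite pabE; ring.
Qed.

End QuinticNorm.

(** * The function x *)

Section Hauptmodul.

Local Notation E k := (feuler int k).
Local Notation q := (qpow int 1).

Definition xq : fps int := q * (E 2 * E 10 ^+ 3) * finv (E 1 ^+ 3 * E 5).
Definition yq : fps int := fsub 5 xq.

Lemma E0 k : (0 < k)%N -> E k 0%N = 1. Proof. exact: feuler0. Qed.

Lemma xq_eta : xq * (E 1 ^+ 3 * E 5) = q * (E 2 * E 10 ^+ 3).
Proof.
have u0 : (E 1 ^+ 3 * E 5) 0%N = 1 by rewrite coef0M coef0X !E0 // expr1n mulr1.
by rewrite -mulrA [_ * (E 1 ^+ 3 * E 5)]mulrC finvK // mulr1.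
Qed.

Lemma xq0 : xq 0%N = 0.
Proof. by rewrite /xq -mulrA coef0M mul0r. Qed.

Lemma xq1 : xq 1%N = 1.
Proof.
rewrite /xq -mulrA qpowME leqnn subnn coef0M coef0_finv mulr1.
by rewrite coef0M coef0X !E0 // expr1n mulr1.
Qed.

Lemma psi_lattice :
  psi int ^+ 2 = q * fsub 5 (psi int) ^+ 2 + f14 int * f23 int.
Proof.
have := psi2_lattice int; rewrite psi2E rmorphM rmorph_nat => h.
have four (f g : fps int) : 4 * f = 4 * g -> f = g.
  move=> /fpsP e; apply/fpsP => n; have := e n; rewrite !fps_natME.
  by apply: mulfI.
by apply: four; transitivity ((2 * psi int) ^+ 2); [ring | rewrite h; ring].
Qed.

(** [phi_lattice] divided by phi(-q)^2, since [f19_f37] shows that q [f19] [f37] / phi(-q)^2 is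
    x. *)
Lemma one4x_eta : (1 + 4 * xq) * (E 1 ^+ 4 * E 10 ^+ 2) = E 2 ^+ 2 * E 5 ^+ 4.
Proof.
have h1 := phi_feuler int.
have h5 : phi5 * E 10 = E 5 ^+ 2.
  by have := congr1 (fsub 5) h1; rewrite rmorphM rmorphXn /= !fsub_feuler.
have hl := phi_lattice int; have hp := f19_f37 int; have hx := xq_eta.
have u0 : E 5 0%N = 1 by rewrite E0.
apply: (fps_cancel u0).
transitivity (E 5 * (E 1 ^+ 2) ^+ 2 * E 10 ^+ 2 + 4 * E 1 * E 10 ^+ 2 * (xq * (E 1 ^+ 3 * E 5)));
  first by ring.
rewrite hx -h1.
transitivity (E 5 * E 2 ^+ 2 * E 10 ^+ 2 * phi int ^+ 2 + 4 * q * E 2 * E 10 ^+ 2 * (E 1 * E 10 ^+ 3)).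
  by ring.
rewrite hl -hp.
transitivity (E 5 * E 2 ^+ 2 * (phi5 * E 10) ^+ 2); first by rewrite /phi5; ring.
by rewrite h5; ring.
Qed.

(** Dividing [psi_lattice] by [f14] [f23] turns its first term into x / (1 + 4 x), so the quotient
    of psi^2 by [f14] [f23] is (1 + 5 x) / (1 + 4 x). *)
Lemma one5x_eta : (1 + 5 * xq) * (E 1 ^+ 5 * E 10) = E 2 ^+ 5 * E 5.
Proof.
have h1 := psi_feuler int.
have h5 : fsub 5 (psi int) * E 5 = E 10 ^+ 2.
  by have := congr1 (fsub 5) h1; rewrite rmorphM rmorphXn /= !fsub_feuler.
have hl := psi_lattice; have hp := f14_f23 int; have hx := xq_eta; have h4 := one4x_eta.
have u0 : (E 5 * E 10) 0%N = 1 by rewrite coef0M !E0 // mulr1.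
apply: (fps_cancel u0).
transitivity (E 1 * E 5 * ((1 + 4 * xq) * (E 1 ^+ 4 * E 10 ^+ 2))
   + (xq * (E 1 ^+ 3 * E 5)) * E 1 ^+ 2 * E 10 ^+ 2); first by ring.
rewrite h4 hx.
transitivity (E 1 * E 5 ^+ 2 * E 2 * (E 2 * E 5 ^+ 3) + q * E 2 * E 10 * E 1 ^+ 2 * (E 10 ^+ 2) ^+ 2).
  by ring.
rewrite -hp -h5.
transitivity (E 2 * E 5 ^+ 2 * E 10 * E 1 ^+ 2 * (q * fsub 5 (psi int) ^+ 2 + f14 int * f23 int)).
  by ring.
rewrite -hl; transitivity (E 2 * E 5 ^+ 2 * E 10 * (psi int * E 1) ^+ 2); first by ring.
by rewrite h1; ring.
Qed.

Lemma one4x_phi : (1 + 4 * xq) * phi int ^+ 2 = phi5 ^+ 2.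
Proof.
have h1 := phi_feuler int.
have h5 : phi5 * E 10 = E 5 ^+ 2.
  by have := congr1 (fsub 5) h1; rewrite rmorphM rmorphXn /= !fsub_feuler.
have u0 : (E 2 ^+ 2 * E 10 ^+ 2) 0%N = 1 by rewrite coef0M !coef0X !E0 // !expr1n mulr1.
apply: (fps_cancel u0).
transitivity ((1 + 4 * xq) * (phi int * E 2) ^+ 2 * E 10 ^+ 2); first by ring.
rewrite h1; transitivity (E 2 ^+ 2 * (E 5 ^+ 2) ^+ 2); last by rewrite -h5; ring.
by transitivity (E 2 ^+ 2 * E 5 ^+ 4); [rewrite -one4x_eta | ]; ring.
Qed.

Definition Mq : fps int := 1 + 4 * yq.

Lemma Mq_fsub : fsub 5 (1 + 4 * xq) = Mq.
Proof. by rewrite rmorphD rmorphM rmorph1 rmorph_nat. Qed.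

Lemma Mq_phi : Mq * phi5 ^+ 2 = phi25 ^+ 2.
Proof.
have := congr1 (fsub 5) one4x_phi.
by rewrite rmorphM rmorphXn /= Mq_fsub -/phi5 rmorphXn /= fsub_phi5.
Qed.

Lemma Mq_pab : Mq * (1 + pa * pb) = 1.
Proof.
have u0 : (phi25 ^+ 2) 0%N = 1 by rewrite coef0X phi25_0 expr1n.
by apply: (fps_cancel u0); rewrite mulr1 mulrCA [phi25 ^+ 2 * _]mulrC pab Mq_phi.
Qed.

Lemma one4x_p25 : (1 + 4 * xq) * p25 ^+ 2 = 1 + pa * pb.
Proof.
have u0 : (phi25 ^+ 2) 0%N = 1 by rewrite coef0X phi25_0 expr1n.
apply: (fps_cancel u0); rewrite [RHS]mulrC pab -one4x_phi -p25M; ring.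
Qed.

Lemma p25_0 : p25 0%N = 1.
Proof. by rewrite coef0M phi0 coef0_finv mulr1. Qed.

(** [pa] and [pb] have the sum [p25 - 1] and the product [N - 1], so [p25_norm] becomes an equation
    in [p25] and [N]. Odd powers of [p25] are collected on the left and even ones on the right,
    ready for squaring. *)
Lemma p25_quintic (N := 1 + pa * pb) :
  p25 * (p25 ^+ 4 + (15 - 5 * N) * p25 ^+ 2 + 5 * N ^+ 2 - 25 * N + 25) =
  5 * p25 ^+ 4 - (15 * N - 25) * p25 ^+ 2 + N ^+ 3.
Proof. by rewrite /N p25_norm p25E; ring. Qed.

(* Squaring both sides of [p25_quintic] leaves only even powers of [p25], which
   [one4x_p25] eliminates. *)
Lemma Z_quintic (Z := 1 + 4 * xq) (M := Mq) :
  Z * (Z ^+ 2 - (15 * M - 25 * M ^+ 2) * Z + 5 * M) ^+ 2 =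
  M * (1 + (15 * M - 5) * Z + (5 - 25 * M + 25 * M ^+ 2) * Z ^+ 2) ^+ 2.
Proof.
have hq := p25_quintic; have hZ := one4x_p25; have hM := Mq_pab; have p0 := p25_0.
rewrite -/Z in hZ; rewrite -/M in hM.
move: hq hZ hM p0; move: (1 + pa * pb) Z M (p25) => N {}Z {}M p hq hZ hM p0.
have u0 : (p ^+ 10) 0%N = 1 by rewrite coef0X p0 expr1n.
apply: (fps_cancel u0).
pose A := p ^+ 4 + (15 - 5 * N) * p ^+ 2 + 5 * N ^+ 2 - 25 * N + 25.
pose B := 5 * p ^+ 4 - (15 * N - 25) * p ^+ 2 + N ^+ 3.
transitivity (M * B ^+ 2).
  transitivity ((Z * p ^+ 2) * ((Z * p ^+ 2) ^+ 2 - (15 * M - 25 * M ^+ 2) * (Z * p ^+ 2) * p ^+ 2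
     + 5 * M * p ^+ 4) ^+ 2); first by ring.
  rewrite hZ; have -> : N ^+ 2 - (15 * M - 25 * M ^+ 2) * N * p ^+ 2 + 5 * M * p ^+ 4 = M * B.
    transitivity (N ^+ 2 - 15 * (M * N) * p ^+ 2 + 25 * M * (M * N) * p ^+ 2 + 5 * M * p ^+ 4);
      first by ring.
    rewrite hM; transitivity ((M * N) * N ^+ 2 - 15 * (M * N) * p ^+ 2 + 25 * M * p ^+ 2 + 5 * M *
      p ^+ 4).
      by rewrite hM; ring.
    by rewrite /B; ring.
  by transitivity ((M * N) * M * B ^+ 2); [ring | rewrite hM; ring].
rewrite -[B]hq -/A.
have -> : p ^+ 10 * (M * (1 + (15 * M - 5) * Z + (5 - 25 * M + 25 * M ^+ 2) * Z ^+ 2) ^+ 2) =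
   M * p ^+ 2 * (p ^+ 4 + (15 * M - 5) * (Z * p ^+ 2) * p ^+ 2
     + (5 - 25 * M + 25 * M ^+ 2) * (Z * p ^+ 2) ^+ 2) ^+ 2 by ring.
rewrite hZ; have -> : p ^+ 4 + (15 * M - 5) * N * p ^+ 2 + (5 - 25 * M + 25 * M ^+ 2) * N ^+ 2 = A.
  transitivity (p ^+ 4 + (15 * (M * N) - 5 * N) * p ^+ 2 + 5 * N ^+ 2 - 25 * (M * N) * N + 25 * (M
    * N) ^+ 2).
    by ring.
  by rewrite hM /A; ring.
by ring.
Qed.

Lemma natM_inj k (f g : fps int) : k.+1%:R * f = k.+1%:R * g -> f = g.
Proof.
move=> /fpsP e; apply/fpsP => n; have := e n; rewrite !fps_natME.
by apply: mulfI; rewrite pnatr_eq0.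
Qed.

(* [Z_quintic] in terms of [x] and [y], divided by [4 ^ 5]. *)
Lemma xq_quintic (x := xq) (y := yq) :
  x ^+ 5 = (y + 20 * y ^+ 2 + 150 * y ^+ 3 + 500 * y ^+ 4 + 625 * y ^+ 5) +
  (15 * y + 305 * y ^+ 2 + 465 * 5 * y ^+ 3 + 315 * 25 * y ^+ 4 + 100 * 10 ^+ 2 * y ^+ 5) * x +
  (85 * y + 175 * 10 * y ^+ 2 + 541 * 25 * y ^+ 3 + 465 * 10 ^+ 2 * y ^+ 4 + 600 * 10 ^+ 2 * y ^+
    5) * x ^+ 2 +
  (215 * y + 895 * 5 * y ^+ 2 + 350 * 10 ^+ 2 * y ^+ 3 + 122 * 10 ^+ 3 * y ^+ 4 + 160 * 10 ^+ 3 * y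
    ^+ 5) * x ^+ 3 +
  (205 * y + 430 * 10 * y ^+ 2 + 340 * 10 ^+ 2 * y ^+ 3 + 120 * 10 ^+ 3 * y ^+ 4 + 160 * 10 ^+ 3 *
    y ^+ 5) * x ^+ 4.
Proof.
have := Z_quintic; rewrite /Mq -/x -/y; move: x y => x y h.
apply: (@natM_inj 1023).
have -> : 1024%:R = 4 ^+ 5 :> fps int by ring.
apply/eqP; rewrite -subr_eq0; apply/eqP; move/eqP: h; rewrite -subr_eq0 => /eqP <-.
ring.
Qed.

(** The difference of the two sides of the quintic, as a polynomial in x, takes the value -((1 + 5
    y) / 5)^5 at x = -1/5. Hence (1 + 5 y)^5 plus 5^5 times this difference is divisible by 1 + 5 x,
    and the long factor is the quotient. *)
Lemma one5x_dvd (x := xq) (y := yq) :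
  (1 + 5 * y) ^+ 5 = (1 + 5 * x) *
  ((1 - 310 * 10 * y - 249 * 10 * 25 * y ^+ 2 - 935 * 10 ^+ 2 * 5 * y ^+ 3 - 499 * 5 ^+ 5 * y ^+ 4
    - 195 * 10 ^+ 4 * y ^+ 5) +
   (- 5 - 251 * 125 * y - 1027 * 5 ^+ 4 * y ^+ 2 - 1577 * 5 ^+ 5 * y ^+ 3 - 269 * 10 ^+ 2 * 5 ^+ 4
     * y ^+ 4 - 215 * 10 ^+ 5 * y ^+ 5) * x +
   (25 - 435 * 10 * 25 * y - 723 * 5 ^+ 5 * y ^+ 2 - 705 * 10 ^+ 3 * 25 * y ^+ 3 - 245 * 10 ^+ 4 *
     25 * y ^+ 4 - 800 * 10 ^+ 5 * y ^+ 5) * x ^+ 2 +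
   (- 125 - 205 * 5 ^+ 4 * y - 215 * 10 ^+ 2 * 125 * y ^+ 2 - 425 * 10 ^+ 4 * 5 * y ^+ 3 - 750 * 10
     ^+ 5 * y ^+ 4 - 100 * 10 ^+ 6 * y ^+ 5) * x ^+ 3 +
   625 * x ^+ 4).
Proof.
have := xq_quintic; rewrite -/x -/y; move: x y => x y h.
transitivity ((1 + 5 * y) ^+ 5 + 3125 * (x ^+ 5 - x ^+ 5)); first by ring.
by rewrite {2}h; ring.
Qed.

End Hauptmodul.

(** * Polynomial arithmetic on coefficient lists *)

Local Notation Z := BinNums.Z.
Local Notation zn := BinInt.Z.of_nat.

Section ListPolynomials.

(* Coefficient lists over the binary integers, lowest degree first, so that the
   recurrences below can be run by [vm_compute]. *)
Fixpoint padd (l1 l2 : seq Z) : seq Z :=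
  match l1, l2 with
  | [::], _ => l2
  | _, [::] => l1
  | a :: l1', b :: l2' => BinInt.Z.add a b :: padd l1' l2'
  end.
Definition pscale (c : Z) (l : seq Z) : seq Z := map (BinInt.Z.mul c) l.
Fixpoint pmul (l1 l2 : seq Z) : seq Z :=
  match l1 with
  | [::] => [::]
  | a :: l1' => padd (pscale a l2) (zn 0 :: pmul l1' l2)
  end.
Definition pexp (l : seq Z) (n : nat) : seq Z := iter n (pmul l) [:: zn 1].
Definition pzero (l : seq Z) : bool := all (BinInt.Z.eqb (zn 0)) l.
Definition peqb (l1 l2 : seq Z) : bool := pzero (padd l1 (pscale (BinInt.Z.opp (zn 1)) l2)).

Definition zi (c : Z) : fps int := (int_of_Z c)%:~R.

Lemma ziD a b : zi (BinInt.Z.add a b) = zi a + zi b.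
Proof. by rewrite /zi -[BinInt.Z.add a b]/(GRing.add a b) rmorphD rmorphD. Qed.
Lemma ziM a b : zi (BinInt.Z.mul a b) = zi a * zi b.
Proof. by rewrite /zi -[BinInt.Z.mul a b]/(GRing.mul a b) rmorphM rmorphM. Qed.
Lemma ziN c : zi (BinInt.Z.opp c) = - zi c.
Proof. by rewrite /zi -[BinInt.Z.opp c]/(GRing.opp c) rmorphN rmorphN. Qed.
Lemma zi0 : zi (zn 0) = 0. Proof. by []. Qed.
Lemma zi1 : zi (zn 1) = 1. Proof. by []. Qed.
Lemma ziN1 : zi (BinInt.Z.opp (zn 1)) = -1. Proof. by []. Qed.
Lemma zi_nat n : zi (zn n) = n%:R.
Proof.
have -> : zn n = n%:R :> Z by rewrite -[n in LHS]natn rmorph_nat.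
by rewrite /zi !rmorph_nat.
Qed.

Variable x : fps int.

Definition ev (l : seq Z) : fps int := foldr (fun c f => zi c + x * f) 0 l.

Lemma ev_nil : ev [::] = 0. Proof. by []. Qed.
Lemma ev_cons c l : ev (c :: l) = zi c + x * ev l. Proof. by []. Qed.

Lemma ev_add l1 l2 : ev (padd l1 l2) = ev l1 + ev l2.
Proof.
elim: l1 l2 => [|a l1 IH] [|b l2] /=; rewrite ?add0r ?addr0 //.
by rewrite IH ziD; ring.
Qed.

Lemma ev_scale c l : ev (pscale c l) = zi c * ev l.
Proof. by elim: l => [|a l IH] /=; rewrite ?mulr0 // IH ziM; ring. Qed.

Lemma ev_mul l1 l2 : ev (pmul l1 l2) = ev l1 * ev l2.
Proof.
elim: l1 => [|a l1 IH] /=; first by rewrite mul0r.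
by rewrite ev_add /= IH ev_scale zi0; ring.
Qed.

Lemma ev_exp l n : ev (pexp l n) = ev l ^+ n.
Proof.
elim: n => [|n IH]; first by rewrite /= zi1 mulr0 addr0.
by rewrite /pexp iterS ev_mul -/(pexp l n) IH exprS.
Qed.

Lemma ev_pzero l : pzero l -> ev l = 0.
Proof.
elim: l => //= a l IH /andP[a0 /IH ->].
by case: a a0 => // _; rewrite mulr0 addr0.
Qed.

Lemma ev_eq l1 l2 : peqb l1 l2 -> ev l1 = ev l2.
Proof.
move=> /ev_pzero; rewrite ev_add ev_scale ziN1 mulN1r => /eqP.
by rewrite subr_eq0 => /eqP.
Qed.

(** The state is a window of five consecutive terms of a linear recurrence with polynomial
    coefficients, sliding by one at each step. *)
Definition rec_step (A : seq (seq Z)) (st : seq (seq Z)) : seq (seq Z) :=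
  rcons (behead st) (foldr padd [::] [seq pmul ab.1 ab.2 | ab <- zip A st]).
Definition rec_list (A base : seq (seq Z)) (k : nat) : seq Z :=
  head [::] (iter k (rec_step A) base).

(** By the projection formula [fdec_fsubM]. The factor [c] serves to clear a denominator common to
    the initial values. *)
Lemma fdec_recurrence a0 a1 a2 a3 a4 b0 b1 b2 b3 b4 (f : nat -> fps int) (c : fps int) :
  (forall k, f (k + 5)%N = fsub 5 (ev a0) * f k + fsub 5 (ev a1) * f (k + 1)%N +
     fsub 5 (ev a2) * f (k + 2)%N + fsub 5 (ev a3) * f (k + 3)%N +
     fsub 5 (ev a4) * f (k + 4)%N) ->
  c * fdec 5 (f 0%N) = ev b0 -> c * fdec 5 (f 1%N) = ev b1 ->
  c * fdec 5 (f 2%N) = ev b2 -> c * fdec 5 (f 3%N) = ev b3 ->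
  c * fdec 5 (f 4%N) = ev b4 ->
  forall k, c * fdec 5 (f k) =
    ev (rec_list [:: a0; a1; a2; a3; a4] [:: b0; b1; b2; b3; b4] k).
Proof.
move=> hf h0 h1 h2 h3 h4 k; rewrite /rec_list.
set A := [:: a0; _; _; _; _]; set base := [:: b0; _; _; _; _].
suff [st_size st_ev] : size (iter k (rec_step A) base) = 5 /\
    forall j, (j < 5)%N ->
      c * fdec 5 (f (k + j)%N) = ev (nth [::] (iter k (rec_step A) base) j).
  by rewrite -{1}[k]addn0 st_ev // nth0.
elim: k => [|k [IHs IH]] /=.
  by split=> // -[|[|[|[|[|j]]]]].
move: (iter k _ _) IHs IH => st IHs IH.
case: st IHs IH => [|c0 [|c1 [|c2 [|c3 [|c4 [|? ?]]]]]] // _ IH.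
split=> // j j5; have [j4|] := ltnP j 4.
  rewrite addSnnS (IH j.+1) //.
  by case: j j4 {j5} => [|[|[|[|]]]].
move=> j4; have {j4 j5}-> : j = 4%N by lia.
rewrite addSnnS hf !raddfD /= !fdec_fsubM //.
rewrite !ev_add !ev_mul /=.
rewrite -(IH 0%N) // -(IH 1%N) // -(IH 2%N) // -(IH 3%N) // -(IH 4%N) // addn0.
by ring.
Qed.

End ListPolynomials.

(** * Decimation of polynomials in x *)

Section DecimationOfPowers.

Local Notation zm := BinInt.Z.mul.
Local Notation zo := BinInt.Z.opp.
Local Notation q := (qpow int 1).
Local Notation U := (fdec 5).

Definition Mx : fps int := 1 + 4 * xq.
Definition lM : seq Z := [:: zn 1; zn 4].

Lemma ev_lM : ev xq lM = Mx.
Proof. by rewrite !ev_cons ev_nil !zi_nat /Mx; ring. Qed.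

Lemma Mx0 : Mx 0%N = 1.
Proof. by rewrite fpsDE fps1E coef0M xq0 mulr0 addr0. Qed.

Lemma fdecD (f g : fps int) : U (f + g) = U f + U g. Proof. exact: raddfD. Qed.

Lemma fdec_natM (c : nat) (f : fps int) : U (c%:R * f) = c%:R * U f.
Proof. by rewrite !mulr_natl raddfMn. Qed.

Lemma fdec_pab i j : U (pa ^+ i * pb ^+ j) =
  if (5 %| i + 4 * j)%N then qpow int ((i + 4 * j) %/ 5) * (p1 ^+ i * p4 ^+ j) else 0.
Proof.
rewrite -fdec_qpowM // rmorphM !rmorphXn /= /pa /pb !exprMn !qpowX !mul1n qpowD.
by congr fdec; ring.
Qed.

(** The product [pa * pb] is this series in q^5; [Mx_hq] identifies [1 + hq] with 1 / (1 + 4 x). *)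
Definition hq : fps int := q * (p1 * p4).

Lemma Mx_hq : Mx * (1 + hq) = 1.
Proof.
have e : pa * pb = fsub 5 hq.
  by rewrite /pa /pb /hq !rmorphM /= fsub_qpow // (qpowD _ 1 4); ring.
have h : fsub 5 (Mx * (1 + hq)) = fsub 5 1.
  rewrite [LHS]rmorphM /= /Mx Mq_fsub [fsub 5 (1 + hq)]rmorphD /= -e.
  by rewrite !rmorph1 Mq_pab.
by rewrite -[LHS](@fdecK _ 5) // h fdecK.
Qed.

Lemma fdec_npab (c i j : nat) : U (c%:R * (pa ^+ i * pb ^+ j)) =
  c%:R * if (5 %| i + 4 * j)%N then qpow int ((i + 4 * j) %/ 5) * (p1 ^+ i * p4 ^+ j) else 0.
Proof. by rewrite fdec_natM fdec_pab. Qed.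

(** The term [pa ^ i * pb ^ j] survives only if [i] and [j] agree modulo 5. Up to the fourth power
    of [p25] this leaves the diagonal terms, hence a polynomial in [hq]. *)
Lemma fdec_p25_4 : U (p25 ^+ 4) = 1 + 12 * hq + 6 * hq ^+ 2.
Proof.
have -> : p25 ^+ 4 = 1%:R * (pa ^+ 0 * pb ^+ 0) + 12%:R * (pa ^+ 1 * pb ^+ 1) + 6%:R * (pa ^+ 2 *
  pb ^+ 2)
  + 4%:R * (pa ^+ 1 * pb ^+ 0) + 4%:R * (pa ^+ 0 * pb ^+ 1)
  + 6%:R * (pa ^+ 2 * pb ^+ 0) + 6%:R * (pa ^+ 0 * pb ^+ 2)
  + 4%:R * (pa ^+ 3 * pb ^+ 0) + 4%:R * (pa ^+ 0 * pb ^+ 3)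
  + 12%:R * (pa ^+ 2 * pb ^+ 1) + 12%:R * (pa ^+ 1 * pb ^+ 2)
  + 1%:R * (pa ^+ 4 * pb ^+ 0) + 1%:R * (pa ^+ 0 * pb ^+ 4)
  + 4%:R * (pa ^+ 3 * pb ^+ 1) + 4%:R * (pa ^+ 1 * pb ^+ 3) by rewrite p25E; ring.
rewrite !fdecD !fdec_npab /= /hq !mulr0 !addr0 !mul1r.
by rewrite -[((1 + 4 * 1) %/ 5)%N]/1%N -[((2 + 4 * 2) %/ 5)%N]/(1 + 1)%N qpowD; ring.
Qed.

Lemma fdec_p25_3 : U (p25 ^+ 3) = 1 + 6 * hq.
Proof.
have -> : p25 ^+ 3 = 1%:R * (pa ^+ 0 * pb ^+ 0) + 6%:R * (pa ^+ 1 * pb ^+ 1)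
  + 3%:R * (pa ^+ 1 * pb ^+ 0) + 3%:R * (pa ^+ 0 * pb ^+ 1)
  + 3%:R * (pa ^+ 2 * pb ^+ 0) + 3%:R * (pa ^+ 0 * pb ^+ 2)
  + 1%:R * (pa ^+ 3 * pb ^+ 0) + 1%:R * (pa ^+ 0 * pb ^+ 3)
  + 3%:R * (pa ^+ 2 * pb ^+ 1) + 3%:R * (pa ^+ 1 * pb ^+ 2) by rewrite p25E; ring.
rewrite !fdecD !fdec_npab /= /hq !mulr0 !addr0 !mul1r.
by rewrite -[((1 + 4 * 1) %/ 5)%N]/1%N; ring.
Qed.

Lemma fdec_p25_2 : U (p25 ^+ 2) = 1 + 2 * hq.
Proof.
have -> : p25 ^+ 2 = 1%:R * (pa ^+ 0 * pb ^+ 0) + 2%:R * (pa ^+ 1 * pb ^+ 1)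
  + 2%:R * (pa ^+ 1 * pb ^+ 0) + 2%:R * (pa ^+ 0 * pb ^+ 1)
  + 1%:R * (pa ^+ 2 * pb ^+ 0) + 1%:R * (pa ^+ 0 * pb ^+ 2) by rewrite p25E; ring.
rewrite !fdecD !fdec_npab /= /hq !mulr0 !addr0 !mul1r.
by rewrite -[((1 + 4 * 1) %/ 5)%N]/1%N; ring.
Qed.

Lemma fdec_p25_1 : U p25 = 1.
Proof.
have -> : p25 = pa ^+ 0 * pb ^+ 0 + (pa ^+ 1 * pb ^+ 0) + (pa ^+ 0 * pb ^+ 1).
  by rewrite p25E; ring.
by rewrite !fdecD !fdec_pab /= !addr0 -qpow0; ring.
Qed.

Lemma fdec_1 : U (1 : fps int) = 1.
Proof. by rewrite -{1}(rmorph1 (fsub 5)) fdecK. Qed.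

Definition Gq : fps int := finv p25.

Lemma p25_Gq : p25 * Gq = 1. Proof. exact/finvK/p25_0. Qed.

(** The reciprocal equation of [p25_quintic], with N replaced by 1 / M. Its coefficients are
    polynomials in M = 1 + 4 y, hence series in q^5. *)
Lemma Gq_quintic (M := Mq) : Gq ^+ 5 = M ^+ 3 - 5 * M ^+ 3 * Gq
  + (15 * M ^+ 3 - 5 * M ^+ 2) * Gq ^+ 2 + (15 * M ^+ 2 - 25 * M ^+ 3) * Gq ^+ 3
  + (5 * M - 25 * M ^+ 2 + 25 * M ^+ 3) * Gq ^+ 4.
Proof.
have hq := p25_quintic; have hM := Mq_pab; have hG := p25_Gq; have p0 := p25_0.
rewrite -/M in hM.
move: hq hM hG p0; move: (1 + pa * pb) M (p25) Gq => N {}M p G hq hM hG p0.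
have u0 : (p ^+ 5) 0%N = 1 by rewrite coef0X p0 expr1n.
apply: (fps_cancel u0); rewrite -exprMn hG expr1n.
transitivity ((M * N) ^+ 3); first by rewrite hM expr1n.
transitivity (M ^+ 3 * (p * (p ^+ 4 + (15 - 5 * N) * p ^+ 2 + 5 * N ^+ 2 - 25 * N + 25)
  - (5 * p ^+ 4 - (15 * N - 25) * p ^+ 2))); first by rewrite hq; ring.
transitivity (M ^+ 3 * p ^+ 5 - 5 * M ^+ 3 * p ^+ 4 + (15 * M ^+ 3 - 5 * M ^+ 2 * (M * N)) * p ^+ 3
  + (15 * M ^+ 2 * (M * N) - 25 * M ^+ 3) * p ^+ 2 + (5 * M * (M * N) ^+ 2 - 25 * M ^+ 2 * (M * N)
    + 25 * M ^+ 3) * p).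
  by ring.
rewrite hM; transitivity (M ^+ 3 * p ^+ 5 - 5 * M ^+ 3 * p ^+ 4 * (p * G) + (15 * M ^+ 3 - 5 * M ^+
  2) * p ^+ 3 * (p * G) ^+ 2
  + (15 * M ^+ 2 - 25 * M ^+ 3) * p ^+ 2 * (p * G) ^+ 3 + (5 * M - 25 * M ^+ 2 + 25 * M ^+ 3) * p *
    (p * G) ^+ 4).
  by rewrite hG; ring.
by ring.
Qed.

Definition lG : seq (seq Z) :=
  let M2 := pexp lM 2 in let M3 := pexp lM 3 in
  [:: M3; pscale (zo (zn 5)) M3; padd (pscale (zn 15) M3) (pscale (zo (zn 5)) M2);
      padd (pscale (zn 15) M2) (pscale (zo (zn 25)) M3);
      padd (pscale (zn 5) lM) (padd (pscale (zo (zn 25)) M2) (pscale (zn 25) M3))].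

Definition l1M : seq Z := [:: zn 0; zo (zn 4)].

(** The values [Mx ^ 2 * fdec 5 (p25 ^ (4 - k))] for [k] from 0 to 4. Two factors [Mx] are needed to
    clear [hq ^ 2], and [Mx * hq = 1 - Mx] is the list [l1M]. *)
Definition lG0 : seq (seq Z) :=
  let M2 := pexp lM 2 in
  [:: padd M2 (padd (pscale (zn 12) (pmul lM l1M)) (pscale (zn 6) (pexp l1M 2)));
      padd M2 (pscale (zn 6) (pmul lM l1M));
      padd M2 (pscale (zn 2) (pmul lM l1M)); M2; M2].

(* The powers of [1 / p25] satisfy the quintic too; multiplied by [p25 ^ 4] they start
   at [p25 ^ 4, p25 ^ 3, p25 ^ 2, p25, 1], which [fdec] handles directly. *)
Definition gq k : fps int := p25 ^+ 4 * Gq ^+ k.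

Lemma fdec_gq k : Mx ^+ 2 * U (gq k) = ev xq (rec_list lG lG0 k).
Proof.
have ev1M : ev xq l1M = 1 - Mx.
  by rewrite !ev_cons ev_nil ziN !zi_nat /Mx; ring.
have hh : Mx * hq = 1 - Mx by rewrite -[in RHS]Mx_hq; ring.
apply: (@fdec_recurrence xq _ _ _ _ _ _ _ _ _ _ gq) => [{}k|||||].
- rewrite /gq exprD Gq_quintic -Mq_fsub -/Mx.
  rewrite !(ev_add, ev_scale, ev_exp) ev_lM !ziN !zi_nat.
  have fD a b : fsub 5 (a + b : fps int) = fsub 5 a + fsub 5 b := rmorphD _ a b.
  have fM a b : fsub 5 (a * b : fps int) = fsub 5 a * fsub 5 b := rmorphM _ a b.
  have fN a : fsub 5 (- a : fps int) = - fsub 5 a := rmorphN _ a.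
  have fX (a : fps int) n : fsub 5 (a ^+ n) = fsub 5 a ^+ n := rmorphXn _ n a.
  have fn n : fsub 5 (n%:R : fps int) = n%:R := rmorph_nat _ n.
  by rewrite !(fD, fM, fN, fX, fn) !exprD; ring.
- rewrite !(ev_add, ev_scale, ev_exp, ev_mul) ev_lM ev1M !zi_nat -hh /gq mulr1 fdec_p25_4.
  by ring.
- have -> : gq 1 = p25 ^+ 3 by rewrite /gq expr1 (exprSr _ 3) -mulrA p25_Gq mulr1.
  rewrite !(ev_add, ev_scale, ev_exp, ev_mul) ev_lM ev1M !zi_nat -hh fdec_p25_3.
  by ring.
- have -> : gq 2 = p25 ^+ 2.
    by rewrite /gq (exprD _ 2 2) -mulrA -exprMn p25_Gq expr1n mulr1.
  rewrite !(ev_add, ev_scale, ev_exp, ev_mul) ev_lM ev1M !zi_nat -hh fdec_p25_2.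
  by ring.
- have -> : gq 3 = p25.
    by rewrite /gq exprS -mulrA -exprMn p25_Gq expr1n mulr1.
  by rewrite !(ev_exp) ev_lM fdec_p25_1 mulr1.
- have -> : gq 4 = 1 by rewrite /gq -exprMn p25_Gq expr1n.
  by rewrite !(ev_exp) ev_lM fdec_1 mulr1.
Qed.

End DecimationOfPowers.

(** * Initial values and recurrences for U(x^m) and U(p x^m) *)

Section BasePolynomials.

Local Notation zo := BinInt.Z.opp.
Local Notation U := (fdec 5).

(** [one4x_p25] says that 1 + 4 x is 1 / M times the square of [Gq]. Powers of x thus reduce to the
    even powers of [Gq], whose decimations are known. *)
Lemma Mq_xq : Mq * (4 * xq) = Gq ^+ 2 - Mq.
Proof.
have h : Mq * (1 + 4 * xq) = Gq ^+ 2.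
  transitivity (Mq * ((1 + 4 * xq) * p25 ^+ 2) * Gq ^+ 2); last first.
    by rewrite one4x_p25 Mq_pab mul1r.
  by transitivity (Mq * (1 + 4 * xq) * (p25 * Gq) ^+ 2); [rewrite p25_Gq | ]; ring.
by rewrite -h; ring.
Qed.

(* The binomial expansion of [(Gq ^ 2 - Mq) ^ m], which is [4 ^ m] times [xq ^ m] up to
   powers of [Mq]; the factor [4 ^ m] is divided out in [ubase] and [bbase]. *)
Definition comb (s m : nat) : seq Z := foldr padd [::]
  [seq pscale (if odd i then zo (zn 'C(m, i)) else zn 'C(m, i))
     (pmul (pexp lM i) (rec_list lG lG0 (2 * (m - i) + s))) | i <- iota 0 m.+1].

Lemma comb_eq s m : (s <= 4)%N ->
  Mx ^+ (m + 2) * (4 ^+ m * U (p25 ^+ (4 - s) * xq ^+ m)) = ev xq (comb s m).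
Proof.
move=> s4; rewrite exprD [Mx ^+ m * _]mulrC -mulrA.
have -> : Mx ^+ m * (4 ^+ m * U (p25 ^+ (4 - s) * xq ^+ m)) =
    U (p25 ^+ (4 - s) * (Mq * (4 * xq)) ^+ m).
  rewrite -[4 ^+ m]natrX -fdec_natM natrX -fdec_fsubM // rmorphXn /= Mq_fsub.
  by rewrite !exprMn; congr fdec; ring.
rewrite Mq_xq exprBn big_distrr /= raddf_sum big_distrr /=.
have -> : ev xq (comb s m) = \sum_(i <- iota 0 m.+1)
    ev xq (pscale (if odd i then zo (zn 'C(m, i)) else zn 'C(m, i))
     (pmul (pexp lM i) (rec_list lG lG0 (2 * (m - i) + s)))).
  rewrite /comb; elim: (iota _ _) => [|i r IH]; first by rewrite big_nil.
  by rewrite big_cons /= ev_add IH.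
rewrite -[iota 0 m.+1]/(index_iota 0 m.+1) big_mkord; apply: eq_bigr => i _.
rewrite ev_scale ev_mul ev_exp ev_lM -fdec_gq.
have -> : zi (if odd i then zo (zn 'C(m, i)) else zn 'C(m, i)) = (-1) ^+ i * 'C(m, i)%:R.
  by rewrite -signr_odd; case: (odd i); rewrite ?ziN zi_nat /=; ring.
have -> : p25 ^+ (4 - s) * ((-1) ^+ i * (Gq ^+ 2) ^+ (m - i) * Mq ^+ i *+ 'C(m, i)) =
    fsub 5 ((-1) ^+ i * 'C(m, i)%:R * Mx ^+ i) * gq (2 * (m - i) + s).
  rewrite !rmorphM !rmorphXn rmorphN1 rmorph_nat /= Mq_fsub /gq exprD -exprM.
  have -> : p25 ^+ 4 = p25 ^+ (4 - s) * p25 ^+ s by rewrite -exprD subnK.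
  transitivity ((-1) ^+ i * 'C(m, i)%:R * Mq ^+ i * (p25 ^+ (4 - s) * (p25 * Gq) ^+ s * Gq ^+ (2 *
    (m - i)))).
    rewrite p25_Gq expr1n -[_ *+ _]mulr_natl.
    have r (P C e g M : fps int) : P * (C * (e * g * M)) = e * C * M * (P * 1 * g) by ring.
    by rewrite r.
  have r (P P' C e g g' M : fps int) :
    e * C * M * (P * (P' * g') * g) = e * C * M * (P * P' * (g * g')) by ring.
  by rewrite [(p25 * Gq) ^+ s]exprMn r.
have r (C e M N u : fps int) : N * (e * C * M * u) = e * C * (M * (N * u)) by ring.
by rewrite fdec_fsubM // r.
Qed.

(** Division from the lowest degree upwards by a divisor of constant term 1. No property of it is
    proved: [ubase_check] and [bbase_check] multiply the quotients back. *)
Fixpoint pdivl (n : nat) (l d : seq Z) : seq Z :=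
  match n, l with
  | n'.+1, a :: l' => a :: pdivl n' (padd l' (pscale (zo a) (behead d))) d
  | _, _ => [::]
  end.

Fixpoint pstrip (l : seq Z) : seq Z :=
  if l is a :: l' then
    let s := pstrip l' in if nilp s && BinInt.Z.eqb a (zn 0) then [::] else a :: s
  else [::].

Definition exact_div (l : seq Z) (m j : nat) : seq Z :=
  pstrip (map (fun c => BinInt.Z.div c (zn (4 ^ m))) (pdivl (size l) l (pexp lM j))).

(** [comb 4] belongs to U(x^m) and [comb 3] to U(p x^m). In the second case one factor [Mx] fewer is
    divided out, the one that remains in [fdec_pxq]. *)
Definition ubase m := exact_div (comb 4 m) m (m + 2).
Definition bbase m := exact_div (comb 3 m) m (m + 1).

Lemma ubase_check : all (fun m =>
  peqb (pscale (zn (4 ^ m)) (pmul (pexp lM (m + 2)) (ubase m))) (comb 4 m))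
  (iota 0 5).
Proof. by vm_compute. Qed.

Lemma bbase_check : all (fun m =>
  peqb (pscale (zn (4 ^ m)) (pmul (pexp lM (m + 1)) (bbase m))) (comb 3 m))
  (iota 0 5).
Proof. by vm_compute. Qed.

Lemma pow4_inj m (f g : fps int) : 4 ^+ m * f = 4 ^+ m * g -> f = g.
Proof.
elim: m => [|m IH]; first by rewrite !mul1r.
by rewrite exprS -!mulrA => /natM_inj.
Qed.

Lemma fdec_xq_base m : (m < 5)%N -> U (xq ^+ m) = ev xq (ubase m).
Proof.
move=> m5; have u0 : (Mx ^+ (m + 2)) 0%N = 1 by rewrite coef0X Mx0 expr1n.
have /allP/(_ m) := ubase_check; rewrite mem_iota => /(_ m5) /(ev_eq xq).
rewrite ev_scale ev_mul ev_exp ev_lM zi_nat natrX -comb_eq // mul1r => h.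
by apply: (@pow4_inj m); apply: (fps_cancel u0); rewrite -h; ring.
Qed.

Lemma fdec_pxq_base m : (m < 5)%N -> Mx * U (p25 * xq ^+ m) = ev xq (bbase m).
Proof.
move=> m5; have u0 : (Mx ^+ (m + 1)) 0%N = 1 by rewrite coef0X Mx0 expr1n.
have /allP/(_ m) := bbase_check; rewrite mem_iota => /(_ m5) /(ev_eq xq).
rewrite ev_scale ev_mul ev_exp ev_lM zi_nat natrX -comb_eq // expr1 => h.
apply: (@pow4_inj m); apply: (fps_cancel u0).
transitivity (Mx ^+ (m + 2) * (4 ^+ m * U (p25 * xq ^+ m))); first by rewrite !exprD; ring.
by rewrite -h; ring.
Qed.

Definition lX0 : seq Z := [:: zn 0; zn 1; zn 20; zn 150; zn 500; zn 625].
(* Large coefficients are written as products because [Z.of_nat] needs unary literals. *)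
Definition times (k j : nat) : Z := BinInt.Z.mul (zn k) (zn j).
Definition times3 (k j i : nat) : Z := BinInt.Z.mul (zn k) (times j i).
Definition lX1 : seq Z := [:: zn 0; zn 15; zn 305; times 465 5; times 315 25; times 100 100].
Definition lX2 : seq Z := [:: zn 0; zn 85; times 175 10; times 541 25; times 465 100; times 600 100].
Definition lX3 : seq Z :=
  [:: zn 0; zn 215; times 895 5; times 350 100; times3 122 10 100; times3 160 10 100].
Definition lX4 : seq Z :=
  [:: zn 0; zn 205; times 430 10; times 340 100; times3 120 10 100; times3 160 10 100].

Definition lX := [:: lX0; lX1; lX2; lX3; lX4].

Definition upoly (k : nat) : seq Z := rec_list lX [seq ubase m | m <- iota 0 5] k.
Definition bpoly (k : nat) : seq Z := rec_list lX [seq bbase m | m <- iota 0 5] k.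

Lemma fsub_ev6 c0 c1 c2 c3 c4 c5 :
  fsub 5 (ev xq [:: c0; c1; c2; c3; c4; c5]) =
  zi c0 + yq * (zi c1 + yq * (zi c2 + yq * (zi c3 + yq * (zi c4 + yq * zi c5)))).
Proof.
have e c (f : fps int) : fsub 5 (zi c + xq * f) = zi c + yq * fsub 5 f.
  by rewrite rmorphD rmorphM rmorph_int.
have e0 c : fsub 5 (zi c) = zi c by rewrite rmorph_int.
by rewrite /ev /= mulr0 addr0 !e e0.
Qed.

Lemma xq_recurrence (c : fps int) k : c * xq ^+ (k + 5) =
  fsub 5 (ev xq lX0) * (c * xq ^+ k) + fsub 5 (ev xq lX1) * (c * xq ^+ (k + 1)) +
  fsub 5 (ev xq lX2) * (c * xq ^+ (k + 2)) + fsub 5 (ev xq lX3) * (c * xq ^+ (k + 3)) +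
  fsub 5 (ev xq lX4) * (c * xq ^+ (k + 4)).
Proof.
have key A0 A1 A2 A3 A4 B0 B1 B2 B3 B4 : A0 = B0 -> A1 = B1 -> A2 = B2 ->
    A3 = B3 -> A4 = B4 ->
    c * xq ^+ (k + 5) = B0 * (c * xq ^+ k) + B1 * (c * xq ^+ (k + 1)) +
      B2 * (c * xq ^+ (k + 2)) + B3 * (c * xq ^+ (k + 3)) + B4 * (c * xq ^+ (k + 4)) ->
    c * xq ^+ (k + 5) = A0 * (c * xq ^+ k) + A1 * (c * xq ^+ (k + 1)) +
      A2 * (c * xq ^+ (k + 2)) + A3 * (c * xq ^+ (k + 3)) + A4 * (c * xq ^+ (k + 4)).
  by move=> -> -> -> -> ->.
apply: (key _ _ _ _ _ _ _ _ _ _ (fsub_ev6 _ _ _ _ _ _) (fsub_ev6 _ _ _ _ _ _)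
  (fsub_ev6 _ _ _ _ _ _) (fsub_ev6 _ _ _ _ _ _) (fsub_ev6 _ _ _ _ _ _)).
rewrite exprD xq_quintic; move: (yq) (xq) => y x.
by rewrite !ziM !zi_nat !exprD; ring.
Qed.

Lemma fdec_xq k : U (xq ^+ k) = ev xq (upoly k).
Proof.
rewrite -[LHS]mul1r; apply: (@fdec_recurrence xq _ _ _ _ _ _ _ _ _ _ (fun k => xq ^+ k)).
  by move=> {}k; have := xq_recurrence 1 k; rewrite !mul1r.
all: by rewrite mul1r fdec_xq_base.
Qed.

Lemma fdec_pxq k : Mx * U (p25 * xq ^+ k) = ev xq (bpoly k).
Proof.
apply: (@fdec_recurrence xq _ _ _ _ _ _ _ _ _ _ (fun k => p25 * xq ^+ k)).
  by move=> {}k; apply: xq_recurrence.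
all: by rewrite fdec_pxq_base.
Qed.

End BasePolynomials.

(** * Denominators that are powers of 1 + 5 x *)

Section PolynomialClosure.

Local Notation U := (fdec 5).

Definition hx (P : {poly int}) : fps int := (map_poly intr P).[xq].

Lemma hx_additive : zmod_morphism hx.
Proof. by move=> P Q; rewrite /hx rmorphB hornerD hornerN. Qed.
Lemma hx_multiplicative : monoid_morphism hx.
Proof. by split=> [|P Q]; rewrite /hx ?rmorph1 ?hornerC // rmorphM hornerM. Qed.
HB.instance Definition _ := GRing.isZmodMorphism.Build {poly int} (fps int) hx hx_additive.
HB.instance Definition _ := GRing.isMonoidMorphism.Build {poly int} (fps int) hx hx_multiplicative.

Lemma hxX : hx 'X = xq. Proof. by rewrite /hx map_polyX hornerX. Qed.

Definition hy (P : {poly int}) : fps int := fsub 5 (hx P).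
Lemma hy_additive : zmod_morphism hy.
Proof. by move=> P Q; rewrite /hy !rmorphB. Qed.
Lemma hy_multiplicative : monoid_morphism hy.
Proof. by split=> [|P Q]; rewrite /hy ?rmorph1 // !rmorphM. Qed.
HB.instance Definition _ := GRing.isZmodMorphism.Build {poly int} (fps int) hy hy_additive.
HB.instance Definition _ := GRing.isMonoidMorphism.Build {poly int} (fps int) hy hy_multiplicative.

(** The outer variable stands for x and the inner one for y, so that coefficients leave U by the
    projection formula and only powers of x remain inside. *)
Definition hxy (P : {poly {poly int}}) : fps int := (map_poly hy P).[xq].
Lemma hxy_additive : zmod_morphism hxy.
Proof. by move=> P Q; rewrite /hxy rmorphB hornerD hornerN. Qed.
Lemma hxy_multiplicative : monoid_morphism hxy.
Proof. by split=> [|P Q]; rewrite /hxy ?rmorph1 ?hornerC // rmorphM hornerM. Qed.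
HB.instance Definition _ := GRing.isZmodMorphism.Build {poly {poly int}} (fps int) hxy hxy_additive.
HB.instance Definition _ := GRing.isMonoidMorphism.Build {poly {poly int}} (fps int) hxy
  hxy_multiplicative.

Lemma hxyX : hxy 'X = xq. Proof. by rewrite /hxy map_polyX hornerX. Qed.
Lemma hxyY : hxy ('X)%:P = yq.
Proof. by rewrite /hxy map_polyC hornerC /= /hy hxX. Qed.

Lemma hx_ev l : exists P, ev xq l = hx P.
Proof.
elim: l => [|c l [P IH]]; first by exists 0; rewrite rmorph0.
exists ((int_of_Z c)%:~R + 'X * P).
by rewrite rmorphD rmorphM /= hxX -IH rmorph_int.
Qed.

Lemma hx_sum n (F : nat -> fps int) :
  (forall i, exists P, F i = hx P) -> exists P, \sum_(i < n) F i = hx P.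
Proof.
move=> /choice[P hP]; exists (\sum_(i < n) P i); rewrite rmorph_sum /=.
exact: eq_bigr.
Qed.

Lemma hx_fdec_hxy (c d : fps int) (P : {poly {poly int}}) :
  (forall k, exists Q, d * U (c * xq ^+ k) = hx Q) ->
  exists Q, d * U (c * hxy P) = hx Q.
Proof.
move=> h; rewrite /hxy horner_coef big_distrr /= raddf_sum big_distrr /=.
apply: (@hx_sum _ (fun i => d * U (c * ((map_poly hy P)`_i * xq ^+ i)))) => i.
have [Q hQ] := h i; exists (P`_i * Q); rewrite rmorphM /= -hQ coef_map /= /hy.
by rewrite mulrCA fdec_fsubM // mulrCA.
Qed.

Lemma one5x_dvd_hxy : exists K, (1 + 5 * yq) ^+ 5 = (1 + 5 * xq) * hxy K.
Proof.
rewrite one5x_dvd.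
set f := (X in (1 + 5 * xq) * X); suff [K ->] : exists K, f = hxy K by exists K.
pose S g := exists K, g = hxy K.
have nat n : S n%:R by exists n%:R; rewrite rmorph_nat.
have D g h : S g -> S h -> S (g + h) by move=> [P ->] [Q ->]; exists (P + Q); rewrite rmorphD.
have N g : S g -> S (- g) by move=> [P ->]; exists (- P); rewrite rmorphN.
have M g h : S g -> S h -> S (g * h) by move=> [P ->] [Q ->]; exists (P * Q); rewrite rmorphM.
have X g n : S g -> S (g ^+ n) by move=> [P ->]; exists (P ^+ n); rewrite rmorphXn.
have x : S xq by exists 'X; rewrite hxyX.
have y : S yq by exists ('X)%:P; rewrite hxyY.
rewrite -/(S f) /f; move: (xq) (yq) x y => x y hx hy.
have one : S 1 by exact: (nat 1%N).
by repeat first [exact one | exact hx | exact hy | simple apply nat | simple apply X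
  | simple apply D | simple apply N | simple apply M].
Qed.

(** Moved inside U, [(1 + 5 x) ^ (5 n)] becomes [(1 + 5 y) ^ (5 n)], a multiple of [(1 + 5 x) ^ n]
    by [one5x_dvd]. This clears the denominator of [L], at the price of the factor 5 in the
    exponent. *)
Lemma hx_fdec_localized (c d L : fps int) n :
  (forall k, exists Q, d * U (c * xq ^+ k) = hx Q) ->
  (exists P, (1 + 5 * xq) ^+ n * L = hx P) ->
  exists Q, (1 + 5 * xq) ^+ (5 * n) * (d * U (c * L)) = hx Q.
Proof.
move=> h [P hP]; have [K hK] := one5x_dvd_hxy.
have [P2 hP2] : exists P2, hx P = hxy P2.
  exists (map_poly (fun a => a%:~R) P); rewrite /hx /hxy -map_poly_comp.
  congr _.[_]; apply: eq_map_poly => a /=.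
  by rewrite rmorph_int.
have [Q hQ] := @hx_fdec_hxy c d (K ^+ n * P2) h; exists Q; rewrite -hQ mulrCA; congr (_ * _).
rewrite -fdec_fsubM // rmorphXn rmorphD rmorphM rmorph1 rmorph_nat /= -/yq exprM hK.
by rewrite rmorphM rmorphXn /= -hP2 -hP exprMn; congr fdec; ring.
Qed.

Lemma hx_U L n : (exists P, (1 + 5 * xq) ^+ n * L = hx P) ->
  exists Q, (1 + 5 * xq) ^+ (5 * n) * U L = hx Q.
Proof.
move=> hL; have [|Q hQ] := @hx_fdec_localized 1 1 L n _ hL.
  by move=> k; rewrite !mul1r fdec_xq; apply: hx_ev.
by exists Q; rewrite -hQ !mul1r.
Qed.

(* The passage from [L_(2a)] to [L_(2a+1)]; the eta quotients in the definition of L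
   collapse to this kernel. *)
Definition W (f : fps int) : fps int :=
  Mx ^+ 6 * finv (1 + 5 * xq) ^+ 6 * U (p25 * xq ^+ 6 * f).

Lemma one5x0 : (1 + 5 * xq) 0%N = 1.
Proof. by rewrite fpsDE fps1E coef0M xq0 mulr0 addr0. Qed.

(** The extra 6 is the explicit denominator of [W]. Of the six factors [Mx], one makes [fdec_pxq]
    applicable and the other five are polynomial already. *)
Lemma hx_W L n : (exists P, (1 + 5 * xq) ^+ n * L = hx P) ->
  exists Q, (1 + 5 * xq) ^+ (5 * n + 6) * W L = hx Q.
Proof.
move=> hL; have [|Q hQ] := @hx_fdec_localized (p25 * xq ^+ 6) Mx L n _ hL.
  by move=> k; rewrite -mulrA -exprD fdec_pxq; apply: hx_ev.
have [R hR] : exists R, Mx ^+ 5 = hx R.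
  by have [R hR] := hx_ev (pexp lM 5); exists R; rewrite -hR ev_exp ev_lM.
exists (R * Q); rewrite rmorphM /= -hQ -hR /W exprD.
transitivity ((1 + 5 * xq) ^+ (5 * n) * Mx ^+ 6 * ((1 + 5 * xq) * finv (1 + 5 * xq)) ^+ 6
  * U (p25 * xq ^+ 6 * L)); first by rewrite exprMn; ring.
by rewrite finvK ?one5x0 // expr1n; ring.
Qed.

End PolynomialClosure.

(** * Power series in x *)

Section ExpansionInX.

Lemma eqm_M0 K (f g : fps int) : eqm K f 0 -> eqm K (g * f) 0.
Proof. by move=> h; have := eqmM (@eqm_refl _ K g) h; rewrite mulr0. Qed.

Lemma eqm_subr0 K (f g : fps int) : eqm K f g -> eqm K (f - g) 0.
Proof. by move=> h n nK; rewrite fpsBE h // subrr. Qed.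

Lemma eqm_xq K m : (K <= m)%N -> eqm K (xq ^+ m) 0.
Proof. by move=> Km; apply: eqm_le Km _; apply: eqm_exp0; apply: xq0. Qed.

Lemma xq_lead n : (xq ^+ n) n = 1.
Proof.
have [g gE] := fps_shift xq0.
have g0 : g 0%N = 1 by have := xq1; rewrite gE qpowME leqnn subnn.
by rewrite gE exprMn qpowX mul1n qpowME leqnn subnn coef0X g0 expr1n.
Qed.

(* Meaningful because [xq ^+ m] has valuation [m]. *)
Definition comp (c : fps int) : fps int :=
  Fps (fun n => (\sum_(m < n.+1) (c m)%:~R * xq ^+ m) n).

Lemma comp_eqm (c : fps int) K N : (K <= N)%N ->
  eqm K (comp c) (\sum_(m < N) (c m)%:~R * xq ^+ m).
Proof.
move=> KN n nK; have [d ->] : exists d, N = (n.+1 + d)%N.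
  by exists (N - n.+1)%N; rewrite subnKC // (leq_trans nK).
rewrite big_split_ord fpsDE -[LHS]addr0; congr (_ + _); symmetry.
rewrite fps_sumE big1 // => i _; rewrite fps_intME /=.
by rewrite (@eqm_xq n.+1 (n.+1 + i)) ?leq_addr // mulr0.
Qed.

Lemma comp_hx (c : fps int) (P : {poly int}) K : (forall m, (m < K)%N -> P`_m = c m) ->
  eqm K (comp c) (hx P).
Proof.
move=> h; apply: eqm_trans (@comp_eqm c K (K + size P) (leq_addr _ _)) _.
rewrite /hx (@horner_coef_wide _ (K + size P)); last first.
  by apply: leq_trans (size_poly _ _) (leq_addl _ _).
apply: eqm_sum => i _; rewrite coef_map /=; have [iK|Ki] := ltnP i K.
  by rewrite h.
by apply: (@eqm_trans _ _ _ 0); [|apply: eqm_sym]; apply: eqm_M0; apply: eqm_xq.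
Qed.

Lemma comp_congr K (c d : fps int) : eqm K c d -> eqm K (comp c) (comp d).
Proof.
move=> h; apply: eqm_trans (@comp_hx c (trunc K c) K _) _.
  by move=> m mK; rewrite coef_trunc.
by apply: eqm_sym; apply: comp_hx => m mK; rewrite coef_trunc // h.
Qed.

Lemma compM c d : comp (c * d) = comp c * comp d.
Proof.
apply: eqmP => K; apply: eqm_trans (@comp_hx _ (trunc K c * trunc K d) K _) _.
  by move=> m mK; rewrite -fps_mulE.
rewrite rmorphM /=; apply: eqm_sym; apply: eqmM; apply: comp_hx => m mK;
  by rewrite coef_trunc.
Qed.

Lemma comp_additive : zmod_morphism comp.
Proof.
move=> c d; apply/fpsP => n; rewrite fpsBE.
have e (f : fps int) : comp f n = (\sum_(m < n.+1) (f m)%:~R * xq ^+ m) n by [].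
rewrite !e -fpsBE -sumrB.
by congr (coefs _ n); apply: eq_bigr => i _; rewrite fpsBE intrB; ring.
Qed.

HB.instance Definition _ :=
  GRing.isZmodMorphism.Build (fps int) (fps int) comp comp_additive.

Lemma comp_qpow k : comp (qpow int k) = xq ^+ k.
Proof.
apply: eqmP => K; apply: eqm_trans (@comp_hx _ 'X^k K _) _.
  by move=> m mK; rewrite coefXn qpowE; case: eqP.
by rewrite rmorphXn /= hxX.
Qed.

Lemma comp1 : comp 1 = 1. Proof. by rewrite -qpow0 comp_qpow. Qed.

HB.instance Definition _ := GRing.isMonoidMorphism.Build (fps int) (fps int)
  comp (conj comp1 compM).

(** Since x = q + ..., the passage from x-coefficients to q-coefficients is triangular with ones on
    the diagonal. *)
Lemma comp_inj0 K c : eqm K (comp c) 0 -> eqm K c 0.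
Proof.
move=> h n; elim/ltn_ind: n => n IH nK.
have := h n nK; rewrite (@comp_eqm c n.+1 n.+1) // big_ord_recr fpsDE.
rewrite fps_sumE big1 ?add0r => [|i _]; last first.
  by rewrite fps_intME /= IH ?mul0r // (ltn_trans _ nK).
by rewrite fps_intME -[nat_of_ord ord_max]/n xq_lead mulr1 intz.
Qed.

Lemma fdec_continuous K (f : fps int) : eqm (5 * K) f 0 -> eqm K (fdec 5 f) 0.
Proof. by move=> h; rewrite -(raddf0 (fdec 5)); apply: eqm_fdec. Qed.

(** The continuity hypothesis forces [T (xq ^ m)] to have no term in x^r once [m >= 5 (r + 1)]. Each
    coefficient of the image is therefore a finite sum, the same for every cutoff [N r] beyond this
    bound. *)
Lemma comp_operator (T : {additive fps int -> fps int}) (tau : nat -> fps int)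
    (c : fps int) (N : nat -> nat) :
  (forall K f, eqm (5 * K) f 0 -> eqm K (T f) 0) ->
  (forall m, T (xq ^+ m) = comp (tau m)) ->
  (forall r, 5 * r.+1 <= N r)%N ->
  T (comp c) = comp (Fps (fun r => \sum_(m < N r) c m * tau m r)).
Proof.
move=> hT htau hN; apply: eqmP => K.
have tau0 r m : (5 * r.+1 <= m)%N -> tau m r = 0.
  move=> rm; apply: (@comp_inj0 r.+1 (tau m)) => //; rewrite -htau.
  by apply: hT; apply: eqm_xq.
apply: (@eqm_trans _ _ _ (T (\sum_(m < 5 * K) (c m)%:~R * xq ^+ m))).
  have : eqm K (T (comp c - \sum_(m < 5 * K) (c m)%:~R * xq ^+ m)) 0.
    by apply: hT; apply: eqm_subr0; apply: comp_eqm.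
  by move=> h n nK; have := h n nK; rewrite raddfB fpsBE => /eqP; rewrite subr_eq0 => /eqP.
rewrite raddf_sum /=.
have -> : \sum_(i < 5 * K) T ((c i)%:~R * xq ^+ i) = comp (\sum_(i < 5 * K) (c i)%:~R * tau i).
  rewrite rmorph_sum; apply: eq_bigr => i _.
  by rewrite !mulrzl !raddfMz /= htau.
apply: comp_congr => r rK; rewrite fps_sumE.
under eq_bigr => i _ do rewrite fps_intME intz.
have tail M : (5 * r.+1 <= M)%N ->
    \sum_(i < M) c i * tau i r = \sum_(i < 5 * r.+1) c i * tau i r.
  move=> rM; have [d ->] : exists d, M = (5 * r.+1 + d)%N by exists (M - 5 * r.+1)%N; rewrite subnKC.
  rewrite big_split_ord /= [X in _ + X]big1 ?addr0 // => i _.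
  by rewrite tau0 ?mulr0 // leq_addr.
rewrite -[RHS]/(\sum_(m < N r) c m * tau m r).
by rewrite !tail // leq_mul2l.
Qed.

Definition lfps (l : seq Z) : fps int := Fps (fun r => int_of_Z (nth (zn 0) l r)).

Lemma lfps_nil : lfps [::] = 0.
Proof. by apply/fpsP => r; rewrite /= nth_nil. Qed.

Lemma lfps_add l1 l2 : lfps (padd l1 l2) = lfps l1 + lfps l2.
Proof.
apply/fpsP => r; rewrite fpsDE /=; elim: l1 l2 r => [|a l1 IH] [|b l2] [|r] //=;
  rewrite ?nth_nil ?add0r ?addr0 //.
by rewrite -rmorphD.
Qed.

Lemma lfps_cons a l : lfps (a :: l) = (int_of_Z a)%:~R + qpow int 1 * lfps l.
Proof.
apply/fpsP => -[|r]; rewrite fpsDE fps_intE qpowME /= ?addr0 ?intz ?add0r //.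
by rewrite subn1.
Qed.

Lemma lfps_scale c l : lfps (pscale c l) = (int_of_Z c)%:~R * lfps l.
Proof.
elim: l => [|a l IH]; first by rewrite lfps_nil mulr0.
have -> : pscale c (a :: l) = BinInt.Z.mul c a :: pscale c l by [].
rewrite !lfps_cons IH.
by rewrite -[BinInt.Z.mul c a]/(c * a) !rmorphM /=; ring.
Qed.

Lemma lfps_mul l1 l2 : lfps (pmul l1 l2) = lfps l1 * lfps l2.
Proof.
elim: l1 => [|a l1 IH]; first by rewrite lfps_nil mul0r.
have -> : pmul (a :: l1) l2 = padd (pscale a l2) (zn 0 :: pmul l1 l2) by [].
by rewrite lfps_add lfps_scale !lfps_cons IH rmorph0; ring.
Qed.

Lemma comp_lfps l : comp (lfps l) = ev xq l.
Proof.
elim: l => [|a l IH]; first by rewrite lfps_nil raddf0.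
by rewrite lfps_cons ev_cons rmorphD rmorphM /= IH comp_qpow expr1 rmorph_int.
Qed.

End ExpansionInX.

(** * 5-adic estimates *)

Section FiveAdicSlopes.

Local Notation U := (fdec 5).

Definition dvd5 (n : nat) (z : int) := exists t, z = 5 ^+ n * t.

Lemma dvd5_0 n : dvd5 n 0. Proof. by exists 0; rewrite mulr0. Qed.
Lemma dvd5D n a b : dvd5 n a -> dvd5 n b -> dvd5 n (a + b).
Proof. by move=> [t ->] [s ->]; exists (t + s); rewrite mulrDr. Qed.
Lemma dvd5N n a : dvd5 n a -> dvd5 n (- a).
Proof. by move=> [t ->]; exists (- t); rewrite mulrN. Qed.
Lemma dvd5M n m a b : dvd5 n a -> dvd5 m b -> dvd5 (n + m) (a * b).
Proof. by move=> [t ->] [s ->]; exists (t * s); rewrite exprD; ring. Qed.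
Lemma dvd5Ml n a b : dvd5 n b -> dvd5 n (a * b).
Proof. by move=> [t ->]; exists (a * t); ring. Qed.
Lemma dvd5_le n m a : (m <= n)%N -> dvd5 n a -> dvd5 m a.
Proof. by move=> mn [t ->]; exists (5 ^+ (n - m) * t); rewrite mulrA -exprD subnKC. Qed.
Lemma dvd5_any a : dvd5 0 a. Proof. by exists a; rewrite mul1r. Qed.
Lemma dvd5_sum n I (r : seq I) (P : pred I) (F : I -> int) :
  (forall i, P i -> dvd5 n (F i)) -> dvd5 n (\sum_(i <- r | P i) F i).
Proof.
move=> h; elim/big_ind: _ => //; first exact: dvd5_0.
by move=> x y; apply: dvd5D.
Qed.

Definition sl (s r : nat) : nat := ((5 * r + 5 - s) %/ 6)%N.

(* The coefficient of [t ^ r] is divisible by [5 ^ ((5 r - s) / 6)], rounded up. *)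
Definition slope (s : nat) (c : fps int) := forall r, dvd5 (sl s r) (c r).

Lemma slope_le s s' c : (s <= s')%N -> slope s c -> slope s' c.
Proof. by move=> ss h r; apply: dvd5_le (h r); rewrite /sl; lia. Qed.

Lemma slopeD s c d : slope s c -> slope s d -> slope s (c + d).
Proof. by move=> hc hd r; apply: dvd5D. Qed.

Lemma slopeM s s' c d : slope s c -> slope s' d -> slope (s + s') (c * d).
Proof.
move=> hc hd r; rewrite fpsME; apply: dvd5_sum => i _.
apply: dvd5_le (dvd5M (hc i) (hd (r - i)%N)).
have ir : (i <= r)%N by rewrite -ltnS.
rewrite /sl; lia.
Qed.

(** Each division step multiplies by 5 when the degree rises by 1, which exceeds the required 5 /
    6. *)
Lemma slope_finv c : slope 0 c -> slope 0 (finv (1 + 5 * qpow int 1) * c).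
Proof.
move=> hc; set d := _ * c => r.
have u0 : (1 + 5 * qpow int 1) 0%N = 1 :> int by rewrite fpsDE fps1E coef0M mulr0 addr0.
have e : d + 5 * (qpow int 1 * d) = c.
  transitivity ((1 + 5 * qpow int 1) * d); first by ring.
  by rewrite mulrA finvK // mul1r.
elim: r => [|r IH]; first exact: dvd5_any.
have -> : d r.+1 = c r.+1 - 5 * d r.
  by rewrite -e fpsDE fps_natME qpowME subn1 /= addrK.
apply: dvd5D; first exact: hc.
apply: dvd5N; apply: dvd5_le (dvd5M (n := 1) _ IH); first by rewrite /sl; lia.
by exists 1; rewrite mulr1 expr1.
Qed.

Definition z5 (n : nat) : Z := iter n (BinInt.Z.mul (zn 5)) (zn 1).

Definition z_dvd5 (n : nat) (a : Z) : bool :=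
  BinInt.Z.eqb (BinInt.Z.modulo a (z5 n)) (zn 0).

Lemma z5E n : int_of_Z (z5 n) = 5 ^+ n.
Proof.
elim: n => // n IH; rewrite /z5 iterS -/(z5 n).
by rewrite -[BinInt.Z.mul _ _]/((zn 5 : Z) * z5 n) rmorphM /= IH exprS.
Qed.

Lemma z_dvd5P n a : z_dvd5 n a -> dvd5 n (int_of_Z a).
Proof.
rewrite /z_dvd5 => h; have := BinInt.Z.div_mod a (z5 n).
have -> : BinInt.Z.modulo a (z5 n) = zn 0 by move: h; case: (BinInt.Z.modulo _ _).
move=> e; exists (int_of_Z (BinInt.Z.div a (z5 n))).
rewrite -z5E -rmorphM; congr int_of_Z.
rewrite -[RHS]/(BinInt.Z.mul (z5 n) (BinInt.Z.div a (z5 n))).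
rewrite {1}e ?BinInt.Z.add_0_r // => z0; have := z5E n; rewrite z0 => /esym/eqP.
by rewrite expf_eq0 andbF.
Qed.

Fixpoint slope_check (s r : nat) (l : seq Z) : bool :=
  if l is a :: l' then z_dvd5 (sl s r) a && slope_check s r.+1 l' else true.

Lemma slope_checkP s l : slope_check s 0 l -> slope s (lfps l).
Proof.
move=> h r /=; rewrite -[r in sl s r]add0n; move: (0%N) h => i.
elim: l r i => [|a l IH] [|r] i //=.
- by move=> _; apply: dvd5_0.
- by move=> _; apply: dvd5_0.
- by rewrite addn0 => /andP[/z_dvd5P].
- by rewrite addnS -addSn => /andP[_ /IH].
Qed.

(** The list [lXj] has slope bound [5 - j], so every term of the recurrence for index [k + 5] has
    the bound [(5 - j) + (k + j) + del]: only five initial values need checking. The rate 5 / 6 is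
    tight at the coefficient 160 * 10^3 of y^5 x^4 in the quintic, where (25 - 1) / 6 = 4. *)
Lemma slope_upoly_gen (del : nat) (base : seq (seq Z)) : size base = 5 ->
  (forall j, (j < 5)%N -> slope_check (j + del) 0 (nth [::] base j)) ->
  forall k, slope (k + del) (lfps (rec_list lX base k)).
Proof.
move=> sb hb k; rewrite /rec_list.
suff [st_size st_sl] : size (iter k (rec_step lX) base) = 5 /\ forall j, (j < 5)%N ->
    slope (k + j + del) (lfps (nth [::] (iter k (rec_step lX) base) j)).
  by have := st_sl 0%N isT; rewrite addn0 nth0.
elim: k => [|k [IHs IH]].
  by split=> // j j5; apply: slope_checkP; apply: hb.
rewrite iterS; move: (iter k _ _) IHs IH => st IHs IH.
case: st IHs IH => [|c0 [|c1 [|c2 [|c3 [|c4 [|? ?]]]]]] // _ IH.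
split=> // j j5; have [j4|] := ltnP j 4.
  have := IH j.+1; rewrite addSnnS => /(_ j4).
  by case: j j4 {j5} => [|[|[|[|]]]].
move=> j4; have {j4 j5}-> : j = 4%N by lia.
have -> : nth [::] (rec_step lX [:: c0; c1; c2; c3; c4]) 4 =
  padd (pmul lX0 c0) (padd (pmul lX1 c1) (padd (pmul lX2 c2)
    (padd (pmul lX3 c3) (padd (pmul lX4 c4) [::])))) by [].
have key P0 P1 P2 P3 P4 : lfps (padd P0 (padd P1 (padd P2 (padd P3 (padd P4 [::]))))) =
    lfps P0 + (lfps P1 + (lfps P2 + (lfps P3 + lfps P4))).
  by rewrite !lfps_add lfps_nil addr0.
rewrite key (lfps_mul lX0) (lfps_mul lX1) (lfps_mul lX2) (lfps_mul lX3) (lfps_mul lX4).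
have h0 : slope 5 (lfps lX0) by apply: slope_checkP; vm_compute.
have h1 : slope 4 (lfps lX1) by apply: slope_checkP; vm_compute.
have h2 : slope 3 (lfps lX2) by apply: slope_checkP; vm_compute.
have h3 : slope 2 (lfps lX3) by apply: slope_checkP; vm_compute.
have h4 : slope 1 (lfps lX4) by apply: slope_checkP; vm_compute.
have e0 : slope (k + 0 + del) (lfps c0) := IH 0%N isT.
have e1 : slope (k + 1 + del) (lfps c1) := IH 1%N isT.
have e2 : slope (k + 2 + del) (lfps c2) := IH 2%N isT.
have e3 : slope (k + 3 + del) (lfps c3) := IH 3%N isT.
have e4 : slope (k + 4 + del) (lfps c4) := IH 4%N isT.
by do ?apply: slopeD; [apply: slope_le (slopeM h0 e0) | apply: slope_le (slopeM h1 e1) |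
  apply: slope_le (slopeM h2 e2) | apply: slope_le (slopeM h3 e3) | apply: slope_le (slopeM h4
    e4)]; lia.
Qed.

Lemma slope_upoly k : slope (k + 6) (lfps (upoly k)).
Proof.
apply: slope_upoly_gen => // j j5.
have : all (fun j => slope_check (j + 6) 0 (nth [::] [seq ubase m | m <- iota 0 5] j)) (iota 0 5).
  by vm_compute.
by move/allP/(_ j); rewrite mem_iota => /(_ j5).
Qed.

Lemma slope_bpoly k : slope (k + 8) (lfps (bpoly k)).
Proof.
apply: slope_upoly_gen => // j j5.
have : all (fun j => slope_check (j + 8) 0 (nth [::] [seq bbase m | m <- iota 0 5] j)) (iota 0 5).
  by vm_compute.
by move/allP/(_ j); rewrite mem_iota => /(_ j5).
Qed.

End FiveAdicSlopes.

(** * The two lattices and their exchange *)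

Section FiveAdicLattices.

Local Notation U := (fdec 5).

Lemma W_additive : zmod_morphism W.
Proof. by move=> f g; rewrite /W mulrBr raddfB mulrBr. Qed.
HB.instance Definition _ := GRing.isZmodMorphism.Build (fps int) (fps int) W W_additive.

Lemma W_continuous K f : eqm (5 * K) f 0 -> eqm K (W f) 0.
Proof.
by move=> h; rewrite /W; apply: eqm_M0; apply: fdec_continuous; apply: eqm_M0.
Qed.

Definition den : fps int := finv (1 + 5 * qpow int 1).

Lemma den_unit : (1 + 5 * qpow int 1) * den = 1.
Proof. by rewrite finvK // fpsDE fps1E coef0M mulr0 addr0. Qed.

Lemma comp_den : comp den = finv (1 + 5 * xq).
Proof.
apply: (fps_cancel one5x0); rewrite finvK ?one5x0 //.
have <- : comp (1 + 5 * qpow int 1) = 1 + 5 * xq.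
  by rewrite rmorphD rmorphM rmorph1 rmorph_nat /= comp_qpow expr1.
by rewrite -rmorphM den_unit rmorph1.
Qed.

Definition lw m : seq Z := pmul (pexp lM 5) (bpoly (6 + m)).
Definition wser m : fps int := den ^+ 6 * lfps (lw m).

Lemma W_xq m : W (xq ^+ m) = comp (wser m).
Proof.
rewrite /wser rmorphM rmorphXn /= comp_den comp_lfps ev_mul ev_exp ev_lM -fdec_pxq.
have <- : p25 * xq ^+ 6 * xq ^+ m = p25 * xq ^+ (6 + m) by rewrite exprD mulrA.
by rewrite /W; ring.
Qed.

Lemma slope_den s c : slope s c -> slope s (den * c).
Proof.
have h1 : slope 0 1 by move=> -[|r]; [exact: dvd5_any | exact: dvd5_0].
have := slope_finv h1; rewrite mulr1 -/den => h hc.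
exact: slopeM h hc.
Qed.

Lemma slope_wser m : slope (m + 39) (wser m).
Proof.
(* Degree 5 makes the bound 25 vacuous. Then 25 + (6 + m) + 8 = m + 39. *)
have hM : slope 25 (lfps (pexp lM 5)) by apply: slope_checkP; vm_compute.
rewrite /wser /lw lfps_mul !exprS expr0 mulr1 -!mulrA.
do 6 apply: slope_den.
by apply: slope_le (slopeM hM (slope_bpoly (6 + m))); lia.
Qed.

(** [lat0_W] needs an extra 5 on every power from x^6 on, so [th0] first jumps at 6. The bound for
    U(x^m) at r = 6 becomes void at m = 5 * 6 - 6 = 24, where [th1] must jump. Neither may stay
    bounded, because the slope bounds are void for large m; the slow rates 1/20 and 1/50 satisfy the
    inequalities of [lat1_U] and [lat0_W]. *)
Definition th0 (m : nat) : nat := ((m + 14) %/ 20)%N.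
Definition th1 (m : nat) : nat := ((m + 26) %/ 50)%N.

(** This is t^2 (1 - t)(1 - t^5), congruent to t^2 (1 + 4 t)^6 modulo 5: the factor (1 + 4 x)^6 of
    [W] is visible in it. *)
Definition lh0 : seq Z :=
  let o := BinInt.Z.opp (zn 1) in
  [:: zn 0; zn 0; zn 1; o; zn 0; zn 0; zn 0; o; zn 1].
Definition h0 : nat -> int := lfps lh0.

Lemma h0_large r : (8 < r)%N -> h0 r = 0.
Proof. by move=> hr; rewrite /h0 /= nth_default. Qed.

(* Modulo [5 ^ (k + 1)] the operator [W] maps [lat0 k] to the multiples of [h0], and [U]
   turns [h0] into a multiple of 5; this is why [lat1] needs the term in [h0]. *)
Definition lat0 k (f : fps int) := exists c : fps int,
  [/\ f = comp c, c 0%N = 0 & forall r, dvd5 (k + th0 r) (c r)].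

Definition lat1 k (f : fps int) := exists (c : fps int) (t : int),
  [/\ f = comp c, c 0%N = 0 & forall r, dvd5 (k + 1 + th1 r) (c r - 5 ^+ k * t * h0 r)].

Lemma lat_coef k (c : fps int) n : (forall r, dvd5 k (c r)) -> dvd5 k (comp c n).
Proof.
move=> h; rewrite /comp /= fps_sumE; apply: dvd5_sum => i _.
by rewrite fps_intME intz mulrC; apply: dvd5Ml.
Qed.

Lemma lat0_dvd k f n : lat0 k f -> dvd5 k (f n).
Proof.
move=> [c [-> _ h]]; apply: lat_coef => r; apply: dvd5_le (h r); exact: leq_addr.
Qed.

Lemma lat1_dvd k f n : lat1 k f -> dvd5 k (f n).
Proof.
move=> [c [t [-> _ h]]]; apply: lat_coef => r.
rewrite -(subrK (5 ^+ k * t * h0 r) (c r)); apply: dvd5D.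
  by apply: dvd5_le (h r); rewrite -addnA leq_addr.
by exists (t * h0 r); rewrite mulrA.
Qed.

Definition useq m : fps int := lfps (upoly m).

Lemma U_xq m : U (xq ^+ m) = comp (useq m).
Proof. by rewrite fdec_xq comp_lfps. Qed.

(** The coefficients of U applied to [h0] in x. Only r < 6 needs the computation in [hU_small],
    since for larger r the slope bound of each of the four terms suffices. *)
Definition hU r : int := useq 2 r - useq 3 r - useq 7 r + useq 8 r.

Lemma hU_small : all (fun r => z_dvd5 1 (BinInt.Z.add (BinInt.Z.sub (BinInt.Z.sub
  (nth (zn 0) (upoly 2) r) (nth (zn 0) (upoly 3) r)) (nth (zn 0) (upoly 7) r))
  (nth (zn 0) (upoly 8) r))) (iota 0 6).
Proof. by vm_compute. Qed.

Lemma hU_dvd r : dvd5 (1 + th0 r) (hU r).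
Proof.
have [r6|r6] := ltnP r 6.
  have -> : th0 r = 0%N by rewrite /th0; lia.
  have /allP/(_ r) := hU_small; rewrite mem_iota => /(_ r6) /z_dvd5P.
  rewrite addn0; set z := int_of_Z _; suff -> : z = hU r by [].
  rewrite /z -[BinInt.Z.add _ _]/((_ : Z) - _ - _ + _ : Z).
  by rewrite !(rmorphD, rmorphB, rmorphN).
have d m : (m <= 8)%N -> dvd5 (1 + th0 r) (useq m r).
  by move=> m8; apply: dvd5_le (slope_upoly m r); rewrite /sl /th0; lia.
apply: dvd5D (d 8 _) => //; apply: dvd5D (dvd5N (d 7 _)) => //.
by apply: dvd5D (d 2 _) (dvd5N (d 3 _)).
Qed.

Lemma useq0 m : (0 < m)%N -> useq m 0%N = 0.
Proof.
move=> m0; apply: (@comp_inj0 1) => //; rewrite -U_xq => -[|//] _.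
by rewrite fdecE muln0 coef0X xq0 expr0n gtn_eqF.
Qed.

(** The part of [c] off [h0] has its additional factor 5 already, and the slope bound carries it
    through U; the multiple of [h0] acquires its factor from [hU_dvd]. The 9 in [N] makes room for
    the support of [h0]. *)
Lemma lat1_U k f : lat1 k f -> lat0 k.+1 (U f).
Proof.
move=> [c [t [-> c0 hc]]]; pose N r := (5 * r.+1 + 9)%N.
rewrite (@comp_operator U useq c N (@fdec_continuous) U_xq); last by move=> r; rewrite leq_addr.
eexists; split; first by [].
- rewrite /= big_ord_recl c0 mul0r add0r big1 // => i _.
  by rewrite [X in _ * X]useq0 ?mulr0.
move=> r; rewrite -[coefs _ _]/(\sum_(m < N r) c m * useq m r).
have -> : \sum_(m < N r) c m * useq m r =
    \sum_(m < N r) (c m - 5 ^+ k * t * h0 m) * useq m r + 5 ^+ k * (t * hU r).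
  have -> : t * hU r = \sum_(m < N r) t * h0 m * useq m r.
    rewrite /N addnC big_split_ord /= [X in _ + X]big1 ?addr0 => [|i _]; last first.
      by rewrite h0_large ?mulr0 ?mul0r // ltnS leq_addr.
    rewrite !big_ord_recr big_ord0 [nat_of_ord _]/= /=.
    have [e0 e1 e2 e3] : [/\ h0 0 = 0, h0 1 = 0, h0 2 = 1 & h0 3 = -1] by [].
    have [e4 e5 e6 e7 e8] : [/\ h0 4 = 0, h0 5 = 0, h0 6 = 0, h0 7 = -1 & h0 8 = 1] by [].
    by rewrite e0 e1 e2 e3 e4 e5 e6 e7 e8 /hU; ring.
  rewrite big_distrr -big_split /=; apply: eq_bigr => m _; ring.
apply: dvd5D; last first.
  apply: (@dvd5_le (k + (1 + th0 r))); first by lia.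
  apply: dvd5M.
    by exists 1; rewrite mulr1.
  by apply: dvd5Ml; apply: hU_dvd.
apply: dvd5_sum => m _; apply: dvd5_le (dvd5M (hc m) (slope_upoly m r)).
rewrite /th0 /th1 /sl; lia.
Qed.

(** Computed residues: modulo 5, [W (xq ^ m)] is [gam m] times [h0] in x for m from 1 to 5, with
    [gam 5] the default value 0. *)
Definition gam (m : nat) : int := nth 0 [:: 0; 1; 3; 0; 1] m.

Lemma lw_small1 : all (fun m => all (fun r => z_dvd5 1 (BinInt.Z.sub (nth (zn 0) (lw m) r)
   (BinInt.Z.mul (nth (zn 0) (map zn [:: 0; 1; 3; 0; 1]%N) m) (nth (zn 0) lh0 r))))
   (iota 0 24)) (iota 1 5).
Proof. by vm_compute. Qed.

Lemma lw_small0 : all (fun r => z_dvd5 2 (BinInt.Z.sub (nth (zn 0) (lw 0) r)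
   (BinInt.Z.mul (zn 5) (nth (zn 0) lh0 r)))) (iota 0 24).
Proof. by vm_compute. Qed.

(** [den] is 1 modulo 5, so [wser m] and the finite list [lw m] agree modulo 5; the witness is read
    off from the expansion of (1 - 5 v)^6. *)
Lemma wserE : exists g, forall m, wser m = lfps (lw m) + 5 * (g * lfps (lw m)).
Proof.
have [v dE] : exists v, den = 1 - 5 * v.
  by exists (qpow int 1 * den); rewrite -[X in X - _]den_unit; ring.
exists (- 6 * v + 15 * 5 * v ^+ 2 - 20 * 5 ^+ 2 * v ^+ 3 + 15 * 5 ^+ 3 * v ^+ 4
  - 6 * 5 ^+ 4 * v ^+ 5 + 5 ^+ 5 * v ^+ 6) => m.
by rewrite /wser dE; ring.
Qed.

Lemma wser_dvd1 m r : (0 < m <= 5)%N -> dvd5 (1 + th1 r) (wser m r - gam m * h0 r).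
Proof.
move=> /andP[m0 m5]; have [r24|r24] := ltnP r 24; last first.
  rewrite h0_large ?mulr0 ?subr0; last by lia.
  by apply: dvd5_le (slope_wser m r); rewrite /sl /th1; lia.
have -> : th1 r = 0%N by rewrite /th1; lia.
have [g ->] := wserE; rewrite fpsDE fps_natME addrAC; apply: dvd5D; last first.
  by exists ((g * lfps (lw m)) r); rewrite expr1.
have mi : m \in iota 1 5 by rewrite mem_iota m0.
have ri : r \in iota 0 24 by rewrite mem_iota.
have /z_dvd5P := allP (allP lw_small1 m mi) r ri.
set z := int_of_Z _; suff -> : z = lfps (lw m) r - gam m * h0 r by [].
rewrite /z -[BinInt.Z.sub _ _]/((_ : Z) - (_ : Z) * _ : Z) rmorphB rmorphM /=.
congr (_ - _ * _); clear; rewrite /gam.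
by case: m => [|[|[|[|[|m]]]]] //=; rewrite !nth_nil.
Qed.

(** The start of the induction needs W 1 modulo 25. Below degree 24 the list [lw 0] is itself
    divisible by 5, so the correction in [wserE] vanishes modulo 25. *)
Lemma wser_dvd0 r : dvd5 (2 + th1 r) (wser 0 r - 5 * h0 r).
Proof.
have [r24|r24] := ltnP r 24; last first.
  rewrite h0_large ?mulr0 ?subr0; last by lia.
  by apply: dvd5_le (slope_wser 0 r); rewrite /sl /th1; lia.
have -> : th1 r = 0%N by rewrite /th1; lia.
have hl i : (i < 24)%N -> dvd5 2 (lfps (lw 0) i - 5 * h0 i).
  move=> i24; have /allP/(_ i) := lw_small0; rewrite mem_iota => /(_ i24) /z_dvd5P.
  set z := int_of_Z _; suff -> : z = lfps (lw 0) i - 5 * h0 i by [].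
  by rewrite /z -[BinInt.Z.sub _ _]/((_ : Z) - (_ : Z) * _ : Z) rmorphB rmorphM.
have hl1 i : (i < 24)%N -> dvd5 1 (lfps (lw 0) i).
  move=> i24; rewrite -(subrK (5 * h0 i) (lfps _ i)); apply: dvd5D.
    by apply: dvd5_le (hl i i24).
  by exists (h0 i); rewrite expr1.
have [g ->] := wserE; rewrite fpsDE fps_natME addrAC; apply: dvd5D; first exact: hl.
apply: (@dvd5M 1 1); first by exists 1; rewrite expr1 mulr1.
rewrite fpsME; apply: dvd5_sum => i _; apply: dvd5Ml; apply: hl1.
by apply: leq_ltn_trans r24; apply: leq_subr.
Qed.

Lemma wser0 m : wser m 0%N = 0.
Proof.
apply: (@comp_inj0 1) => //; rewrite -W_xq => -[|//] _.
have e : U (p25 * xq ^+ 6 * xq ^+ m) 0%N = 0.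
  by rewrite fdecE muln0 -mulrA -exprD coef0M coef0X xq0 expr0n mulr0.
by rewrite /W coef0M e mulr0.
Qed.

Lemma lat1_W1 : lat1 1 (W 1).
Proof.
exists (wser 0), 1; split; first by rewrite -W_xq expr0.
- exact: wser0.
- by move=> r; rewrite mulr1 expr1; apply: wser_dvd0.
Qed.

(** The powers x to x^5 contribute [gam m] times [h0] up to an extra 5, and these contributions are
    collected in [t]. From x^6 on, [th0] and the slope bound supply the extra factor. *)
Lemma lat0_W k f : lat0 k f -> lat1 k (W f).
Proof.
move=> [c [-> c0 hc]]; pose N r := (6 + 5 * r.+1)%N.
rewrite (@comp_operator W wser c N (@W_continuous) W_xq); last by move=> r; rewrite leq_addl.
have /choice[d hd] : forall m, exists t, c m = 5 ^+ k * t.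
  move=> m; have [t ->] := hc m; exists (5 ^+ th0 m * t); by rewrite mulrA exprD.
pose t := \sum_(1 <= m < 6) d m * gam m.
exists (Fps (fun r => \sum_(m < N r) c m * wser m r)), t; split=> //.
- by rewrite /= big1 // => i _; rewrite [X in _ * X]wser0 mulr0.
move=> r; rewrite -[coefs _ _]/(\sum_(m < N r) c m * wser m r).
rewrite /N big_split_ord /= addrAC; apply: dvd5D; last first.
  apply: dvd5_sum => m _; apply: dvd5_le (dvd5M (hc (6 + m)%N) (slope_wser (6 + m) r)).
  by rewrite /th0 /th1 /sl; lia.
have -> : \sum_(i < 6) c i * wser i r - 5 ^+ k * t * h0 r =
    \sum_(1 <= m < 6) c m * (wser m r - gam m * h0 r).
  rewrite -(big_mkord xpredT (fun i => c i * wser i r)) big_ltn // c0 mul0r add0r.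
  rewrite /t big_distrr big_distrl /= -sumrB; apply: eq_bigr => m _.
  by rewrite hd; ring.
rewrite big_seq; apply: dvd5_sum => m; rewrite mem_index_iota => /andP[m1 m6].
rewrite -addnA; apply: dvd5M; first by rewrite hd; exists (d m).
by apply: wser_dvd1; rewrite m1 -ltnS.
Qed.

End FiveAdicLattices.

(** * The formal recursion for L_alpha *)

Section FormalTheorem.

Local Notation U := (fdec 5).
Local Notation E k := (feuler int k).
Local Notation q := (qpow int 1).

Definition d5f : fps int := E 2 ^+ 5 * finv (E 1 ^+ 16).

Definition progr (k l : nat) (d : fps int) : fps int := Fps (fun n => d (k * n + l)%N).

Definition Lf (alpha : nat) : fps int :=
  if odd alpha then
    E 5 ^+ 16 * finv (E 10 ^+ 5) *
      (qpow int 2 * progr (5 ^ alpha) (lambda_shift alpha) d5f)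
  else
    E 1 ^+ 16 * finv (E 2 ^+ 5) *
      (q * progr (5 ^ alpha) (lambda_shift alpha) d5f).

Lemma EX0 k n : (0 < k)%N -> (E k ^+ n) 0%N = 1.
Proof. by move=> k0; rewrite coef0X E0 // expr1n. Qed.

Lemma expn5_mod4 alpha : exists m, (5 ^ alpha = 4 * m + 1)%N.
Proof.
elim: alpha => [|a [m IH]]; first by exists 0%N.
by exists (5 * m + 1)%N; rewrite expnS IH; lia.
Qed.

Lemma lambda_shiftS alpha :
  (lambda_shift alpha.+1 = 5 ^ alpha * 3 + lambda_shift alpha)%N.
Proof.
by rewrite /lambda_shift expnS; have [m ->] := expn5_mod4 alpha; lia.
Qed.

(** U keeps the indices congruent to 3 modulo 5, and the shift grows by exactly 3 * 5^alpha. The two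
    cases used are (i, n) = (2, 1) and (7, 2). *)
Lemma progr_shift alpha i n : (n * 5 = 3 + i)%N ->
  U (qpow int i * progr (5 ^ alpha) (lambda_shift alpha) d5f) =
  qpow int n * progr (5 ^ alpha.+1) (lambda_shift alpha.+1) d5f.
Proof.
move=> ni; apply/fpsP => r; rewrite fdecE !qpowME.
have [nr|rn] := leqP n r; last by rewrite leqNgt (_ : (5 * r < i)%N) //; lia.
rewrite (_ : (i <= 5 * r)%N = true); last by lia.
rewrite /= lambda_shiftS expnS; congr (d5f _).
have -> : (5 * r - i = 5 * (r - n) + 3)%N by lia.
by rewrite mulnDr; lia.
Qed.

Lemma Lf_odd alpha : odd alpha -> Lf alpha.+1 = U (Lf alpha).
Proof.
move=> oa; rewrite /Lf /= oa /=.
have key (A A5 B C : fps int) : fsub 5 A = A5 -> U B = C -> A * C = U (A5 * B).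
  by move=> <- <-; rewrite fdec_fsubM.
apply: key; last exact: (@progr_shift alpha 2 1).
by rewrite [LHS]rmorphM /= fsub_finv ?EX0 // !rmorphXn /= !fsub_feuler.
Qed.

Lemma p25_eta : p25 * (E 2 * E 25 ^+ 2) = E 1 ^+ 2 * E 50.
Proof.
have h1 := phi_feuler int.
have h25 : phi25 * E 50 = E 25 ^+ 2.
  by have := congr1 (fsub 25) h1; rewrite rmorphM rmorphXn /= !fsub_feuler.
rewrite -h25 -h1 -p25M; ring.
Qed.

Lemma fsub_EX k n : (0 < k)%N -> fsub 5 (E k ^+ n) = E (5 * k) ^+ n.
Proof. by move=> k0; rewrite rmorphXn /= fsub_feuler. Qed.

Lemma Mq_eta : Mq * (E 5 ^+ 4 * E 50 ^+ 2) = E 10 ^+ 2 * E 25 ^+ 4.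
Proof.
have := congr1 (fsub 5) one4x_eta.
rewrite [LHS]rmorphM [X in _ * X]rmorphM [RHS]rmorphM /= Mq_fsub.
by rewrite !fsub_EX.
Qed.

Lemma one5y_eta : (1 + 5 * yq) * (E 5 ^+ 5 * E 50) = E 10 ^+ 5 * E 25.
Proof.
have := congr1 (fsub 5) one5x_eta.
rewrite [LHS]rmorphM [X in _ * X]rmorphM [RHS]rmorphM /= !fsub_EX // !fsub_feuler //.
by rewrite rmorphD rmorphM rmorph1 rmorph_nat.
Qed.

(** The origin of [W]: its factors combine to q^6 E_25^16 E_2^5 / (E_50^5 E_1^16), the change of
    prefactor from even to odd index, or from 1 to L_1. *)
Lemma W_kernel :
  fsub 5 (Mx ^+ 6 * finv (1 + 5 * xq) ^+ 6) * (p25 * xq ^+ 6) * E 1 ^+ 16 =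
  qpow int 6 * fsub 5 (E 5 ^+ 16 * finv (E 10 ^+ 5)) * E 2 ^+ 5.
Proof.
have y0 : (1 + 5 * yq) 0%N = 1 by rewrite fpsDE fps1E coef0M fsub_coef0 xq0 mulr0 addr0.
have i5 : fsub 5 (finv (1 + 5 * xq)) * (1 + 5 * yq) = 1.
  rewrite fsub_finv ?one5x0 // rmorphD rmorphM rmorph1 rmorph_nat /= -/yq.
  by rewrite mulrC finvK.
have i50 : fsub 5 (finv (E 10 ^+ 5)) * E 50 ^+ 5 = 1.
  by rewrite fsub_finv ?EX0 // rmorphXn /= fsub_feuler // mulrC finvK ?EX0.
have e6 (f g : fps int) : fsub 5 (f ^+ 6 * g ^+ 6) = fsub 5 f ^+ 6 * fsub 5 g ^+ 6.
  by rewrite rmorphM !rmorphXn.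
have eM (f g : fps int) : fsub 5 (f * g) = fsub 5 f * fsub 5 g by rewrite rmorphM.
rewrite e6 Mq_fsub (eM (E 5 ^+ 16)) fsub_EX //.
move: i5 i50; move: (fsub 5 (finv (1 + 5 * xq))) (fsub 5 (finv (E 10 ^+ 5))) => i5 i50 h5 h50.
(* Chosen so that each of [xq_eta], [p25_eta], [Mq_eta] and [one5y_eta] finds its left-hand side as
   a factor. *)
pose K := E 1 ^+ 2 * E 5 ^+ 6 * (E 2 * E 25 ^+ 2) * (E 5 ^+ 4 * E 50 ^+ 2) ^+ 6
   * (1 + 5 * yq) ^+ 6 * E 50 ^+ 5.
have K0 : K 0%N = 1.
  have ek k : E k.+1 0%N = 1 by apply: E0.
  have m1 (f g : fps int) : f 0%N = 1 -> g 0%N = 1 -> (f * g) 0%N = 1.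
    by move=> f0 g0; rewrite coef0M f0 g0 mulr1.
  have x1 n (f : fps int) : f 0%N = 1 -> (f ^+ n) 0%N = 1.
    by move=> f0; rewrite coef0X f0 expr1n.
  by rewrite /K; repeat first [exact y0 | apply ek | simple apply x1 | simple apply m1].
apply: (fps_cancel K0).
have hx := xq_eta; have hp := p25_eta; have hM := Mq_eta; have hy := one5y_eta.
transitivity ((i5 * (1 + 5 * yq)) ^+ 6 * E 50 ^+ 5 * (xq * (E 1 ^+ 3 * E 5)) ^+ 6
  * (p25 * (E 2 * E 25 ^+ 2)) * (Mq * (E 5 ^+ 4 * E 50 ^+ 2)) ^+ 6); first by rewrite /K; ring.
rewrite h5 hx hp hM.
transitivity (q ^+ 6 * E 1 ^+ 2 * E 2 ^+ 6 * E 25 ^+ 18 * E 50 ^+ 6 * (E 10 ^+ 5 * E 25) ^+ 6).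
  by ring.
rewrite -hy qpowX mul1n.
transitivity (qpow int 6 * E 1 ^+ 2 * E 2 ^+ 6 * E 25 ^+ 18 * E 5 ^+ 30 * E 50 ^+ 12
  * (1 + 5 * yq) ^+ 6 * (i50 * E 50 ^+ 5)); first by rewrite h50; ring.
by rewrite /K; ring.
Qed.

Lemma W_eq f g : E 2 ^+ 5 * f = E 1 ^+ 16 * g ->
  W f = E 5 ^+ 16 * finv (E 10 ^+ 5) * U (qpow int 6 * g).
Proof.
move=> fg; rewrite /W -!fdec_fsubM //; congr fdec.
have u0 : (E 2 ^+ 5) 0%N = 1 by rewrite EX0.
apply: (fps_cancel u0).
transitivity (fsub 5 (Mx ^+ 6 * finv (1 + 5 * xq) ^+ 6) * (p25 * xq ^+ 6) * (E 2 ^+ 5 * f)).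
  by ring.
rewrite fg.
transitivity (fsub 5 (Mx ^+ 6 * finv (1 + 5 * xq) ^+ 6) * (p25 * xq ^+ 6) * E 1 ^+ 16 * g).
  by ring.
by rewrite W_kernel; ring.
Qed.

Lemma Lf_even alpha : ~~ odd alpha -> Lf alpha.+1 = W (Lf alpha).
Proof.
move=> ea; rewrite /Lf /= ea (negbTE ea).
rewrite (@W_eq _ (q * progr (5 ^ alpha) (lambda_shift alpha) d5f)); last first.
  have inv : E 2 ^+ 5 * finv (E 2 ^+ 5) = 1 by rewrite finvK ?EX0.
  by rewrite -mulrA mulrCA [E 2 ^+ 5 * _]mulrA inv mul1r.
by rewrite [qpow int 6 * _]mulrA -(qpowD int 6 1) (@progr_shift alpha 7 2).
Qed.

Lemma Lf_1 : Lf 1 = W 1.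
Proof.
rewrite /Lf /= (@W_eq 1 d5f); last first.
  by rewrite /d5f mulr1 mulrCA finvK ?EX0 // mulr1.
congr (_ * _); apply/fpsP => r; rewrite fdecE !qpowME.
have [r2|r2] := leqP 2 r; last by rewrite leqNgt (_ : (5 * r < 6)%N) //; lia.
rewrite (_ : (6 <= 5 * r)%N = true); last by lia.
by rewrite /=; congr (d5f _); rewrite /lambda_shift expn1; lia.
Qed.

(** With 5^(alpha+1) = 4 m + 1 the exponent is m for odd and m - 1 for even alpha. The gcd term is
    what makes it follow the rules 5 n of [hx_U] and 5 n + 6 of [hx_W]. *)
Lemma psi_exp_odd alpha : odd alpha -> psi_exp alpha.+1 = (5 * psi_exp alpha)%N.
Proof.
move=> oa; rewrite /psi_exp !addn1 !(expnS _ alpha.+1).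
have [m ->] := expn5_mod4 alpha.+1.
have -> : gcdn alpha 2 = 1%N by apply/eqP; rewrite -[_ == _]/(coprime _ _) coprimen2.
have -> : gcdn alpha.+1 2 = 2%N by apply/gcdn_idPr; rewrite dvdn2 /= oa.
by lia.
Qed.

Lemma psi_exp_even alpha : (0 < alpha)%N -> ~~ odd alpha ->
  psi_exp alpha.+1 = (5 * psi_exp alpha + 6)%N.
Proof.
move=> a0 ea; rewrite /psi_exp !addn1 !(expnS _ alpha.+1).
have [m hm] := expn5_mod4 alpha.+1; rewrite hm.
have -> : gcdn alpha.+1 2 = 1%N.
  by apply/eqP; rewrite -[_ == _]/(coprime _ _) coprimen2 /= ea.
have -> : gcdn alpha 2 = 2%N by apply/gcdn_idPr; rewrite dvdn2.
have : (5 <= 5 ^ alpha.+1)%N by rewrite -{1}(expn1 5) leq_exp2l.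
by rewrite hm; lia.
Qed.

(** Denominator and 5-adic lattice are carried along separately. The exponent of 5 rises only from
    odd to even index, as [beta_exp] does, and psi(1) = 6 comes from [hx_W] with [n = 0]. *)
Lemma Lf_structure alpha : (0 < alpha)%N ->
  (if odd alpha then lat1 (beta_exp alpha) (Lf alpha)
   else lat0 (beta_exp alpha) (Lf alpha)) /\
  exists Q, (1 + 5 * xq) ^+ psi_exp alpha * Lf alpha = hx Q.
Proof.
elim: alpha => // alpha IH _; case: alpha IH => [_|alpha IH].
  rewrite Lf_1; split; first exact: lat1_W1.
  have [|Q hQ] := @hx_W 1 0; last by exists Q.
  by exists 1; rewrite rmorph1 mulr1.
have [hl hQ] := IH isT; move: (alpha.+1) (isT : 0 < alpha.+1)%N hl hQ {IH} => a a0 hl hQ.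
have [oa|ea] := boolP (odd a); move: hl.
  rewrite oa => hl; rewrite Lf_odd // psi_exp_odd //= oa; split; last exact: hx_U.
  have -> : beta_exp a.+1 = (beta_exp a).+1 by rewrite /beta_exp; lia.
  exact: lat1_U.
rewrite (negbTE ea) => hl; rewrite Lf_even // psi_exp_even //= ea; split; last exact: hx_W.
have -> : beta_exp a.+1 = beta_exp a by rewrite /beta_exp; lia.
exact: lat0_W.
Qed.

(** The lowest term of x^n is q^n, so divisibility of the q-coefficients passes to the coefficients
    of [Q] one degree at a time. *)
Lemma hx_dvd5 k Q : (forall n, dvd5 k (hx Q n)) -> exists P, hx Q = 5 ^+ k * hx P.
Proof.
move=> h; pose c : fps int := Fps (fun n => Q`_n).
have cE : comp c = hx Q by apply: eqmP => K; apply: comp_hx.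
have dc n : dvd5 k (c n).
  elim/ltn_ind: n => n IH; have := h n; rewrite -cE (@comp_eqm c n.+1 n.+1) //.
  rewrite big_ord_recr fpsDE fps_intME -[nat_of_ord ord_max]/n xq_lead mulr1 intz => hn.
  set s := (X in X + _) in hn; rewrite -[c n](addrK s); apply: dvd5D.
    by rewrite addrC.
  apply: dvd5N; rewrite /s fps_sumE; apply: dvd5_sum => i _.
  by rewrite fps_intME intz mulrC; apply: dvd5Ml; apply: IH => /=.
have /choice[t ht] : forall n, exists t, Q`_n = 5 ^+ k * t by move=> n; apply: dc.
exists (\poly_(i < size Q) t i).
have {1}-> : Q = (5 ^+ k)%:P * \poly_(i < size Q) t i.
  apply/polyP => i; rewrite coefCM coef_poly; case: ltnP => iQ; first exact: ht.
  by rewrite mulr0 nth_default.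
rewrite rmorphM /=; congr (_ * _).
by rewrite /hx map_polyC hornerC /= rmorphXn rmorph_nat.
Qed.

Lemma formal_theorem alpha : (0 < alpha)%N ->
  exists P, (1 + 5 * xq) ^+ psi_exp alpha * Lf alpha = 5 ^+ beta_exp alpha * hx P.
Proof.
move=> /Lf_structure[hl [Q hQ]]; rewrite hQ; apply: hx_dvd5 => n; rewrite -hQ fpsME.
apply: dvd5_sum => i _; apply: dvd5Ml.
by case: (odd alpha) hl => hl; [apply: lat1_dvd | apply: lat0_dvd].
Qed.

End FormalTheorem.

(** * Evaluation in the unit disc *)

Import numFieldNormedType.Exports.
Local Open Scope classical_set_scope.
Local Open Scope ring_scope.
Local Open Scope complex_scope.

Section AbstractLimits.
Variable K : numFieldType.
Implicit Types (u v : nat -> K) (l m : K).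

(* Limits are handled over an abstract field, as the topology is not inferred on
   [R[i]]; [tendsC] below gives the epsilon form over [R[i]]. *)
Definition tends u l : Prop := u @ \oo --> l.

Lemma tendsP u l : tends u l <->
  forall e : K, 0 < e -> exists N, forall n, (N <= n)%N -> `|l - u n| < e.
Proof.
rewrite /tends; split=> [/cvgrPdist_lt h e e0|h].
  by have [N _ hN] := h e e0; exists N => n Nn; apply: hN.
apply/cvgrPdist_lt => e e0; have [N hN] := h e e0.
by exists N => // n /= Nn; apply: hN.
Qed.

Lemma tends_unique u l m : tends u l -> tends u m -> l = m.
Proof. by move=> hl hm; apply: (cvg_unique _ hl hm). Qed.

Lemma tends_lim u l : tends u l -> lim (u @ \oo) = l.
Proof. by move=> h; apply: cvg_lim. Qed.

Lemma tendsD u v l m : tends u l -> tends v m -> tends (fun n => u n + v n) (l + m).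
Proof. exact: cvgD. Qed.

Lemma tendsM u v l m : tends u l -> tends v m -> tends (fun n => u n * v n) (l * m).
Proof. exact: cvgM. Qed.

Lemma tends_cst l : tends (fun=> l) l.
Proof. exact: cvg_cst. Qed.

Definition psum (f : fps int) (q : K) (N : nat) : K := \sum_(n < N) (f n)%:~R * q ^+ n.

Definition evl (f : fps int) (q : K) : K := lim (psum f q @ \oo).

Lemma has_sum_psum (f : fps int) (q l : K) :
  has_sum (fun n => (f n)%:~R * q ^+ n) l <-> tends (psum f q) l.
Proof. by rewrite /has_sum seriesEord. Qed.

End AbstractLimits.

(** * The complex modulus and limits in epsilon form *)

Section ComplexModulus.
Variable R : realType.
Implicit Types (x y z : R[i]).

Definition modc z : R := complex.Re `|z|.

Lemma modcE z : `|z| = (modc z)%:C.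
Proof. by rewrite /modc normc_def. Qed.

Lemma lecC (a b : R) : (a%:C <= b%:C) = (a <= b).
Proof. by rewrite lecE /= eqxx. Qed.

Lemma ltcC (a b : R) : (a%:C < b%:C) = (a < b).
Proof. by rewrite ltcE /= eqxx. Qed.

Lemma modcM x y : modc (x * y) = modc x * modc y.
Proof. by apply: complexI; rewrite rmorphM /= -!modcE normrM. Qed.

Lemma modc_ge0 x : 0 <= modc x.
Proof. by rewrite -lecC -modcE normr_ge0. Qed.

Lemma modcD x y : modc (x + y) <= modc x + modc y.
Proof. by rewrite -lecC rmorphD /= -!modcE ler_normD. Qed.

Lemma modcN x : modc (- x) = modc x.
Proof. by rewrite /modc normrN. Qed.

Lemma modcX x n : modc (x ^+ n) = modc x ^+ n.
Proof. by apply: complexI; rewrite rmorphXn /= -!modcE normrX. Qed.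

Lemma modc_real (a : R) : modc a%:C = `|a|.
Proof. by rewrite /modc normc_def /= expr0n /= addr0 sqrtr_sqr. Qed.

Lemma modc_int (k : int) : modc k%:~R = `|k%:~R : R|.
Proof. by rewrite -modc_real rmorph_int. Qed.

Lemma modc_sum I (s : seq I) (P : pred I) (F : I -> R[i]) :
  modc (\sum_(i <- s | P i) F i) <= \sum_(i <- s | P i) modc (F i).
Proof.
elim/big_rec2: _ => [|i a x _ xa]; first by rewrite -[0]/(0%:C) modc_real normr0.
by apply: le_trans (modcD _ _) _; rewrite lerD2l.
Qed.

Lemma Re_le_modc x : `|complex.Re x| <= modc x.
Proof.
rewrite /modc normc_def /= -sqrtr_sqr ler_wsqrtr // lerDl; exact: sqr_ge0.
Qed.

Lemma Im_le_modc x : `|complex.Im x| <= modc x.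
Proof.
rewrite /modc normc_def /= -sqrtr_sqr ler_wsqrtr // lerDr; exact: sqr_ge0.
Qed.

Lemma modc_le x : modc x <= `|complex.Re x| + `|complex.Im x|.
Proof.
have := modcD (complex.Re x)%:C ('i%C * (complex.Im x)%:C).
rewrite -complexE modcM !modc_real.
have -> : modc 'i%C = 1.
  by rewrite /modc normc_def /= expr0n /= expr1n add0r sqrtr1.
by rewrite mul1r.
Qed.

Lemma tendsC (u : nat -> R[i]) l : tends u l <->
  forall e : R, 0 < e -> exists N, forall n, (N <= n)%N -> modc (l - u n) < e.
Proof.
rewrite tendsP; split=> h e e0.
  have [|N hN] := h e%:C; first by rewrite -[0]/(0%:C) ltcC.
  by exists N => n /hN; rewrite modcE ltcC.
(* A positive element of [R[i]] is real: the order forces its imaginary part to vanish. *)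
move: e e0 => [e e']; rewrite ltcE /= => /andP[/eqP -> e0].
have [N hN] := h e e0; exists N => n /hN; rewrite modcE.
by rewrite -[e +i* 0]/(e%:C) ltcC.
Qed.

Lemma tends_squeeze (u v : nat -> R[i]) (w : nat -> R) l :
  (forall n, modc (u n - v n) <= w n) ->
  (forall e : R, 0 < e -> exists N, forall n, (N <= n)%N -> w n < e) ->
  tends u l -> tends v l.
Proof.
move=> uv hw /tendsC hu; apply/tendsC => e e0; have e2 : 0 < e / 2 by rewrite divr_gt0.
have [N1 h1] := hw _ e2; have [N2 h2] := hu _ e2.
exists (maxn N1 N2) => n; rewrite geq_max => /andP[n1 n2].
rewrite -(subrK (u n) (l)) -addrA; apply: le_lt_trans (modcD _ _) _.
by rewrite (splitr e) ltrD ?h2 // (le_lt_trans (uv n)) ?h1.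
Qed.

End ComplexModulus.

(** * Absolute convergence and arithmetic in the unit disc *)

Section AbsoluteSums.
Variable R : realType.
Implicit Types (f g : fps int) (r : R) (q : R[i]).

Lemma real_abs_series (u : nat -> R) B : (forall N, \sum_(n < N) `|u n| <= B) ->
  exists l, forall e, 0 < e -> exists N, forall n, (N <= n)%N ->
    `|l - \sum_(k < n) u k| < e.
Proof.
move=> hB; have cv : cvgn (series u).
  apply: normed_cvg; apply: nondecreasing_is_cvgn.
    by apply/nondecreasing_seqP => n; rewrite /= /series /= big_nat_recr //= lerDl.
  by exists B => _ [n _ <-]; rewrite /= /series /= big_mkord.
exists (limn (series u)) => e e0.
have /cvgrPdist_lt/(_ e e0) [N _ hN] := cv.
by exists N => n /hN; rewrite seriesEord.
Qed.

Definition absum f r N : R := \sum_(n < N) `|(f n)%:~R| * r ^+ n.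

(* Absolute convergence in the open unit disc. *)
Definition disc_summable f := forall r, 0 <= r -> r < 1 -> exists B, forall N, absum f r N <= B.

Lemma absum_ge0 f r N : 0 <= r -> 0 <= absum f r N.
Proof. by move=> r0; apply: sumr_ge0 => i _; rewrite mulr_ge0 ?exprn_ge0. Qed.

Lemma modc_term f q n : modc ((f n)%:~R * q ^+ n) = `|(f n)%:~R : R| * modc q ^+ n.
Proof. by rewrite modcM modcX modc_int. Qed.

Lemma complex_series (u : nat -> R[i]) B : (forall N, \sum_(n < N) modc (u n) <= B) ->
  exists l, tends (fun N => \sum_(n < N) u n) l.
Proof.
move=> hB.
have [|a ha] := @real_abs_series (fun n => complex.Re (u n)) B.
  by move=> N; apply: le_trans (hB N); apply: ler_sum => i _; apply: Re_le_modc.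
have [|b hb] := @real_abs_series (fun n => complex.Im (u n)) B.
  by move=> N; apply: le_trans (hB N); apply: ler_sum => i _; apply: Im_le_modc.
exists (a +i* b); apply/tendsC => e e0; have e2 : 0 < e / 2 by rewrite divr_gt0.
have [N1 h1] := ha _ e2; have [N2 h2] := hb _ e2.
exists (maxn N1 N2) => n; rewrite geq_max => /andP[n1 n2].
apply: le_lt_trans (modc_le _) _; rewrite (splitr e); apply: ltrD.
  have -> : complex.Re (a +i* b - \sum_(n0 < n) u n0) = a - \sum_(k < n) complex.Re (u k).
    by rewrite !raddfB /= !raddf_sum.
  exact: h1.
have -> : complex.Im (a +i* b - \sum_(n0 < n) u n0) = b - \sum_(k < n) complex.Im (u k).
  by rewrite !raddfB /= !raddf_sum.
exact: h2.
Qed.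

Lemma disc_tends f q : disc_summable f -> modc q < 1 -> tends (psum f q) (evl f q).
Proof.
move=> tf q1; have [B hB] := tf _ (modc_ge0 q) q1.
have [|l hl] := @complex_series (fun n => (f n)%:~R * q ^+ n) B.
  by move=> N; apply: le_trans (hB N); apply: ler_sum => i _; rewrite modc_term.
by rewrite /evl (tends_lim (hl : tends (psum f q) l)).
Qed.

Lemma discD f g : disc_summable f -> disc_summable g -> disc_summable (f + g).
Proof.
move=> tf tg r r0 r1; have [B hB] := tf r r0 r1; have [C hC] := tg r r0 r1.
exists (B + C) => N; apply: le_trans (lerD (hB N) (hC N)); rewrite -big_split /=.
apply: ler_sum => i _; rewrite -mulrDl ler_wpM2r ?exprn_ge0 //.
by rewrite fpsDE rmorphD ler_normD.
Qed.

Lemma discN f : disc_summable f -> disc_summable (- f).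
Proof.
move=> tf r r0 r1; have [B hB] := tf r r0 r1; exists B => N.
by apply: le_trans (hB N); apply: ler_sum => i _; rewrite fpsNE rmorphN normrN.
Qed.

Lemma disc_bound (f : fps int) (M : nat) : (forall n, (M <= n)%N -> f n = 0) -> disc_summable f.
Proof.
move=> h r r0 r1; exists (absum f r M) => N; have [NM|MN] := leqP N M.
  rewrite -(subnKC NM) /absum big_split_ord /= lerDl.
  by apply: sumr_ge0 => i _; rewrite mulr_ge0 ?exprn_ge0.
rewrite -(subnKC (ltnW MN)) /absum big_split_ord /= [X in _ + X]big1 ?addr0 // => i _.
by rewrite h ?leq_addr // normr0 mul0r.
Qed.

Lemma disc_qpow k : disc_summable (qpow int k).
Proof.
by apply: (@disc_bound _ k.+1) => n kn; rewrite qpowE gtn_eqF.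
Qed.

Lemma disc_int (k : int) : disc_summable k%:~R.
Proof. by apply: (@disc_bound _ 1) => -[|n] // _; rewrite fps_intE. Qed.

Lemma disc1 : disc_summable 1. Proof. exact: (disc_int 1). Qed.

Let pabs f N : {poly R} := \poly_(i < N) `|(f i)%:~R|.

Let pabs_horner f r N : (pabs f N).[r] = absum f r N.
Proof. by rewrite horner_poly. Qed.

Let pabs_ge0 f N i : 0 <= (pabs f N)`_i.
Proof. by rewrite coef_poly; case: ifP. Qed.

Let pabsM_ge0 f g N i : 0 <= (pabs f N * pabs g N)`_i.
Proof. by rewrite coefM; apply: sumr_ge0 => j _; rewrite mulr_ge0 ?pabs_ge0. Qed.

Let pabsM_size f g N : (size (pabs f N * pabs g N)%R <= N + N)%N.
Proof.
apply: leq_trans (size_polyMleq _ _) _; apply: leq_trans (leq_pred _) _.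
by apply: leq_add; apply: size_poly.
Qed.

Let pabsM_horner f g r N :
  absum f r N * absum g r N = \sum_(n < N + N) (pabs f N * pabs g N)`_n * r ^+ n.
Proof. by rewrite -!pabs_horner -hornerM (horner_coef_wide _ (pabsM_size f g N)). Qed.

Let pabsM_coef f g N n : (n < N)%N -> `|((f * g) n)%:~R| <= (pabs f N * pabs g N)`_n.
Proof.
move=> nN; rewrite fpsME rmorph_sum coefM; apply: le_trans (ler_norm_sum _ _ _) _.
apply: ler_sum => i _; rewrite rmorphM normrM !coef_poly.
rewrite (leq_ltn_trans _ nN) ?(leq_ltn_trans (leq_subr _ _) nN) //.
by rewrite -ltnS.
Qed.

Lemma absumM f g r N : 0 <= r -> absum (f * g) r N <= absum f r N * absum g r N.
Proof.
move=> r0; rewrite pabsM_horner big_split_ord /=; apply: ler_wpDr.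
  by apply: sumr_ge0 => i _; rewrite mulr_ge0 ?exprn_ge0.
by apply: ler_sum => i _; rewrite ler_wpM2r ?exprn_ge0 // pabsM_coef.
Qed.

Lemma discM f g : disc_summable f -> disc_summable g -> disc_summable (f * g).
Proof.
move=> tf tg r r0 r1; have [B hB] := tf r r0 r1; have [C hC] := tg r r0 r1.
exists (B * C) => N; apply: le_trans (absumM _ _ _ r0) _.
by apply: ler_pM; rewrite ?absum_ge0.
Qed.

Lemma discX f n : disc_summable f -> disc_summable (f ^+ n).
Proof. by move=> tf; elim: n => [|n IH]; [exact: disc1 | rewrite exprS; apply: discM]. Qed.

(** The product of two partial sums differs from the partial sum of the product only in degrees from
    [N] on, where |q|^n is at most (|q| / r)^N r^n. *)
Lemma psumM f g q r N : modc q <= r -> 0 < r ->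
  modc (psum f q N * psum g q N - psum (f * g) q N) <=
  (modc q / r) ^+ N * (absum f r N * absum g r N).
Proof.
move=> qr r0; pose pc (h : fps int) : {poly R[i]} := \poly_(i < N) (h i)%:~R.
have hc h : (pc h).[q] = psum h q N by rewrite horner_poly.
have sz : (size (pc f * pc g)%R <= N + N)%N.
  apply: leq_trans (size_polyMleq _ _) _; apply: leq_trans (leq_pred _) _.
  by apply: leq_add; apply: size_poly.
rewrite -2!hc -hornerM (horner_coef_wide _ sz) big_split_ord /=.
have -> : \sum_(i < N) (pc f * pc g)`_i * q ^+ i = psum (f * g) q N.
  apply: eq_bigr => i _; congr (_ * _); rewrite fpsME rmorph_sum coefM.
  apply: eq_bigr => j _; rewrite rmorphM !coef_poly.
  rewrite (leq_ltn_trans _ (ltn_ord i)) ?(leq_ltn_trans (leq_subr _ _) (ltn_ord i)) //.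
  by rewrite -ltnS.
rewrite [X in X - _]addrC addrK.
apply: le_trans (modc_sum _ _ _) _.
rewrite pabsM_horner big_split_ord mulrDr /=; apply: ler_wpDl.
  rewrite mulr_ge0 ?exprn_ge0 ?divr_ge0 ?modc_ge0 ?(ltW r0) //.
  by apply: sumr_ge0 => i _; rewrite mulr_ge0 ?exprn_ge0 // ltW.
rewrite big_distrr /=; apply: ler_sum => i _; rewrite modcM modcX.
have hcoef : modc (pc f * pc g)`_(N + i) <= (pabs f N * pabs g N)`_(N + i).
  rewrite !coefM; apply: le_trans (modc_sum _ _ _) _; apply: ler_sum => j _.
  rewrite modcM !coef_poly; apply: ler_pM; rewrite ?modc_ge0 //;
    by case: ifP => _; rewrite ?modc_int // -[0]/(0%:C) modc_real normr0.
rewrite mulrCA; apply: ler_pM => //; rewrite ?modc_ge0 ?exprn_ge0 ?modc_ge0 //.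
rewrite !exprD mulrA -exprMn divfK ?gt_eqF // ler_wpM2l ?exprn_ge0 ?modc_ge0 //.
by rewrite lerXn2r ?nnegrE ?modc_ge0 // ltW.
Qed.

Lemma geometric_small (s C e : R) : 0 <= s -> s < 1 -> 0 <= C -> 0 < e ->
  exists N, forall n, (N <= n)%N -> s ^+ n * C < e.
Proof.
move=> s0 s1 C0 e0; have c1 : 0 < C + 1 by rewrite ltr_wpDl.
have sa : `|s| < 1 by rewrite ger0_norm.
have /cvgrPdist_lt/(_ (e / (C + 1)) (divr_gt0 e0 c1)) [N _ hN] := cvg_expr sa.
exists N => n /hN; rewrite sub0r normrN ger0_norm ?exprn_ge0 // ltr_pdivlMr // => h.
by apply: le_lt_trans h; rewrite ler_wpM2l ?exprn_ge0 // lerDl.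
Qed.

Lemma evl_tends_eq f q l : tends (psum f q) l -> evl f q = l.
Proof. exact: tends_lim. Qed.

Lemma evlD f g q : disc_summable f -> disc_summable g -> modc q < 1 -> evl (f + g) q = evl f q +
  evl g q.
Proof.
move=> tf tg q1; apply: evl_tends_eq.
have := tendsD (disc_tends tf q1) (disc_tends tg q1); congr tends; apply: funext => N.
by rewrite /psum -big_split; apply: eq_bigr => i _; rewrite [RHS]/= rmorphD mulrDl.
Qed.

Lemma evlN f q : disc_summable f -> modc q < 1 -> evl (- f) q = - evl f q.
Proof.
move=> tf q1; apply: evl_tends_eq.
have := tendsM (@tends_cst R[i] (-1)) (disc_tends tf q1); rewrite mulN1r; congr tends.
apply: funext => N; rewrite /psum mulN1r -sumrN; apply: eq_bigr => i _.
by rewrite -mulNr rmorphN.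
Qed.

Lemma evl_const f q M : (forall n, (M <= n)%N -> f n = 0) -> evl f q = psum f q M.
Proof.
move=> h; apply: evl_tends_eq; apply/tendsC => e e0; exists M => n Mn.
rewrite -(subnKC Mn) /psum big_split_ord /= [X in _ - (_ + X)]big1 ?addr0 => [|i _].
  by rewrite subrr -[0]/(0%:C) modc_real normr0.
by rewrite h ?leq_addr // mulr0z mul0r.
Qed.

Lemma evl_qpow k q : evl (qpow int k) q = q ^+ k.
Proof.
rewrite (@evl_const _ _ k.+1) => [|n kn]; last by rewrite qpowE gtn_eqF.
rewrite /psum big_ord_recr /= big1 ?add0r => [|i _]; first by rewrite eqxx mul1r.
by rewrite ltn_eqF // mul0r.
Qed.

Lemma evl_int (k : int) q : evl k%:~R q = k%:~R.
Proof.
rewrite (@evl_const _ _ 1) => [|[|n] //= _]; last by rewrite fps_intE.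
by rewrite /psum big_ord1 fps_intE mulr1 intz.
Qed.

Lemma evl1 q : evl 1 q = 1. Proof. exact: (evl_int 1). Qed.

Lemma evlM f g q : disc_summable f -> disc_summable g -> modc q < 1 -> evl (f * g) q = evl f q *
  evl g q.
Proof.
move=> tf tg q1; apply: evl_tends_eq; have q0 := modc_ge0 q.
have [r [r0 qr r1]] : exists r : R, [/\ 0 < r, modc q < r & r < 1].
  by exists ((modc q + 1) / 2); split; lra.
have [B hB] := tf r (ltW r0) r1; have [C hC] := tg r (ltW r0) r1.
have B0 : 0 <= B := le_trans (absum_ge0 f 0 (ltW r0)) (hB 0%N).
have C0 : 0 <= C := le_trans (absum_ge0 g 0 (ltW r0)) (hC 0%N).
apply: (tends_squeeze (w := fun N => (modc q / r) ^+ N * (B * C))) _ _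
  (tendsM (disc_tends tf q1) (disc_tends tg q1)) => [N|e e0].
  apply: le_trans (psumM _ _ _ (ltW qr) r0) _.
  apply: ler_wpM2l; first by rewrite exprn_ge0 ?divr_ge0 ?(ltW r0).
  by apply: ler_pM => //; apply: absum_ge0; apply: ltW.
apply: geometric_small; rewrite ?mulr_ge0 ?invr_ge0 ?(ltW r0) //.
by rewrite ltr_pdivrMr // mul1r.
Qed.

Lemma evlX f n q : disc_summable f -> modc q < 1 -> evl (f ^+ n) q = evl f q ^+ n.
Proof.
move=> tf q1; elim: n => [|n IH]; first exact: evl1.
by rewrite !exprS evlM // ?IH //; apply: discX.
Qed.

Lemma disc_horner (P : {poly int}) f : disc_summable f -> disc_summable (map_poly intr P).[f].
Proof.
move=> tf; elim/poly_ind: P => [|P c IH]; first by rewrite rmorph0 horner0; apply: (disc_int 0).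
rewrite rmorphD rmorphM /= map_polyX map_polyC /= hornerD hornerM hornerX hornerC.
by apply: discD; [apply: discM | apply: disc_int].
Qed.

Lemma evl_horner (P : {poly int}) f q : disc_summable f -> modc q < 1 ->
  evl (map_poly intr P).[f] q = (map_poly intr P).[evl f q].
Proof.
move=> tf q1; elim/poly_ind: P => [|P c IH].
  by rewrite !rmorph0 !horner0; apply: (evl_int 0).
have tP := disc_horner P tf.
rewrite !rmorphD !rmorphM /= !map_polyX !map_polyC /= !(hornerD, hornerM, hornerX, hornerC).
rewrite evlD ?evlM ?IH ?evl_int //; [exact: discM | exact: disc_int].
Qed.

End AbsoluteSums.

Lemma eqm_finv (A : comNzRingType) K (f g : fps A) : eqm K f g -> eqm K (finv f) (finv g).
Proof.
move=> fg n nK; apply: (@eqm_sum A K _ _ _ _ _ _ n nK) => i _.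
by apply: eqmX; apply: eqmD => //; apply: eqmN.
Qed.

(** * Convergence of the Euler product and of its inverse *)

Section DiscClosure.
Variable R : realType.
Implicit Types (f g : fps int) (r s : R) (q : R[i]).

Lemma geometric_le r N : 0 <= r -> r < 1 -> \sum_(i < N) r ^+ i <= (1 - r)^-1.
Proof.
move=> r0 r1; rewrite -[leRHS]mul1r ler_pdivlMr ?subr_gt0 // mulrC.
by rewrite -opprB mulNr -subrX1 opprB lerBlDr lerDl exprn_ge0.
Qed.

Lemma between1 r : 0 <= r -> r < 1 -> exists s, [/\ 0 < s, r < s & s < 1].
Proof. by move=> r0 r1; exists ((r + 1) / 2); split; lra. Qed.

(** Bounded terms at a radius s > r leave a geometric series of ratio r / s at the radius r. *)
Lemma disc_of_terms f :
  (forall r, 0 < r -> r < 1 -> exists B, forall n, `|(f n)%:~R| * r ^+ n <= B) ->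
  disc_summable R f.
Proof.
move=> h r r0 r1; have [s [s0 rs s1]] := between1 r0 r1.
have [B hB] := h s s0 s1; exists (B * (1 - r / s)^-1) => N.
have B0 : 0 <= B by apply: le_trans (hB 0%N); rewrite mulr_ge0 ?exprn_ge0 // ltW.
have t0 : 0 <= r / s by rewrite divr_ge0 // ltW.
have t1 : r / s < 1 by rewrite ltr_pdivrMr // mul1r.
apply: le_trans (ler_wpM2l B0 (geometric_le N t0 t1)); rewrite big_distrr /=.
apply: ler_sum => i _; apply: le_trans (ler_wpM2r (exprn_ge0 i t0) (hB i)).
by rewrite -mulrA -exprMn mulrCA divff ?gt_eqF // mulr1.
Qed.

Lemma disc_terms f r : disc_summable R f -> 0 <= r -> r < 1 ->
  exists B, forall n, `|(f n)%:~R| * r ^+ n <= B.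
Proof.
move=> tf r0 r1; have [B hB] := tf r r0 r1; exists B => n.
by apply: le_trans (hB n.+1); rewrite /absum big_ord_recr /= lerDr absum_ge0.
Qed.

Lemma exprn_in01 r k : 0 <= r -> r < 1 -> (0 < k)%N -> r ^+ k < 1.
Proof. by move=> r0 r1 k0; rewrite exprn_ilt1 // -lt0n. Qed.

Lemma disc_fsub k f : (0 < k)%N -> disc_summable R f -> disc_summable R (fsub k f).
Proof.
move=> k0 tf; apply: disc_of_terms => r r0 r1.
have [B hB] := disc_terms tf (exprn_ge0 k (ltW r0)) (exprn_in01 (ltW r0) r1 k0).
exists B => n; rewrite fsubE; case: ifP => kn; last first.
  by rewrite mulr0z normr0 mul0r; apply: le_trans (hB 0%N); rewrite mulr_ge0 ?exprn_ge0 // ltW.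
by rewrite -{2}(divnK kn) mulnC exprM.
Qed.

Lemma bernoulli_le (u : R) k : 0 <= u -> u <= 1 -> 1 - k%:R * u <= (1 - u) ^+ k.
Proof.
move=> u0 u1; elim: k => [|k IH]; first by rewrite mul0r subr0.
have /ler_wpM2l/(_ _ _ IH) h : 0 <= 1 - u by lra.
rewrite exprS; apply: le_trans h; rewrite -natr1.
have := mulr_ge0 (ler0n R k) (sqr_ge0 u); rewrite expr2; nra.
Qed.

Lemma disc_progr k l f : (0 < k)%N -> disc_summable R f -> disc_summable R (progr k l f).
Proof.
move=> k0 tf; apply: disc_of_terms => r r0 r1.
have kR : 0 < k%:R :> R by rewrite ltr0n.
have k1 : 1 <= k%:R :> R by rewrite ler1n.
(* Instead of a k-th root of r: Bernoulli's inequality gives r <= s^k for s = 1 - u < 1. *)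
pose u := (1 - r) / k%:R.
have ku : k%:R * u = 1 - r by rewrite mulrC divfK ?gt_eqF.
have u0 : 0 < u by rewrite divr_gt0 // subr_gt0.
have u1 : u < 1 by rewrite /u ltr_pdivrMr //; lra.
have := bernoulli_le k (ltW u0) (ltW u1); rewrite ku subKr.
have s0 : 0 < 1 - u by rewrite subr_gt0.
have s1 : 1 - u < 1 by rewrite ltrBlDr ltrDl.
move: (1 - u) s0 s1 => s s0 s1 rs.
have [B hB] := disc_terms tf (ltW s0) s1; exists (B / s ^+ l) => n.
rewrite ler_pdivlMr ?exprn_gt0 //; apply: le_trans (hB (k * n + l)%N).
rewrite -mulrA exprD exprM; apply: ler_wpM2l => //; apply: ler_wpM2r.
  by rewrite exprn_ge0 // ltW.
by rewrite lerXn2r ?nnegrE ?exprn_ge0 // ltW.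
Qed.

Lemma psum_fsub k f q N : (0 < k)%N -> psum (fsub k f) q (k * N) = psum f (q ^+ k) N.
Proof.
move=> k0; elim: N => [|N IH]; first by rewrite muln0 /psum !big_ord0.
rewrite mulnS addnC /psum big_split_ord [RHS]big_ord_recr; congr (_ + _); first exact: IH.
case: k k0 IH => // k _ _; rewrite big_ord_recl /= addn0 big1 ?addr0 => [|i _].
  by rewrite dvdn_mulr // mulKn // exprM.
rewrite dvdn_addr ?dvdn_mulr // gtnNdvd ?mulr0z ?mul0r //.
by rewrite /bump /= add1n ltnS.
Qed.

Lemma evl_fsub k f q : (0 < k)%N -> disc_summable R f -> modc q < 1 ->
  evl (fsub k f) q = evl f (q ^+ k).
Proof.
move=> k0 tf q1; have := disc_tends (disc_fsub k0 tf) q1 => /tendsC h.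
have qk : modc (q ^+ k) < 1 by rewrite modcX exprn_in01 // modc_ge0.
apply: tends_unique (disc_tends tf qk); apply/tendsC => e /h [N hN].
exists N => n nN; rewrite -psum_fsub //; apply: hN.
by apply: leq_trans nN _; apply: leq_pmull.
Qed.

Lemma absum_qpowM j g r N : 0 <= r -> absum (qpow int j * g) r N <= r ^+ j * absum g r N.
Proof.
move=> r0; apply: le_trans (absumM _ _ _ r0) _; apply: ler_wpM2r; first exact: absum_ge0.
have [Nj|jN] := leqP N j.
  rewrite /absum big1 ?exprn_ge0 // => i _.
  by rewrite qpowE ltn_eqF ?normr0 ?mul0r // (leq_trans _ Nj).
rewrite /absum (bigD1 (Ordinal jN)) //= eqxx normr1 mul1r big1 ?addr0 // => i.
by rewrite -val_eqE /= => /negbTE ->; rewrite normr0 mul0r.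
Qed.

Lemma absumD f g r N : 0 <= r -> absum (f + g) r N <= absum f r N + absum g r N.
Proof.
move=> r0; rewrite -big_split /=; apply: ler_sum => i _; rewrite -mulrDl.
by rewrite ler_wpM2r ?exprn_ge0 // rmorphD ler_normD.
Qed.

Lemma absumN f r N : absum (- f) r N = absum f r N.
Proof. by apply: eq_bigr => i _; rewrite fpsNE rmorphN normrN. Qed.

Lemma absum_eqm f g r N : eqm N f g -> absum f r N = absum g r N.
Proof. by move=> h; apply: eq_bigr => i _; rewrite h. Qed.

Lemma absum1 r N : absum 1 r N <= 1.
Proof.
case: N => [|N]; first by rewrite /absum big_ord0.
by rewrite /absum big_ord_recl /= normr1 mul1r big1 ?addr0 // => i _; rewrite normr0 mul0r.
Qed.

(* Each step costs a factor [1 / (1 - r ^ (m + 1))], at most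
   [exp (r ^ m / (1 - r))], whether one multiplies or divides by [1 - q ^ (m + 1)]. *)
Lemma absum_growth r (u : nat -> fps int) : 0 <= r -> r < 1 -> u 0%N = 1 ->
  (forall m N, (1 - r ^+ m.+1) * absum (u m.+1) r N <= absum (u m) r N) ->
  forall m N, absum (u m) r N <= expR ((1 - r)^-1 ^+ 2).
Proof.
move=> r0 r1 u0 step m N; have d0 : 0 < 1 - r by rewrite subr_gt0.
suff h : absum (u m) r N <= expR ((1 - r)^-1 * \sum_(i < m) r ^+ i).
  apply: le_trans h _; rewrite ler_expR expr2 ler_wpM2l ?invr_ge0 ?(ltW d0) //.
  exact: geometric_le.
elim: m => [|m IH]; first by rewrite u0 big_ord0 mulr0 expR0 absum1.
have xr : r ^+ m.+1 <= r by rewrite exprS ler_piMr // exprn_ile1 // ltW.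
have x0 : 0 < 1 - r ^+ m.+1 by lra.
rewrite big_ord_recr /= mulrDr expRD.
have key : 1 <= (1 - r ^+ m.+1) * expR ((1 - r)^-1 * r ^+ m).
  rewrite mulrC -ler_pdivrMr // mul1r; apply: le_trans (expR_ge1Dx _).
  have xm : r ^+ m.+1 <= r ^+ m by rewrite exprS ler_piMl ?exprn_ge0 // ltW.
  have -> : (1 - r ^+ m.+1)^-1 = 1 + r ^+ m.+1 / (1 - r ^+ m.+1) by field; lra.
  rewrite lerD2l mulrC; apply: ler_pM; rewrite ?exprn_ge0 ?invr_ge0 ?(ltW x0) //.
  by rewrite lef_pV2 ?posrE //; lra.
rewrite -(ler_pM2l x0); apply: le_trans (step m N) _; apply: le_trans IH _.
by rewrite mulrCA ler_peMr // expR_ge0.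
Qed.

Let h m : fps int := \prod_(i < m) (1 - qpow int (1 * i.+1)).

Let hS m : h m.+1 = h m * (1 - qpow int m.+1).
Proof. by rewrite /h big_ord_recr /= mul1n. Qed.

Let h0 m : h m 0%N = 1.
Proof.
elim: m => [|m IH]; first by rewrite /h big_ord0.
by rewrite hS coef0M IH mul1r.
Qed.

Let finv_hS m : finv (h m.+1) * (1 - qpow int m.+1) = finv (h m).
Proof.
by apply: (fps_cancel (h0 m)); rewrite finvK // mulrCA -hS mulrC finvK.
Qed.

Let h_growth r : 0 <= r -> r < 1 ->
  forall m N, absum (h m) r N <= expR ((1 - r)^-1 ^+ 2).
Proof.
move=> r0 r1; apply: absum_growth => //; first by rewrite /h big_ord0.
move=> m N; have xr : r ^+ m.+1 <= 1 by rewrite exprn_ile1 // ltW.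
rewrite hS mulrBr mulr1 [h m * _]mulrC.
have cab := absumD (h m) (- (qpow int m.+1 * h m)) N r0.
have ba := absum_qpowM m.+1 (h m) N r0; rewrite absumN in cab.
have x0 : 0 <= r ^+ m.+1 by rewrite exprn_ge0.
have a0 := absum_ge0 (h m) N r0.
move: (r ^+ m.+1) (absum (h m) r N) (absum (_ * _) r N) (absum (_ - _) r N) x0 xr a0 ba cab.
move=> x a b c x0 x1 a0 ba cab.
have : (1 - x) * c <= (1 - x) * (a + x * a) by apply: ler_wpM2l; lra.
have := mulr_ge0 a0 (sqr_ge0 x); rewrite expr2; nra.
Qed.

(** From 1 / h_m = (1 - q^(m+1)) / h_(m+1), rewritten as 1 / h_(m+1) = 1 / h_m + q^(m+1) / h_(m+1);
    the last term is moved to the left-hand side. *)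
Let finv_h_growth r : 0 <= r -> r < 1 ->
  forall m N, absum (finv (h m)) r N <= expR ((1 - r)^-1 ^+ 2).
Proof.
move=> r0 r1; apply: absum_growth => //.
  by have := finvK (h0 0); rewrite /h big_ord0 mul1r.
move=> m N; rewrite mulrBl mul1r lerBlDr; apply: le_trans (lerD (lexx _) (absum_qpowM _ _ _ r0)).
have {1}-> : finv (h m.+1) = finv (h m) + qpow int m.+1 * finv (h m.+1).
  by rewrite -(finv_hS m) mulrBr mulr1 [qpow _ _ * _]mulrC subrK.
exact: absumD.
Qed.

Let feuler_h N : eqm N (feuler int 1) (h N).
Proof. exact: feuler_eqm. Qed.

Lemma disc_feuler1 : disc_summable R (feuler int 1).
Proof.
move=> r r0 r1; exists (expR ((1 - r)^-1 ^+ 2)) => N.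
by rewrite (@absum_eqm _ _ r N (@feuler_h N)) h_growth.
Qed.

Lemma disc_finv_feuler1 : disc_summable R (finv (feuler int 1)).
Proof.
move=> r r0 r1; exists (expR ((1 - r)^-1 ^+ 2)) => N.
by rewrite (@absum_eqm _ _ r N (eqm_finv (@feuler_h N))) finv_h_growth.
Qed.

Lemma psum_tail g q r N M : modc q <= r -> 0 < r ->
  modc (psum g q (N + M) - psum g q N) <= (modc q / r) ^+ N * absum g r (N + M).
Proof.
move=> qr r0; rewrite /psum big_split_ord /= [X in X - _]addrC addrK.
apply: le_trans (modc_sum _ _ _) _; rewrite /absum big_split_ord mulrDr /=.
apply: ler_wpDl.
  by rewrite mulr_ge0 ?absum_ge0 ?exprn_ge0 ?divr_ge0 ?modc_ge0 ?(ltW r0).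
rewrite big_distrr /=; apply: ler_sum => i _; rewrite modc_term mulrCA ler_wpM2l //.
rewrite !exprD mulrA -exprMn divfK ?gt_eqF // ler_wpM2l ?exprn_ge0 ?modc_ge0 //.
by rewrite lerXn2r ?nnegrE ?modc_ge0 // ltW.
Qed.

Let disc_h m : disc_summable R (h m).
Proof. by move=> r r0 r1; eexists => N; apply: h_growth. Qed.

Let evl_h m q : modc q < 1 -> evl (h m) q = \prod_(i < m) (1 - q ^+ i.+1).
Proof.
move=> q1; elim: m => [|m IH]; first by rewrite /h !big_ord0 evl1.
have tq : disc_summable R (- qpow int m.+1) by apply/discN/disc_qpow.
rewrite hS big_ord_recr /= -IH evlM //; last by apply: discD => //; apply: disc1.
by rewrite evlD ?evlN ?evl1 ?evl_qpow //; [exact: disc_qpow | exact: disc1].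
Qed.

(** The partial product [h N] and the Euler product agree below degree [N], and the tail of [h N] is
    small because [h_growth] bounds it uniformly in [N]. *)
Lemma feuler1_product q : modc q < 1 ->
  tends (fun N => \prod_(i < N) (1 - q ^+ i.+1)) (evl (feuler int 1) q).
Proof.
move=> q1; have [r [r0 qr r1]] := between1 (modc_ge0 q) q1.
apply: (tends_squeeze (w := fun N => (modc q / r) ^+ N * expR ((1 - r)^-1 ^+ 2))) _ _
  (disc_tends disc_feuler1 q1); last first.
  move=> e e0; apply: geometric_small; rewrite ?expR_ge0 ?divr_ge0 ?modc_ge0 ?(ltW r0) //.
  by rewrite ltr_pdivrMr // mul1r.
move=> N /=; rewrite -evl_h //.
have -> : psum (feuler int 1) q N = psum (h N) q N.
  by apply: eq_bigr => i _; rewrite (@feuler_h N).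
apply/ler_addgt0Pr => e e0; have /tendsC/(_ e e0)[M hM] := disc_tends (disc_h N) q1.
have hMN := hM (N + M)%N (leq_addl _ _).
rewrite -modcN opprB -(subrK (psum (h N) q (N + M)) (evl _ _)) -addrA.
apply: le_trans (modcD _ _) _; rewrite [leRHS]addrC. apply: lerD; first exact: ltW.
apply: le_trans (psum_tail _ _ _ (ltW qr) r0) _.
by rewrite ler_wpM2l ?h_growth ?exprn_ge0 ?divr_ge0 ?modc_ge0 // ltW.
Qed.

End DiscClosure.

(** * Evaluation at the nome and uniqueness of d_5 *)

Section Evaluation.
Variable R : realType.
Implicit Types (f g : fps int) (q : R[i]).

Local Notation E k := (feuler int k).

Lemma fsub_feuler1 k : (0 < k)%N -> fsub k (E 1) = E k.
Proof. by case: k => // k _; have := @fsub_feuler int k 1 isT; rewrite muln1. Qed.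

Lemma disc_feuler k : (0 < k)%N -> disc_summable R (E k).
Proof.
move=> k0; have := disc_fsub k0 (disc_feuler1 (R := R)).
by move: (fsub_feuler1 k0) => ->.
Qed.

Lemma disc_finv_feuler k : (0 < k)%N -> disc_summable R (finv (E k)).
Proof.
move=> k0; have := disc_fsub k0 (disc_finv_feuler1 (R := R)).
have := fsub_feuler1 k0; have := @feuler0 int 1 isT; move: (E 1) => g g0 <-.
by case: k k0 => // k _; rewrite fsub_finv.
Qed.

Lemma finvM (A : comNzRingType) (f g : fps A) : f 0%N = 1 -> g 0%N = 1 ->
  finv (f * g) = finv f * finv g.
Proof.
move=> f0 g0; have fg0 : (f * g) 0%N = 1 by rewrite coef0M f0 g0 mulr1.
by apply: (fps_cancel fg0); rewrite finvK // mulrACA !finvK // mulr1.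
Qed.

Lemma disc_finvM f g : f 0%N = 1 -> g 0%N = 1 -> disc_summable R (finv f) -> disc_summable R (finv g) ->
  disc_summable R (finv (f * g)).
Proof. by move=> f0 g0 hf hg; rewrite finvM //; apply: discM. Qed.

Lemma disc_finv_feulerX k n : (0 < k)%N -> disc_summable R (finv (E k ^+ n)).
Proof.
move=> k0; elim: n => [|n IH].
  by rewrite expr0 -[finv 1]mul1r finvK //; apply: disc1.
by rewrite exprS; apply: disc_finvM; rewrite ?EX0 ?feuler0 //; apply: disc_finv_feuler.
Qed.

Lemma evl_finv f q : f 0%N = 1 -> disc_summable R f -> disc_summable R (finv f) -> modc q < 1 ->
  evl (finv f) q = (evl f q)^-1.
Proof.
move=> f0 df df' q1; have h : evl f q * evl (finv f) q = 1.
  by rewrite -evlM // finvK // evl1.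
have nz : evl f q != 0 by apply/eqP => z; move: h; rewrite z mul0r => /eqP; rewrite eq_sym oner_eq0.
by apply: (mulfI nz); rewrite h divff.
Qed.

Lemma evl_feuler k q : (0 < k)%N -> modc q < 1 -> evl (E k) q = euler k q.
Proof.
move=> k0 q1; have qk : modc (q ^+ k) < 1 by rewrite modcX exprn_in01 // modc_ge0.
have -> : evl (E k) q = evl (E 1) (q ^+ k).
  have := evl_fsub k0 (disc_feuler1 (R := R)) q1.
  by move: (fsub_feuler1 k0) => ->.
rewrite /euler /qpoch; symmetry; apply: tends_lim.
have := feuler1_product qk; congr tends; apply: funext => N.
by rewrite big_mkord; apply: eq_bigr => i _; rewrite exprS.
Qed.

Lemma evl_feulerX k n q : (0 < k)%N -> modc q < 1 -> evl (E k ^+ n) q = euler k q ^+ n.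
Proof. by move=> k0 q1; rewrite evlX ?evl_feuler //; apply: disc_feuler. Qed.

Lemma evl_quotient f j n q : (0 < j)%N -> disc_summable R f -> modc q < 1 ->
  evl (f * finv (E j ^+ n)) q = evl f q / euler j q ^+ n.
Proof.
move=> j0 df q1; have dX := disc_finv_feulerX n j0.
rewrite evlM // evl_finv ?evl_feulerX ?EX0 //.
by apply/discX/disc_feuler.
Qed.

Lemma evl_d5f q : modc q < 1 -> evl d5f q = euler 2 q ^+ 5 / euler 1 q ^+ 16.
Proof.
move=> q1; rewrite evl_quotient ?evl_feulerX //.
by apply/discX/disc_feuler.
Qed.

Lemma disc_d5f : disc_summable R d5f.
Proof. by apply: discM; [apply/discX/disc_feuler | apply: disc_finv_feulerX]. Qed.

(** Convergence at y bounds the terms there, as differences of partial sums; bounds at every radius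
    give absolute convergence. *)
Lemma tends_zero_disc f : (forall y : R, 0 < y -> y < 1 -> tends (psum f y%:C) 0) ->
  disc_summable R f.
Proof.
move=> h; apply: disc_of_terms => y y0 y1.
have /tendsC/(_ 1 ltr01)[N hN] := h y y0 y1.
have hN' n : (N <= n)%N -> modc (psum f y%:C n) < 1 by move/hN; rewrite sub0r modcN.
have ty n : 0 <= `|(f n)%:~R| * y ^+ n by rewrite mulr_ge0 ?exprn_ge0 // ltW.
exists (absum f y N + 2) => n; have [nN|Nn] := ltnP n N.
  rewrite /absum (bigD1 (Ordinal nN)) //= -addrA lerDl addr_ge0 ?ler0n //.
  by apply: sumr_ge0 => i _; apply: ty.
apply: ler_wpDl; first by apply: absum_ge0; apply: ltW.
have -> : `|(f n)%:~R| * y ^+ n = modc (psum f y%:C n.+1 - psum f y%:C n).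
  rewrite /psum big_ord_recr /= [X in X - _]addrC addrK modc_term modc_real.
  by rewrite (gtr0_norm y0).
apply: le_trans (modcD _ _) _; rewrite modcN.
have := hN' _ Nn; have := hN' _ (leqW Nn); lra.
Qed.

(* Near 0 the tail of the series is smaller than 1, hence so is the integer [g 0]. *)
Lemma disc_tends0_coef0 g : disc_summable R g ->
  (forall y : R, 0 < y -> y < 1 -> tends (psum g y%:C) 0) -> g 0%N = 0.
Proof.
move=> dg h; have half0 : 0 < 2^-1 :> R by rewrite invr_gt0.
have half1 : 2^-1 < 1 :> R by lra.
have [B hB] := dg _ (ltW half0) half1.
have B0 : 0 <= B := le_trans (absum_ge0 g 0 (ltW half0)) (hB 0%N).
have b0 : 0 < 8 * (B + 1) by lra.
pose y := (8 * (B + 1))^-1; have y0 : 0 < y by rewrite invr_gt0.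
have yB : y * (8 * (B + 1)) = 1 by rewrite mulVf ?gt_eqF.
have y2 : y <= 2^-1 by rewrite lef_pV2 ?posrE //; lra.
have /tendsC/(_ _ half0)[N hN] := h y y0 (le_lt_trans y2 half1).
have my : modc y%:C = y by rewrite modc_real gtr0_norm.
have yh : modc y%:C <= 2^-1 by rewrite my.
have tl := @psum_tail R g y%:C 2^-1 1 N yh half0.
have hN1 := hN (1 + N)%N (leq_addl _ _); rewrite sub0r modcN in hN1.
have h1 : modc (psum g y%:C 1) < 1.
  rewrite -(subrK (psum g y%:C (1 + N)) (psum g y%:C 1)).
  apply: le_lt_trans (modcD _ _) _; rewrite -modcN opprB.
  rewrite my expr1 invrK in tl.
  have : y * 2 * absum g 2^-1 (1 + N) <= y * 2 * B.
    by apply: ler_wpM2l; rewrite ?mulr_ge0 // ltW.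
  by move: tl hN1; nra.
move: h1; rewrite /psum big_ord1 expr0 mulr1 modc_int -intr_norm.
by rewrite -[1]/(1%:~R) ltr_int; case: (g 0%N) => [[|n]|n].
Qed.

Lemma psum_qpowM k f q N : psum (qpow int k * f) q (k + N) = q ^+ k * psum f q N.
Proof.
rewrite -[RHS]add0r /psum mulr_sumr [LHS]big_split_ord; congr (_ + _).
  by apply: big1 => i _; rewrite qpowME [nat_of_ord _]/= leqNgt ltn_ord mulr0z mul0r.
apply: eq_bigr => i _.
by rewrite qpowME [nat_of_ord _]/= leq_addr addKn exprD mulrCA.
Qed.

(** Once the coefficients below n vanish, division by q^n makes the n-th one a constant term, and
    dividing the limit by y^n keeps it 0. *)
Lemma tends_zero_fps0 f : (forall y : R, 0 < y -> y < 1 -> tends (psum f y%:C) 0) -> f = 0.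
Proof.
move=> h; have df := tends_zero_disc h; apply/fpsP => n.
elim/ltn_ind: n => n IH; pose g := progr 1 n f.
have gE : f = qpow int n * g.
  apply/fpsP => m; rewrite qpowME; case: leqP => [nm|mn]; last exact: IH.
  by rewrite /= mul1n subnK.
have -> : f n = g 0%N by rewrite /= muln0.
apply: disc_tends0_coef0 => [|y y0 y1]; first exact: disc_progr.
apply/tendsC => e e0; have yn0 : 0 < y ^+ n by rewrite exprn_gt0.
have /tendsC/(_ (y ^+ n * e))[|N hN] := h y y0 y1; first by rewrite mulr_gt0.
exists N => m Nm; have := hN (n + m)%N (leq_trans Nm (leq_addl _ _)).
rewrite gE psum_qpowM !sub0r !modcN modcM modcX modc_real gtr0_norm //.
by rewrite ltr_pM2l.
Qed.

Lemma modc_cexp (z : R[i]) : modc (cexp z) = expR (complex.Re z).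
Proof.
rewrite /cexp modcM modc_real gtr0_norm ?expR_gt0 //.
by rewrite /modc normc_def /= cos2Dsin2 sqrtr1 mulr1.
Qed.

Lemma nome_lt1 (tau : R[i]) : upper_half_plane tau -> modc (nome tau) < 1.
Proof.
case: tau => a b; rewrite /upper_half_plane /= => b0; rewrite /nome modc_cexp /=.
rewrite mul0r sub0r -expR0 ltr_expR oppr_lt0 mulr_gt0 // mulr_gt0 ?pi_gt0 //.
Qed.

(** [is_d5] speaks only of nomes; purely imaginary tau already reach all of (0, 1), which suffices
    for uniqueness. *)
Lemma nome_imag (y : R) : 0 < y -> y < 1 ->
  exists tau : R[i], upper_half_plane tau /\ nome tau = y%:C.
Proof.
move=> y0 y1; have p0 : 0 < 2 * pi :> R by rewrite mulr_gt0 ?pi_gt0.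
have tE : 2 * pi * (- ln y / (2 * pi)) = - ln y by rewrite mulrC divfK ?gt_eqF.
exists (0 +i* (- ln y / (2 * pi))); split.
  by rewrite /upper_half_plane /= divr_gt0 // oppr_gt0 ln_lt0 // y0.
rewrite /nome /cexp /= !mul0r mulr0 addr0 sub0r cos0 sin0 tE opprK lnK ?posrE //.
by rewrite mulr1.
Qed.

Lemma is_d5_unique (d : nat -> int) : is_d5 R d -> forall n, d n = d5f n.
Proof.
move=> hd n; suff /fpsP/(_ n) : Fps d - d5f = 0.
  by move=> /= /eqP; rewrite subr_eq0 => /eqP.
apply: tends_zero_fps0 => y y0 y1; have [tau [tau0 taq]] := nome_imag y0 y1.
have q1 : modc y%:C < 1 by rewrite modc_real gtr0_norm.
have := hd tau tau0; rewrite /= taq => /(@has_sum_psum R[i] (Fps d)) h1.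
have h2 := disc_tends disc_d5f q1; rewrite (evl_d5f q1) in h2.
have := tendsD h1 (tendsM (@tends_cst R[i] (-1)) h2); rewrite mulN1r subrr; congr tends.
apply: funext => N; rewrite /psum mulN1r -sumrN -big_split; apply: eq_bigr => i _.
by rewrite [RHS]/= rmorphB mulrBl.
Qed.

Lemma disc_finv_E1E5 : disc_summable R (finv (E 1 ^+ 3 * E 5)).
Proof.
by apply: disc_finvM; rewrite ?EX0 ?feuler0 //; [apply: disc_finv_feulerX | apply: disc_finv_feuler].
Qed.

Lemma disc_xq : disc_summable R xq.
Proof.
apply: discM disc_finv_E1E5; apply: discM; first exact: disc_qpow.
by apply: discM; [| apply: discX]; apply: disc_feuler.
Qed.

Lemma evl_xq (tau : R[i]) : upper_half_plane tau -> evl xq (nome tau) = x_fun tau.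
Proof.
move=> /nome_lt1; rewrite /x_fun /=; move: (nome tau) => q q1.
have key (A B C D : fps int) a b c d :
    A 0%N = 1 -> D 0%N = 1 -> disc_summable R A -> disc_summable R B -> disc_summable R C ->
      disc_summable R D ->
    disc_summable R (finv (A ^+ 3 * D)) ->
    evl A q = a -> evl B q = b -> evl C q = c -> evl D q = d ->
    evl (qpow int 1 * (B * C ^+ 3) * finv (A ^+ 3 * D)) q = q * (b * c ^+ 3 / (a ^+ 3 * d)).
  move=> A0 D0 dA dB dC dD di <- <- <- <-.
  have dA3 := discX 3 dA; have dC3 := discX 3 dC; have dq := @disc_qpow R 1.
  have dBC := discM dB dC3; have AD0 : (A ^+ 3 * D) 0%N = 1.
    by rewrite coef0M coef0X A0 D0 expr1n mulr1.
  rewrite (evlM (discM dq dBC) di q1) (evlM dq dBC q1) (evlM dB dC3 q1).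
  rewrite (evl_finv AD0 (discM dA3 dD) di q1) (evlM dA3 dD q1).
  by rewrite (evlX 3 dA q1) (evlX 3 dC q1) evl_qpow expr1 -[LHS]mulrA.
by apply: key => //; first [exact: feuler0 | exact: disc_feuler
  | exact: disc_finv_E1E5 | exact: evl_feuler].
Qed.

Lemma sum_series_progr (d : nat -> int) k l j q : (0 < k)%N -> disc_summable R (Fps d) ->
  modc q < 1 ->
  sum_series (fun n => (d (k * n + l)%N)%:~R * q ^+ (n + j)) =
  evl (qpow int j * progr k l (Fps d)) q.
Proof.
move=> k0 dd q1; have dp := disc_progr l k0 dd.
rewrite evlM // ?evl_qpow //; last exact: disc_qpow.
rewrite /sum_series seriesEord; apply: tends_lim.
have := tendsM (@tends_cst R[i] (q ^+ j)) (disc_tends dp q1); congr tends.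
apply: funext => N; rewrite /psum mulr_sumr; apply: eq_bigr => i _.
by rewrite [(_ + j)%N]addnC exprD [RHS]mulrCA.
Qed.

Lemma disc_Lf alpha : disc_summable R (Lf alpha).
Proof.
have dp k (l : nat) : disc_summable R (progr (5 ^ k) l d5f).
  by apply: disc_progr; rewrite ?expn_gt0 //; apply: disc_d5f.
rewrite /Lf; case: odd; apply: discM; first [by apply: discM; [by apply/disc_qpow | exact: dp] |
  by apply: discM; [by apply/discX/disc_feuler | exact: disc_finv_feulerX]].
Qed.

Lemma evl_Lf (d : nat -> int) alpha (tau : R[i]) : is_d5 R d -> upper_half_plane tau ->
  evl (Lf alpha) (nome tau) = L_fun d alpha tau.
Proof.
move=> /is_d5_unique hd /nome_lt1; rewrite /L_fun /=; move: (nome tau) => q q1.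
have -> : d = coefs d5f by apply: funext.
have dd : disc_summable R (Fps (coefs d5f)) by exact: disc_d5f.
have eta : Fps (coefs d5f) = d5f by apply/fpsP.
have k0 : (0 < 5 ^ alpha)%N by rewrite expn_gt0.
have key (A B S : fps int) a s : disc_summable R A -> disc_summable R B -> disc_summable R S ->
    evl (A * B) q = a -> s = evl S q -> evl (A * B * S) q = a * s.
  by move=> dA dB dS <- ->; rewrite (evlM (discM dA dB) dS q1).
have dS j : disc_summable R (qpow int j * progr (5 ^ alpha) (lambda_shift alpha) d5f).
  by apply: discM; [exact: disc_qpow | apply: disc_progr => //; exact: disc_d5f].
have hS j := sum_series_progr (lambda_shift alpha) j k0 dd q1.
rewrite eta in hS.
have dE j n : (0 < j)%N -> disc_summable R (E j ^+ n) by move=> j0; apply/discX/disc_feuler.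
have hE i m j n : (0 < i)%N -> (0 < j)%N ->
    evl (E i ^+ m * finv (E j ^+ n)) q = euler i q ^+ m / euler j q ^+ n.
  by move=> i0 j0; rewrite evl_quotient ?evl_feulerX //; apply: dE.
rewrite /Lf; case: odd; apply: key;
  by [apply: dE | apply: disc_finv_feulerX | apply: dS | apply: hE | apply: hS].
Qed.

End Evaluation.

Unset Implicit Arguments.

Theorem theorem1p2 (R : realType) (d5 : nat -> int) (hd5 : is_d5 R d5)
    (alpha : nat) (halpha : (1 <= alpha)%N) :
  in_int_poly_ring (@x_fun R)
    (fun tau : R[i] =>
       (1 + 5 * x_fun tau) ^+ psi_exp alpha / 5 ^+ beta_exp alpha * L_fun d5 alpha tau).
Proof.
have [P hP] := formal_theorem halpha; exists P => tau htau.
have q1 := nome_lt1 htau; have dx := @disc_xq R; have dL := @disc_Lf R alpha.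
rewrite -(evl_Lf alpha hd5 htau) -(evl_xq htau); move: (nome tau) q1 => q q1.
have c5 : disc_summable R 5 := @disc_int R 5.
have e5 : evl 5 q = 5 := @evl_int R 5 q.
have d5x := discM c5 dx; have d15x := discD (@disc1 R) d5x.
have nz : (5 : R[i]) ^+ beta_exp alpha != 0 by rewrite expf_neq0 // pnatr_eq0.
(* Multiplying by 5^beta turns the quotient in the statement into the formal identity [hP] evaluated
   at q. *)
apply: (mulfI nz); rewrite mulrA mulrCA mulfV // mulr1.
have := congr1 (fun f => evl f q) hP.
rewrite /hx (evlM (discX (psi_exp alpha) d15x) dL q1) (evlX (psi_exp alpha) d15x q1) (evlD (@disc1
  R) d5x q1).
rewrite (evlM c5 dx q1) evl1 e5 => ->.
by rewrite (evlM (discX (beta_exp alpha) c5) (disc_horner P dx) q1) (evlX (beta_exp alpha) c5 q1)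
  e5 (evl_horner P dx q1).
Qed.
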